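(* Let $\alpha\colon\mathbb{Z}_+^n\to\mathrm{End}(A)$ be a unital C*-dynamical system, let $\sigma$ be the action of $\mathbb{R}$ related to $\lambda\in\mathbb{R}^n$, i.e. $\sigma_t=\gamma_{(\exp(i\lambda_1t),\dots,\exp(i\lambda_nt))}$ on $\mathcal{NT}(A,\alpha)$ with the induced action on $\mathcal{NO}(A,\alpha)$ denoted by the same symbol, and let $\beta\in\mathbb{R}$ be such that $\lambda_k\beta>0$ for all $k=1,\dots,n$. Then there is an affine homeomorphism $\tau\mapsto\varphi_\tau$ (for the weak*-topologies) from the simplex of the tracial states on $A$ that vanish on $I_{\underline{1}}=\big(\bigcap_{i=1}^n\ker\alpha_i\big)^\perp$ onto the simplex of the $(\sigma,\beta)$-KMS states on $\mathcal{NO}(A,\alpha)$ such that $$\varphi_\tau(U_xaU_y^* )=\delta_{x,y}\cdot e^{-\langle x,\lambda\rangle\beta}\cdot\prod_{i=1}^n(1-e^{-\lambda_i\beta})\cdot\sum_{w\in\mathbb{Z}_+^n}e^{-\langle w,\lambda\rangle\beta}\,\tau(\alpha_w(a)),$$ for all $a\in A$ and $x,y\in\mathbb{Z}_+^n$.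
   Context: A C*-dynamical system over $\mathbb{Z}_+^n$ is a semigroup action $\alpha\colon\mathbb{Z}_+^n\to\mathrm{End}(A)$ by $*$-endomorphisms of a C*-algebra $A$; it is unital if $A$ is unital and every $\alpha_x$ is unital. Let $\mathbf{e}_1,\dots,\mathbf{e}_n$ be the standard generators of $\mathbb{Z}_+^n$; write $V_i=V_{\mathbf{e}_i}$, $\alpha_i=\alpha_{\mathbf{e}_i}$, and $\langle x,y\rangle=\sum_ix_iy_i$. For $x\in\mathbb{Z}_+^n$ let $\mathrm{supp}\,x=\{i: x_i\neq 0\}$ and $x^\perp=\{y\in\mathbb{Z}_+^n:\mathrm{supp}\,y\cap\mathrm{supp}\,x=\emptyset\}$. For an ideal $J$ of $A$ let $J^\perp=\{a\in A: aJ=\{0\}\}$. For $x\neq 0$ put $$I_x=\bigcap_{y\in x^\perp}\alpha_y^{-1}\Big(\big(\bigcap_{i\in\mathrm{supp}\,x}\ker\alpha_i\big)^\perp\Big),$$ and $I_0=\{0\}$; $\underline{1}=(1,\dots,1)$. An isometric Nica covariant pair $(\pi,V)$ on a Hilbert space $H$ consists of a $*$-representation $\pi\colon A\to\mathcal{B}(H)$ and a semigroup homomorphism $V$ of $\mathbb{Z}_+^n$ into the isometries on $H$ with $V_iV_j^*=V_j^*V_i$ for $i\neq j$, such that $\pi(a)V_i=V_i\pi(\alpha_i(a))$ for all $a\in A$ and all $i$. It is Cuntz-Nica covariant if moreover $\pi(a)\prod_{i\in\mathrm{supp}\,x}(I-V_iV_i^* )=0$ for all $x\in\mathbb{Z}_+^n$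 and $a\in I_x$. $\mathcal{NT}(A,\alpha)$ (resp. $\mathcal{NO}(A,\alpha)$) is the universal C*-algebra generated by the elements $V_x\pi(a)$ ($x\in\mathbb{Z}_+^n$, $a\in A$) over all isometric Nica covariant (resp. Cuntz-Nica covariant) pairs; $\mathcal{NO}(A,\alpha)$ is a quotient of $\mathcal{NT}(A,\alpha)$. The image of $V_x$ in $\mathcal{NO}(A,\alpha)$ is denoted $U_x$. $A$ embeds isometrically in both algebras (write $a$ for $\pi(a)$) and $1\in A$ is their unit. Both carry the gauge action $\gamma$ of $\mathbb{T}^n$ fixing $A$ and sending $V_x$ (resp. $U_x$) to $z_1^{x_1}\cdots z_n^{x_n}V_x$ (resp. $z_1^{x_1}\cdots z_n^{x_n}U_x$). For an action $\sigma$ of $\mathbb{R}$ on a C*-algebra $\mathcal{A}$, with $\mathcal{A}_{\mathrm{an}}$ the dense $*$-subalgebra of analytic elements (those $a$ for which $t\mapsto\sigma_t(a)$ extends to an entire function $z\mapsto\sigma_z(a)$), a state $\psi$ is a $(\sigma,\beta)$-KMS state if $\psi(ab)=\psi(b\sigma_{i\beta}(a))$ for all $a,b$ in a norm-dense $\sigma$-invariant $*$-subalgebra of $\mathcal{A}_{\mathrm{an}}$. *)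

(* Defs.v *)
From HB Require Import structures.
From mathcomp Require Import all_boot all_order all_algebra complex.
From mathcomp Require Import all_classical all_reals all_analysis.
From mathcomp.analysis.showcase Require summability.

Set Implicit Arguments.
Unset Strict Implicit.
Unset Printing Implicit Defensive.

Import Order.TTheory GRing.Theory Num.Theory.
Import numFieldNormedType.Exports.

Local Open Scope classical_set_scope.
Local Open Scope ring_scope.

(* R[i] seen as a numClosedFieldType: this is the form for which
   MathComp-Analysis provides the topology and the norm. The norm of a
   normedModType over Cx R takes its values in Cx R. *)
Definition Cx (R : realType) : numClosedFieldType := R[i].

Definition ofR (R : realType) (r : R) : Cx R := (r%:C)%C.

Definition expi (R : realType) (t : R) : Cx R := ofR (cos t) + 'i * ofR (sin t).

(* Unital C*-algebras; the zero algebra (1 = 0) is one of them. Hierarchy-Builder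
   cannot join normed modules and rings (a numDomainType is a normed module over
   itself), so the multiplication is part of the mixin, and the ring structure
   is declared below on the carrier of a cstarType. *)
HB.mixin Record isCstarAlgebra (R : realType) A
    of CompleteNormedModule (Cx R) A := {
  cone : A ;
  cmul : A -> A -> A ;
  star : A -> A ;
  cmulA : associative cmul ;
  cmul1l : left_id cone cmul ;
  cmul1r : right_id cone cmul ;
  cmulDl : left_distributive cmul +%R ;
  cmulDr : right_distributive cmul +%R ;
  cmulZl : forall (k : Cx R) (a b : A), cmul (k *: a) b = k *: cmul a b ;
  cmulZr : forall (k : Cx R) (a b : A), cmul a (k *: b) = k *: cmul a b ;
  cnormM : forall a b : A, `|cmul a b| <= `|a| * `|b| ;
  starK : involutive star ;
  starD : {morph star : a b / a + b} ;
  starZ : forall (k : Cx R) (a : A), star (k *: a) = k^* *: star a ;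
  cstarM : forall a b : A, star (cmul a b) = cmul (star b) (star a) ;
  cstar_identity : forall a : A, `|cmul (star a) a| = `|a| ^+ 2
}.

#[short(type="cstarType")]
HB.structure Definition CstarAlgebra (R : realType) :=
  {A of isCstarAlgebra R A & CompleteNormedModule (Cx R) A}.

HB.instance Definition _ (R : realType) (A : cstarType R) :=
  GRing.Zmodule_isPzRing.Build (CstarAlgebra.sort A)
    (@cmulA R A) (@cmul1l R A) (@cmul1r R A) (@cmulDl R A) (@cmulDr R A).

(* The axioms of the mixin in terms of the ring structure. *)
Section CstarRing.
Variables (R : realType) (A : cstarType R).
Implicit Types (a b : A) (k : Cx R).

Lemma mulcZl k a b : (k *: a) * b = k *: (a * b).
Proof. exact: cmulZl. Qed.

Lemma mulcZr k a b : a * (k *: b) = k *: (a * b).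
Proof. exact: cmulZr. Qed.

Lemma normcM_le a b : `|a * b| <= `|a| * `|b|.
Proof. exact: cnormM. Qed.

Lemma starM a b : star (a * b) = star b * star a.
Proof. exact: cstarM. Qed.

Lemma norm_starM a : `|star a * a| = `|a| ^+ 2.
Proof. exact: cstar_identity. Qed.

End CstarRing.

HB.mixin Record isHilbert (R : realType) H
    of CompleteNormedModule (Cx R) H := {
  dotp : H -> H -> Cx R ;
  dotp_linearl : forall y : H, scalar (dotp ^~ y) ;
  dotpC : forall x y : H, dotp y x = (dotp x y)^* ;
  dotp_norm : forall x : H, dotp x x = `|x| ^+ 2
}.

#[short(type="hilbertType")]
HB.structure Definition Hilbert (R : realType) :=
  {H of isHilbert R H & CompleteNormedModule (Cx R) H}.

Section StarAlgebras.
Variable R : realType.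
Implicit Types A B : cstarType R.

Definition star_hom A B (f : A -> B) : Prop :=
  [/\ linear f, {morph f : a b / a * b} & {morph f : a / star a}].

Definition star_subalg A (S : set A) : Prop :=
  [/\ S 0,
      forall (k : Cx R) a b, S a -> S b -> S (k *: a + b),
      forall a b, S a -> S b -> S (a * b)
    & forall a, S a -> S (star a)].

Definition is_adjoint (H : hilbertType R) (T S : H -> H) : Prop :=
  forall x y : H, dotp (T x) y = dotp x (S y).

(* Representations on H; they are allowed to be degenerate. *)
Definition star_rep A (H : hilbertType R) (pi : A -> H -> H) : Prop :=
  [/\ forall a, linear (pi a) /\ continuous (pi a),
      forall xi, linear (pi ^~ xi),
      forall a b, pi (a * b) = pi a \o pi b
    & forall a, is_adjoint (pi a) (pi (star a))].

Definition isometry (H : hilbertType R) (T : H -> H) : Prop :=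
  linear T /\ forall xi, `|T xi| = `|xi|.

Definition is_state A (psi : A -> Cx R) : Prop :=
  [/\ scalar psi, forall a, 0 <= psi (star a * a) & psi 1 = 1].

Definition tracial A (psi : A -> Cx R) : Prop :=
  forall a b, psi (a * b) = psi (b * a).

Definition annihilator A (J : set A) : set A :=
  [set a | forall b, J b -> a * b = 0].

End StarAlgebras.

Section KMS.
Variables (R : realType) (B : cstarType R) (sigma : R -> B -> B).

Definition entire (f : Cx R -> B) : Prop := forall z : Cx R, derivable f z 1.

Definition entire_extensions (a : B) : set (Cx R -> B) :=
  [set f | entire f /\ forall t : R, f (ofR t) = sigma t a].

Definition analytic : set B := [set a | entire_extensions a !=set0].

(* sigma_z(a), for a analytic and z complex *)
Definition analytic_ext (z : Cx R) (a : B) : B :=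
  xget (fun=> 0) (entire_extensions a) z.

Definition is_KMS (beta : R) (psi : B -> Cx R) : Prop :=
  is_state psi /\
  exists D : set B,
    [/\ star_subalg D, D `<=` analytic, dense D,
        forall t a, D a -> D (sigma t a)
      & forall a b, D a -> D b ->
          psi (a * b) = psi (b * analytic_ext ('i * ofR beta) a)].

End KMS.

(* Z_+^n, with the pointwise addition of finite functions *)
Notation Zplus n := {ffun 'I_n -> nat}.

Section DynamicalSystems.
Variables (R : realType) (n : nat).

Definition egen (i : 'I_n) : Zplus n := [ffun j => (i == j) : nat].

Definition ones : Zplus n := [ffun=> 1%N].

Definition pairing (x : Zplus n) (lam : 'I_n -> R) : R :=
  \sum_(i < n) (x i)%:R * lam i.

Definition supp (x : Zplus n) : set 'I_n := [set i | x i != 0%N].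

Definition orth (x : Zplus n) : set (Zplus n) :=
  [set y | supp y `&` supp x = set0].

Variables (A : cstarType R) (alpha : Zplus n -> A -> A).

Definition unital_dynamical_system : Prop :=
  [/\ forall x, star_hom (alpha x),
      forall x, alpha x 1 = 1,
      alpha 0 = idfun
    & forall x y, alpha (x + y) = alpha x \o alpha y].

Definition kernel_at (i : 'I_n) : set A := [set a | alpha (egen i) a = 0].

Definition I_ideal (x : Zplus n) : set A :=
  if x == 0 then [set 0] else
  \bigcap_(y in orth x)
    alpha y @^-1` annihilator (\bigcap_(i in supp x) kernel_at i).

Section Pairs.
Variable H : hilbertType R.

(* (pi, V) together with the adjoints V_x^*, which exist and are unique by the
   Riesz representation theorem *)
Record op_pair := OpPair {
  rep : A -> H -> H ;
  iso : Zplus n -> H -> H ;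
  iso_adj : Zplus n -> H -> H
}.

Definition nica_covariant (p : op_pair) : Prop :=
  let V i := iso p (egen i) in let Vs i := iso_adj p (egen i) in
  [/\ star_rep (rep p),
      [/\ forall x, isometry (iso p x),
          forall x, is_adjoint (iso p x) (iso_adj p x),
          iso p 0 = idfun
        & forall x y, iso p (x + y) = iso p x \o iso p y],
      forall i j, i != j -> V i \o Vs j = Vs j \o V i
    & forall a i, rep p a \o V i = V i \o rep p (alpha (egen i) a)].

(* prod_(i in supp x) (I - V_i V_i^* ); the factors commute for a Nica
   covariant pair *)
Definition defect_product (p : op_pair) (x : Zplus n) : H -> H :=
  \big[(fun S T : H -> H => S \o T)/idfun]_(i < n | x i != 0%N)
    (fun xi => xi - iso p (egen i) (iso_adj p (egen i) xi)).

Definition cuntz_nica_covariant (p : op_pair) : Prop :=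
  nica_covariant p /\
  forall x a, I_ideal x a -> rep p a \o defect_product p x = fun=> 0.

End Pairs.

(* (N, rho, v) is the universal C*-algebra generated by the elements
   V_x pi(a) over all pairs in the class P: N is generated by the
   v_x rho(a), it is faithfully represented by some pair in P, and every pair
   in P induces a representation of N. Since pi may be degenerate, a
   representation induced by (pi, V) is only required to send v_x rho(a) to
   V_x pi(a). *)
Definition universal_for (P : forall H : hilbertType R, op_pair H -> Prop)
    (N : cstarType R) (rho : A -> N) (v : Zplus n -> N) : Prop :=
  let represents H (p : op_pair H) (Theta : N -> H -> H) :=
    star_rep Theta /\
    forall x a, Theta (v x * rho a) = iso p x \o rep p a in
  [/\ rho 1 = 1 /\ v 0 = 1,
      forall S : set N, star_subalg S -> closed S ->
        (forall x a, S (v x * rho a)) -> S = setT,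
      exists (H : hilbertType R) (p : op_pair H) (Theta : N -> H -> H),
        [/\ P H p, represents H p Theta & injective Theta]
    & forall (H : hilbertType R) (p : op_pair H), P H p ->
        exists Theta : N -> H -> H, represents H p Theta].

Definition is_NT := universal_for nica_covariant.

Definition is_NO := universal_for cuntz_nica_covariant.

Definition torus : set ('I_n -> Cx R) := [set z | forall i, `|z i| = 1].

Definition gauge_action (N : cstarType R) (rho : A -> N) (v : Zplus n -> N)
    (gamma : ('I_n -> Cx R) -> N -> N) : Prop :=
  [/\ forall z, torus z -> star_hom (gamma z),
      gamma (fun=> 1) = idfun,
      forall z w, torus z -> torus w ->
        gamma (fun i => z i * w i) = gamma z \o gamma w,
      forall z a, torus z -> gamma z (rho a) = rho a
    & forall z x, torus z ->
        gamma z (v x) = (\prod_(i < n) z i ^+ x i) *: v x].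

Definition quotient_map (N : cstarType R) (rho : A -> N) (v : Zplus n -> N)
    (N' : cstarType R) (rho' : A -> N') (v' : Zplus n -> N')
    (q : N -> N') : Prop :=
  [/\ star_hom q, set_surj setT setT q,
      forall a, q (rho a) = rho' a & forall x, q (v x) = v' x].

(* the action related to lam *)
Definition flow (N : cstarType R) (gamma : ('I_n -> Cx R) -> N -> N)
    (lam : 'I_n -> R) (t : R) : N -> N :=
  gamma (fun k => expi (lam k * t)).

Definition tracial_states_on_quotient : set {ptws A -> Cx R} :=
  [set tau | [/\ is_state tau, tracial tau
               & forall a, I_ideal ones a -> tau a = 0]].

End DynamicalSystems.

Definition KMS_states (R : realType) (B : cstarType R) (sigma : R -> B -> B)
    (beta : R) : set {ptws B -> Cx R} :=
  [set psi | is_KMS sigma beta psi].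

(* The weak*-topology on a set of functionals is the topology of pointwise
   convergence, i.e. the one of {ptws _ -> _}. *)
Definition affine_homeomorphism (R : realType) (X Y : Type)
    (S : set {ptws X -> Cx R}) (T : set {ptws Y -> Cx R})
    (Phi : {ptws X -> Cx R} -> {ptws Y -> Cx R}) : Prop :=
  [/\ set_bij S T Phi,
      forall (s : R) f g, 0 <= s <= 1 -> S f -> S g ->
        Phi (fun x => ofR s * f x + ofR (1 - s) * g x) =
        (fun y => ofR s * Phi f y + ofR (1 - s) * Phi g y),
      {within S, continuous Phi}
    & exists Psi : {ptws Y -> Cx R} -> {ptws X -> Cx R},
        (forall f, S f -> Psi (Phi f) = f) /\ {within T, continuous Psi}].

(* e^{-<w,lam>beta} tau(alpha_w(a)) *)
Definition KMS_term (R : realType) (n : nat) (A : cstarType R)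
    (alpha : Zplus n -> A -> A) (lam : 'I_n -> R) (beta : R)
    (tau : A -> Cx R) (a : A) (w : Zplus n) : Cx R :=
  ofR (expR (- (pairing w lam * beta))) * tau (alpha w a).

(* Main.v *)
(* From a KMS state psi one recovers tau as the normalized corner trace
   a |-> psi (a Q_n) / prod_i (1 - e^{-lam_i beta}), where
   Q_k = prod_{i < k} (1 - U_i U_i^* ): the KMS condition gives
   psi (a Q_{i+1}) = psi (a Q_i) - e^{-lam_i beta} psi (alpha_i(a) Q_i). Iterating
   alpha_i, this recursion determines the values at Q_i by those at Q_{i+1}, so
   psi is determined by tau; and tau vanishes on I_1 because I_1 kills Q_n.
   Conversely, if the trace tau vanishes on I_1, then the Fock representation on
   the completion of the finitely supported functions f : Z_+^n -> A, with inner
   product sum_w tau (g(w)^* f(w)), is Cuntz-Nica covariant, and averaging its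
   vector states at delta_w with the weights e^{-<w,lam> beta} gives phi_tau.
   Since the KMS condition is only assumed on some dense subalgebra of analytic
   elements, it is first transported to the eigenvectors U_x a U_y^* of sigma by
   a contour argument on the strip between the real axis and i beta. *)

Require Import Defs.
From HB Require Import structures.
From mathcomp Require Import all_boot all_order all_algebra complex finmap.
From mathcomp Require Import all_classical all_reals all_analysis.
From mathcomp.analysis.showcase Require summability.
From mathcomp Require Import ring lra zify.
Set Implicit Arguments.
Unset Strict Implicit.
Unset Printing Implicit Defensive.
Import Order.TTheory GRing.Theory Num.Theory.
Import numFieldNormedType.Exports.
Local Open Scope classical_set_scope.
Local Open Scope ring_scope.

(** * Holomorphic functions on a strip *)

(** The subalgebra in the KMS condition need not contain any monomial, and norm closeness of [a] to
    an eigenvector [m] says nothing about the continuation of [a] at [i beta]. Real translations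
    bound the function on the whole strip, so its means over long horizontal edges agree, and on
    both edges these are controlled by norm closeness alone. The facts on entire functions behind
    this, potentials of closed forms and the identity theorem, are proved for functions that are
    merely differentiable at each point.

    On monomials one mechanism recurs: the KMS condition reproduces a quantity with a factor below 1
    and some [alpha w] applied to its argument, while all these values stay bounded because a state
    composed with [alpha w] is again a state; so the quantity is zero. This kills the values at
    monomials with [x != y] and the difference of two states with equal corner traces.

    That [tau] vanishes on the single ideal [I_1] is enough for every [I_x]: the defect of the Fock
    representation at [x] leaves only points [p] orthogonal to [x], and there [alpha p] maps [I_x]
    into [I_1]. *)

Section RealAnalysis.
Variable R : realType.
Implicit Types (x y h k e d a b : R) (f g m n G : R -> R -> R).

Lemma MVT_bound (F f : R -> R) x x' c e :
  (forall t, Num.min x x' <= t <= Num.max x x' ->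
     is_derive t 1 F (f t) /\ `|f t - c| <= e) ->
  `|F x' - F x - c * (x' - x)| <= e * `|x' - x|.
Proof.
move=> dF.
wlog xx' : x x' dF / x <= x' => [W|].
  have [xx'|x'x] := leP x x'; first exact: W.
  rewrite (distrC x' x) -[leLHS]normrN.
  have -> : - (F x' - F x - c * (x' - x)) = F x - F x' - c * (x - x') by ring.
  by apply: W (ltW x'x) => t; rewrite minC maxC; exact: dF.
have [tl|] := eqVneq x x'; first by rewrite tl !subrr mulr0 subr0 normr0 mulr0.
move=> nxx'; have ltx : x < x' by rewrite lt_neqAle nxx'.
rewrite (min_idPl xx') (max_idPr xx') in dF.
have [||t tx ->] := @MVT R F f x x' ltx.
- by move=> t; rewrite in_itv/= => /andP[? ?]; apply: (dF t _).1; rewrite !ltW.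
- apply: derivable_within_continuous => t; rewrite in_itv/= => tx.
  exact: (@ex_derive _ _ _ _ _ _ _ (dF t tx).1).
rewrite -mulrBl normrM ler_wpM2r//; apply: (dF t _).2.
by move: tx; rewrite in_itv/= => /andP[? ?]; rewrite !ltW.
Qed.

(** The integral from the fixed base point [a] has a two-sided derivative only to the right of [a];
    this is the origin of the hypotheses [a < x] below and of base points placed left of the region
    of interest. *)
Lemma antiderivative (f : R -> R) a : continuous f ->
  exists F : R -> R, forall x, a < x -> is_derive x 1 F (f x).
Proof.
move=> cf; exists (fun x => \int[lebesgue_measure]_(t in [set` `[a, x]]) f t)%R => x ax.
have [] := @continuous_FTC1_closed R f a x (x + 1) _ _ ax (cf x).
- by rewrite ltrDl.
- apply: continuous_compact_integrable; first exact: segment_compact.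
  exact: continuous_subspaceT.
- by move=> df; rewrite derive1E => <-; exact: DeriveDef.
Qed.

(* Frechet differentiability of [f] at [(x, y)], with partial derivatives [a]
   and [b]. *)
Definition D2 f x y a b := forall e : R, 0 < e -> exists2 d : R, 0 < d &
  forall h k, `|h| < d -> `|k| < d ->
    `|f (x + h) (y + k) - f x y - (a * h + b * k)| <= e * (`|h| + `|k|).

Lemma is_derive_eps (F : R -> R) x a :
  (forall e : R, 0 < e -> exists2 d : R, 0 < d & forall h, `|h| < d ->
     `|F (x + h) - F x - a * h| <= e * `|h|) -> is_derive x 1 F a.
Proof.
move=> HF.
have cF : (fun h => h^-1 *: (F (h *: 1 + x) - F x)) @ 0^' --> a.
  apply/cvgrPdist_le => e e0; have [d d0 Hd] := HF _ e0.
  apply/nbhs_ballP; exists d => //= h; rewrite /ball/= sub0r normrN => hd h0.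
  have h0' : 0 < `|h| by rewrite normr_gt0.
  rewrite -(ler_pM2r h0') -normrM.
  have := Hd _ hd; rewrite -normrN; congr (`|_| <= _).
  rewrite /GRing.scale/= mulr1 (addrC h x) mulrBl mulrAC mulVf// mul1r; ring.
split; last exact/cvg_lim.
by apply/cvg_ex; exists a.
Qed.

Lemma is_derive_epsE (F : R -> R) x a : is_derive x 1 F a ->
  forall e : R, 0 < e -> exists2 d : R, 0 < d & forall h, `|h| < d ->
     `|F (x + h) - F x - a * h| <= e * `|h|.
Proof.
move=> [dF <-] e e0; move/cvgrPdist_le : dF => /(_ e e0)/nbhs_ballP[d /= d0 Hd].
exists d => // h hd; have [->|h0] := eqVneq h 0.
  by rewrite addr0 mulr0 !subrr normr0 mulr0.
have /= := Hd h; rewrite /ball/= sub0r normrN => /(_ hd h0).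
have h0' : 0 < `|h| by rewrite normr_gt0.
rewrite -(ler_pM2r h0') -normrM -normrN; congr (`|_| <= _).
rewrite /GRing.scale/= mulr1 (addrC h x) mulrBl mulrAC mulVf// mul1r.
by rewrite opprB; congr (_ - _ * h).
Qed.

Lemma D2_dx f x y a b : D2 f x y a b -> is_derive x 1 (f^~ y) a.
Proof.
move=> D; apply: is_derive_eps => e /D[d d0 Hd]; exists d => // h hd.
by have := Hd h 0 hd; rewrite normr0 => /(_ d0); rewrite !addr0 mulr0 addr0.
Qed.

Lemma D2_dy f x y a b : D2 f x y a b -> is_derive y 1 (f x) b.
Proof.
move=> D; apply: is_derive_eps => e /D[d d0 Hd]; exists d => // h hd.
by have := Hd 0 h; rewrite normr0 => /(_ d0 hd); rewrite !addr0 mulr0 !add0r.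
Qed.

Lemma D2_lip f x y a b : D2 f x y a b -> exists2 d : R, 0 < d &
  forall h k, `|h| < d -> `|k| < d ->
    `|f (x + h) (y + k) - f x y| <= (1 + `|a| + `|b|) * (`|h| + `|k|).
Proof.
move=> /(_ 1 ltr01)[d d0 Hd]; exists d => // h k hd kd.
rewrite -(subrK (a * h + b * k) (_ - _)); apply: (le_trans (ler_normD _ _)).
rewrite -(addrA 1) (mulrDl 1); apply: lerD; first exact: Hd.
apply: (le_trans (ler_normD _ _)); rewrite !normrM; have := normr_ge0 a; have := normr_ge0 b.
have := normr_ge0 h; have := normr_ge0 k; nra.
Qed.

Lemma D2_cont f x y a b : D2 f x y a b -> forall e : R, 0 < e ->
  exists2 d : R, 0 < d & forall h k, `|h| < d -> `|k| < d ->
    `|f (x + h) (y + k) - f x y| <= e.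
Proof.
move=> /D2_lip[d d0 Hd] e e0.
have c0 : 0 < 1 + `|a| + `|b| by rewrite -addrA ltr_pwDl// addr_ge0.
set c := 1 + _ + _ in Hd c0.
exists (Num.min d (e / (2 * c))); first by rewrite lt_min d0 divr_gt0// mulr_gt0.
move=> h k; rewrite !lt_min => /andP[hd he] /andP[kd ke].
apply: (le_trans (Hd _ _ hd kd)).
rewrite mulrC -ler_pdivlMr//.
have -> : e / c = e / (2 * c) + e / (2 * c) by field; rewrite gt_eqF.
by rewrite lerD// ltW.
Qed.

Lemma D2D f g x y a b a' b' : D2 f x y a b -> D2 g x y a' b' ->
  D2 (fun x y => f x y + g x y) x y (a + a') (b + b').
Proof.
move=> Df Dg e e0; have e20 : 0 < e / 2 by rewrite divr_gt0.
have [d d0 Hd] := Df _ e20; have [d' d'0 Hd'] := Dg _ e20.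
exists (Num.min d d'); first by rewrite lt_min d0.
move=> h k; rewrite !lt_min => /andP[hd hd'] /andP[kd kd'].
have -> : e * (`|h| + `|k|) = e / 2 * (`|h| + `|k|) + e / 2 * (`|h| + `|k|) by field.
apply: le_trans (lerD (Hd _ _ hd kd) (Hd' _ _ hd' kd')).
by apply: le_trans (ler_normD _ _); rewrite le_eqVlt; apply/orP; left; apply/eqP; congr (`|_|); ring.
Qed.

Lemma D2M f g x y a b a' b' : D2 f x y a b -> D2 g x y a' b' ->
  D2 (fun x y => f x y * g x y) x y
     (a * g x y + f x y * a') (b * g x y + f x y * b').
Proof.
move=> Df Dg e e0; set c := `|f x y| + `|g x y| + 1.
have c0 : 0 < c by rewrite ltr_wpDl// addr_ge0.
have e20 : 0 < e / (2 * c) by rewrite divr_gt0// mulr_gt0.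
have [d d0 Hd] := Df _ e20; have [d' d'0 Hd'] := Dg _ e20.
have [d1 d10 Hd1] := D2_lip Df.
set s := 1 + `|a| + `|b| in Hd1.
have s0 : 0 < s by rewrite /s -addrA ltr_pwDl// addr_ge0.
have e30 : 0 < e / (2 * s) by rewrite divr_gt0// mulr_gt0.
have [d3 d30 Hd3] := D2_cont Dg e30.
exists (Num.min (Num.min d d') (Num.min d1 d3)); first by rewrite !lt_min d0 d'0 d10.
move=> h k; rewrite !lt_min => /andP[/andP[hd hd'] /andP[h1 h3]].
move=> /andP[/andP[kd kd'] /andP[k1 k3]].
have := Hd _ _ hd kd; have := Hd' _ _ hd' kd'.
have := Hd1 _ _ h1 k1; have := Hd3 _ _ h3 k3.
set F := f _ _; set Gg := g (x + h) _; set f0 := f x y; set g0 := g x y.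
set A := a * h + _; set B := a' * h + _; set t := `|h| + `|k|.
move=> H3 H1 H2 H4.
(* First-order errors of [f] and of [g], each against the value of the other factor, plus the
   product of the two increments; [c] and [s] split [e] evenly between the linear errors and this
   product. *)
have -> : F * Gg - f0 * g0 - ((a * g0 + f0 * a') * h + (b * g0 + f0 * b') * k) =
  (F - f0 - A) * g0 + f0 * (Gg - g0 - B) + (F - f0) * (Gg - g0).
  by rewrite /A /B; ring.
apply: (le_trans (ler_normD _ _)).
have -> : e * t = e / (2 * c) * t * c + s * t * (e / (2 * s)).
  by field; rewrite !gt_eqF.
apply: lerD; last by rewrite normrM ler_pM.
apply: (le_trans (ler_normD _ _)); rewrite !normrM.
have t0 : 0 <= e / (2 * c) * t by apply: mulr_ge0; [exact: ltW|exact: addr_ge0].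
apply: (@le_trans _ _ (e / (2 * c) * t * `|g0| + e / (2 * c) * t * `|f0|)).
  by rewrite lerD// ?ler_wpM2r// mulrC ler_wpM2r.
by rewrite -mulrDr ler_wpM2l// /c; lra.
Qed.

Lemma D2_cst c x y : D2 (fun _ _ => c) x y 0 0.
Proof.
move=> e e0; exists 1 => // h k _ _.
by rewrite !mul0r subrr addr0 subr0 normr0 mulr_ge0 ?addr_ge0// ltW.
Qed.

Lemma D2N f x y a b : D2 f x y a b ->
  D2 (fun x y => - f x y) x y (- a) (- b).
Proof.
move=> D e /D[d d0 Hd]; exists d => // h k hd kd.
by have := Hd _ _ hd kd; rewrite -normrN; congr (`|_| <= _); ring.
Qed.

Lemma D2_x (u : R -> R) x y a : is_derive x 1 u a -> D2 (fun x _ => u x) x y a 0.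
Proof.
move=> /is_derive_epsE D e e0; have [d d0 Hd] := D _ e0; exists d => // h k hd _.
rewrite mul0r addr0; apply: le_trans (Hd _ hd) _.
by rewrite ler_wpM2l ?(ltW e0)// lerDl.
Qed.

Lemma D2_y (u : R -> R) x y a : is_derive y 1 u a -> D2 (fun _ y => u y) x y 0 a.
Proof.
move=> /is_derive_epsE D e e0; have [d d0 Hd] := D _ e0; exists d => // h k _ kd.
rewrite mul0r add0r; apply: le_trans (Hd _ kd) _.
by rewrite ler_wpM2l ?(ltW e0)// lerDr.
Qed.

End RealAnalysis.

(** * Goursat's lemma and potentials of closed forms *)

Section Goursat.
Variable R : realType.
Variables (m n : R -> R -> R) (a : R).
Hypothesis closed : forall x y, exists p q r, D2 m x y p q /\ D2 n x y q r.

Lemma closed_cont_x (y : R) : continuous (m^~ y).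
Proof.
move=> x; have [p [q [r [Dm _]]]] := closed x y.
exact/differentiable_continuous/derivable1_diffP/(@ex_derive _ _ _ _ _ _ _ (D2_dx Dm)).
Qed.

Lemma closed_cont_y (x : R) : continuous (n x).
Proof.
move=> y; have [p [q [r [_ Dn]]]] := closed x y.
exact/differentiable_continuous/derivable1_diffP/(@ex_derive _ _ _ _ _ _ _ (D2_dy Dn)).
Qed.

Variables P Q : R -> R -> R.
Hypothesis dP : forall y x, a < x -> is_derive x 1 (P y) (m x y).
Hypothesis dQ : forall x y, a < y -> is_derive y 1 (Q x) (n x y).

(** The counterclockwise loop integral of [m dx + n dy] around the rectangle, each side being
    evaluated by an antiderivative. The partial derivatives in [closed] may be discontinuous, which
    rules out Green's formula. *)
Let rect x0 x1 y0 y1 : R :=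
  (P y0 x1 - P y0 x0) + (Q x1 y1 - Q x1 y0)
  - (P y1 x1 - P y1 x0) - (Q x0 y1 - Q x0 y0).

(** The linear part of the form at [(x, y)] has a symmetric matrix, hence a vanishing loop integral;
    what is left is an error [e * (w + l)] integrated along a perimeter of order [w + l]. *)
Let rect_local x y (e : R) : 0 < e -> exists2 d : R, 0 < d &
  forall x0 y0 w l : R, a < x0 -> a < y0 -> 0 <= w < d -> 0 <= l < d ->
    x0 <= x <= x0 + w -> y0 <= y <= y0 + l ->
    `|rect x0 (x0 + w) y0 (y0 + l)| <= 4 * e * (w + l) ^+ 2.
Proof.
move=> e0; have [p [q [r [Dm Dn]]]] := closed x y.
have [d d0 Hd] := Dm _ e0; have [d' d'0 Hd'] := Dn _ e0.
exists (Num.min d d'); first by rewrite lt_min d0.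
move=> x0 y0 w l ax ay; rewrite !lt_min => /andP[w0 /andP[wd wd']] /andP[l0 /andP[ld ld']].
move=> /andP[x0x xx1] /andP[y0y yy1].
have near_m t s : x0 <= t <= x0 + w -> y0 <= s <= y0 + l ->
    `|m t s - m x y - (p * (t - x) + q * (s - y))| <= e * (w + l).
  move=> /andP[t0 t1] /andP[s0 s1].
  have tw : `|t - x| <= w by rewrite ler_norml; lra.
  have sl : `|s - y| <= l by rewrite ler_norml; lra.
  have := Hd (t - x) (s - y) (le_lt_trans tw wd) (le_lt_trans sl ld).
  rewrite (addrC x) (addrC y) !subrK => H; apply: (le_trans H).
  by rewrite ler_wpM2l ?(ltW e0)// lerD.
have near_n t s : x0 <= t <= x0 + w -> y0 <= s <= y0 + l ->
    `|n t s - n x y - (q * (t - x) + r * (s - y))| <= e * (w + l).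
  move=> /andP[t0 t1] /andP[s0 s1].
  have tw : `|t - x| <= w by rewrite ler_norml; lra.
  have sl : `|s - y| <= l by rewrite ler_norml; lra.
  have := Hd' (t - x) (s - y) (le_lt_trans tw wd') (le_lt_trans sl ld').
  rewrite (addrC x) (addrC y) !subrK => H; apply: (le_trans H).
  by rewrite ler_wpM2l ?(ltW e0)// lerD.
have x01 : x0 <= x0 + w by rewrite lerDl.
have y01 : y0 <= y0 + l by rewrite lerDl.
have HP := @MVT_bound R (P y0 \- P (y0 + l)) (fun t => m t y0 - m t (y0 + l))
  x0 (x0 + w) (- (q * l)) (2 * e * (w + l)).
have HQ := @MVT_bound R (Q (x0 + w) \- Q x0) (fun t => n (x0 + w) t - n x0 t)
  y0 (y0 + l) (q * w) (2 * e * (w + l)).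
have {}HP : `|(P y0 \- P (y0 + l)) (x0 + w) - (P y0 \- P (y0 + l)) x0 - - (q * l) * w|
    <= 2 * e * (w + l) * w.
  rewrite (_ : x0 + w - x0 = w) in HP; last by ring.
  rewrite -[X in _ <= _ * X](ger0_norm w0).
  apply: HP => t; rewrite (min_idPl x01) (max_idPr x01) => tx.
  have at_ : a < t by case/andP: tx => ? _; apply: lt_le_trans ax _.
  split; first by apply: is_deriveB; exact: dP.
  have H1 := near_m t y0 tx; have H2 := near_m t (y0 + l) tx.
  rewrite -(_ : (m t y0 - m x y - (p * (t - x) + q * (y0 - y))) -
    (m t (y0 + l) - m x y - (p * (t - x) + q * ((y0 + l) - y)))
    = m t y0 - m t (y0 + l) - - (q * l)); last by ring.
  apply: (le_trans (ler_normB _ _)).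
  rewrite -(_ : e * (w + l) + e * (w + l) = 2 * e * (w + l)); last by ring.
  by rewrite lerD// ?H1 ?H2// ?lexx ?y01.
have {}HQ : `|(Q (x0 + w) \- Q x0) (y0 + l) - (Q (x0 + w) \- Q x0) y0 - (q * w) * l|
    <= 2 * e * (w + l) * l.
  rewrite (_ : y0 + l - y0 = l) in HQ; last by ring.
  rewrite -[X in _ <= _ * X](ger0_norm l0).
  apply: HQ => t; rewrite (min_idPl y01) (max_idPr y01) => ty.
  have at_ : a < t by case/andP: ty => ? _; apply: lt_le_trans ay _.
  split; first by apply: is_deriveB; exact: dQ.
  have H1 := near_n (x0 + w) t _ ty; have H2 := near_n x0 t _ ty.
  rewrite -(_ : (n (x0 + w) t - n x y - (q * ((x0 + w) - x) + r * (t - y))) -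
    (n x0 t - n x y - (q * (x0 - x) + r * (t - y)))
    = n (x0 + w) t - n x0 t - (q * w)); last by ring.
  apply: (le_trans (ler_normB _ _)).
  rewrite -(_ : e * (w + l) + e * (w + l) = 2 * e * (w + l)); last by ring.
  by rewrite lerD// ?H1 ?H2// ?lexx ?x01.
(* The corrections by [(q * l) * w] and [(q * w) * l] cancel: this is where the equality of the
   mixed partial derivatives enters. *)
have -> : rect x0 (x0 + w) y0 (y0 + l) =
  ((P y0 \- P (y0 + l)) (x0 + w) - (P y0 \- P (y0 + l)) x0 - - (q * l) * w) +
  ((Q (x0 + w) \- Q x0) (y0 + l) - (Q (x0 + w) \- Q x0) y0 - (q * w) * l).
  by rewrite /rect /=; ring.
apply: (le_trans (ler_normD _ _)); apply: (le_trans (lerD HP HQ)).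
have : 0 <= e * (w + l) ^+ 2 by rewrite mulr_ge0 ?sqr_ge0// ltW.
by rewrite expr2; nra.
Qed.

(* Bisection: each step keeps a quarter of the rectangle carrying at least a
   quarter of the loop integral; the corners converge to a point that
   contradicts [rect_local]. *)
Let rect_ge0 x0 y0 w l : a < x0 -> a < y0 -> 0 <= w -> 0 <= l ->
  rect x0 (x0 + w) y0 (y0 + l) = 0.
Proof.
move=> ax ay w0 l0; apply: contrapT => /eqP; rewrite -normr_gt0.
set N := `|_| => N0.
pose half k (u : R) := u / 2 ^+ k.
have half0 k u : 0 <= u -> 0 <= half k u.
  by move=> u0; rewrite /half divr_ge0// exprn_ge0.
have halfS k u : half k u = half k.+1 u + half k.+1 u.
  by rewrite /half exprS; field; rewrite expf_neq0.
pose rk k (z : R * R) := rect z.1 (z.1 + half k w) z.2 (z.2 + half k l).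
pose next k (z z' : R * R) :=
  (z'.1 = z.1 \/ z'.1 = z.1 + half k.+1 w) /\
  (z'.2 = z.2 \/ z'.2 = z.2 + half k.+1 l) /\
  `|rk k z| / 4 <= `|rk k.+1 z'|.
have nextP (kz : nat * (R * R)) : exists z', next kz.1 kz.2 z'.
  case: kz => k z /=; set w' := half k.+1 w; set l' := half k.+1 l.
  have E : rk k z = rk k.+1 z + rk k.+1 (z.1 + w', z.2) +
      rk k.+1 (z.1, z.2 + l') + rk k.+1 (z.1 + w', z.2 + l').
    rewrite /rk (halfS k w) (halfS k l) -/w' -/l' /rect /= -!addrA; ring.
  have := ler_normD (rk k.+1 z + rk k.+1 (z.1 + w', z.2) + rk k.+1 (z.1, z.2 + l'))
     (rk k.+1 (z.1 + w', z.2 + l')).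
  have := ler_normD (rk k.+1 z + rk k.+1 (z.1 + w', z.2)) (rk k.+1 (z.1, z.2 + l')).
  have := ler_normD (rk k.+1 z) (rk k.+1 (z.1 + w', z.2)).
  rewrite -E => H1 H2 H3.
  have [A|A] := leP (`|rk k z| / 4) `|rk k.+1 z|.
    by exists z; split; [left|split; [left|]].
  have [B|B] := leP (`|rk k z| / 4) `|rk k.+1 (z.1 + w', z.2)|.
    by exists (z.1 + w', z.2); split; [right|split; [left|]].
  have [C|C] := leP (`|rk k z| / 4) `|rk k.+1 (z.1, z.2 + l')|.
    by exists (z.1, z.2 + l'); split; [left|split; [right|]].
  exists (z.1 + w', z.2 + l'); split; [by right|split; [by right|]].
  lra.
have [f fP] := choice nextP.
pose z := fix z k := if k is k'.+1 then f (k', z k') else (x0, y0).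
have zS k : next k (z k) (z k.+1) by exact: fP.
have rz k : N / 4 ^+ k <= `|rk k (z k)|.
  elim: k => [|k IH]; first by rewrite expr0 divr1 /rk /half !divr1.
  have [_ [_]] := zS k; apply: le_trans.
  rewrite exprS (_ : N / _ = N / 4 ^+ k / 4) ?ler_wpM2r//.
  by field; rewrite expf_neq0.
(* Nested intervals: the left endpoints increase, the right ones decrease, and the supremum of the
   left endpoints lies in all of them. *)
have lim1 (u : nat -> R) v : 0 <= v ->
    (forall k, u k.+1 = u k \/ u k.+1 = u k + half k.+1 v) ->
    exists t, forall k, u k <= t <= u k + half k v.
  move=> v0 uS.
  have mono k j : u k <= u (k + j)%N.
    elim: j => [|j IH]; first by rewrite addn0.
    rewrite addnS; apply: (le_trans IH).
    by case: (uS (k + j)%N) => ->; rewrite ?lerDl ?half0.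
  have bnd k j : u (k + j)%N + half (k + j)%N v <= u k + half k v.
    elim: j => [|j IH]; first by rewrite addn0.
    rewrite addnS; apply: le_trans IH.
    have := half0 (k + j).+1 _ v0; rewrite (halfS (k + j)%N v).
    by case: (uS (k + j)%N) => ->; lra.
  have ub k j : u j <= u k + half k v.
    have [kj|jk] := leqP k j.
      rewrite -(subnKC kj); apply: le_trans (bnd k (j - k)%N).
      by rewrite lerDl half0.
    rewrite -(subnKC (ltnW jk)); apply: (le_trans (mono j (k - j)%N)).
    by rewrite lerDl half0.
  have hs : has_sup (range u).
    split; first by exists (u 0%N), 0%N.
    by exists (u 0%N + half 0 v) => _ [j _ <-]; exact: ub.
  exists (sup (range u)) => k; apply/andP; split.
    by apply: sup_ubound; [exact: hs.2|exists k].
  by apply: sup_le_ub; [exact: hs.1|move=> _ [j _ <-]; exact: ub].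
have [x Hx] := lim1 (fun k => (z k).1) w w0 (fun k => (zS k).1).
have [y Hy] := lim1 (fun k => (z k).2) l l0 (fun k => (zS k).2.1).
(* At stage [k] the bound of [rect_local] and the lower bound [N / 4 ^+ k] both scale by [4 ^- k];
   this [e] makes the former the smaller one, since [4 * e * (w + l) ^+ 2 < N]. *)
pose e := N / (8 * ((w + l) ^+ 2 + 1)).
have s0 : 0 < (w + l) ^+ 2 + 1 by rewrite ltr_wpDl// sqr_ge0.
have e0 : 0 < e by rewrite divr_gt0// mulr_gt0.
have [d d0 Hd] := rect_local x y e0.
have corner k : x0 <= (z k).1 /\ y0 <= (z k).2.
  elim: k => [//|k [IH1 IH2]]; have [z1 [z2 _]] := zS k.
  split; [case: z1 => ->//|case: z2 => ->//].
    by rewrite (le_trans IH1)// lerDl half0.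
  by rewrite (le_trans IH2)// lerDl half0.
have [k kd] : exists k, half k (w + l) < d.
  exists (Num.truncn ((w + l) / d)).+1.
  rewrite /half ltr_pdivrMr ?exprn_gt0// mulrC -ltr_pdivrMr//.
  apply: (@lt_trans _ _ (Num.truncn ((w + l) / d)).+1%:R); first exact: truncnS_gt.
  by rewrite -natrX ltr_nat ltn_expl.
have halfD : half k (w + l) = half k w + half k l by rewrite /half mulrDl.
have /= Hk := Hd (z k).1 (z k).2 (half k w) (half k l).
have := rz k; rewrite leNgt => /negP; apply.
apply: (@le_lt_trans _ _ (4 * e * (half k w + half k l) ^+ 2)).
  apply: Hk; rewrite ?Hx ?Hy ?half0//=.
  - exact: lt_le_trans (corner k).1.
  - exact: lt_le_trans (corner k).2.
  - by apply: le_lt_trans kd; rewrite halfD lerDl half0.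
  - by apply: le_lt_trans kd; rewrite halfD lerDr half0.
rewrite -halfD /half expr_div_n -exprM mulnC exprM (_ : 2 ^+ 2 = 4); last by rewrite -natrX.
rewrite mulrA ltr_pM2r ?invr_gt0 ?exprn_gt0//.
rewrite /e (_ : 4 * _ * _ = N * ((w + l) ^+ 2 / (2 * ((w + l) ^+ 2 + 1)))); last first.
  by field; rewrite gt_eqF.
rewrite gtr_pMr// ltr_pdivrMr ?mulr_gt0// mul1r.
by have := sqr_ge0 (w + l); lra.
Qed.

Lemma rect_eq0 x0 x1 y0 y1 : a < x0 -> a < x1 -> a < y0 -> a < y1 ->
  rect x0 x1 y0 y1 = 0.
Proof.
move=> ax0 ax1 ay0 ay1.
wlog : x0 x1 ax0 ax1 / x0 <= x1 => [W|lex].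
  have [|/ltW] := leP x0 x1; first exact: W.
  by move=> /W -/(_ ax1 ax0) H; rewrite -[RHS]oppr0 -H /rect; ring.
wlog : y0 y1 ay0 ay1 / y0 <= y1 => [W|ley].
  have [|/ltW] := leP y0 y1; first exact: W.
  by move=> /W -/(_ ay1 ay0) H; rewrite -[RHS]oppr0 -H /rect; ring.
have := @rect_ge0 x0 y0 (x1 - x0) (y1 - y0) ax0 ay0.
by rewrite !subr_ge0 (addrC x0) (addrC y0) !subrK; apply.
Qed.

End Goursat.

(** The potential integrates the form horizontally at height [b] and then vertically up to [(x, y)];
    the base point is [a + 1] because the antiderivatives are only controlled to the right of
    [a]. *)
Lemma closed_form_potential (R : realType) (m n : R -> R -> R) (a : R) :
  (forall x y, exists p q r, D2 m x y p q /\ D2 n x y q r) ->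
  exists G : R -> R -> R, forall x y, a < x -> a < y -> D2 G x y (m x y) (n x y).
Proof.
move=> closed.
have [P dP] := choice (fun y => antiderivative a (@closed_cont_x R m n closed y)).
have [Q dQ] := choice (fun x => antiderivative a (@closed_cont_y R m n closed x)).
set b := a + 1.
have ab : a < b by rewrite ltrDl.
exists (fun x y => (P b x - P b b) + (Q x y - Q x b)) => x y ax ay e e0.
have [p [q [r [Dm Dn]]]] := closed x y.
have [d d0 Hd] := D2_cont Dm e0; have [d' d'0 Hd'] := D2_cont Dn e0.
exists (Num.min (Num.min d d') (Num.min (x - a) (y - a))).
  by rewrite !lt_min d0 d'0 !subr_gt0 ax.
move=> h k; rewrite !lt_min => /andP[/andP[hd hd'] /andP[hx hy]].
move=> /andP[/andP[kd kd'] /andP[kx ky]].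
have axh : a < x + h by move: hx; rewrite ltr_norml; lra.
have ayk : a < y + k by move: ky; rewrite ltr_norml; lra.
(* The loop over [[x, x + h] x [b, y]] moves the horizontal increment from height [b] to height [y],
   next to the point where [m] is known to be continuous. *)
have rect0 := rect_eq0 closed dP dQ ax axh ab ay.
have -> : P b (x + h) - P b b + (Q (x + h) (y + k) - Q (x + h) b)
   - (P b x - P b b + (Q x y - Q x b)) - (m x y * h + n x y * k) =
   (P y (x + h) - P y x - m x y * (x + h - x)) +
   (Q (x + h) (y + k) - Q (x + h) y - n x y * (y + k - y)).
  by apply/eqP; rewrite -subr_eq0 -rect0; apply/eqP; ring.
apply: (le_trans (ler_normD _ _)); rewrite (mulrDr e); apply: lerD.
  have {3}-> : h = x + h - x by ring.
  apply: (@MVT_bound R (P y) (fun t => m t y)) => t tx; split.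
    by apply: dP; apply: lt_le_trans (andP tx).1; rewrite lt_min ax.
  have -> : t = x + (t - x) by ring.
  rewrite -{1}(addr0 y); apply: Hd; last by rewrite normr0.
  apply: le_lt_trans hd; move: tx; rewrite ge_min le_max.
  by case: (ger0P h) => h0 /andP[/orP[] ? /orP[] ?]; rewrite ler_norml; lra.
have {3}-> : k = y + k - y by ring.
apply: (@MVT_bound R (Q (x + h)) (fun t => n (x + h) t)) => t ty; split.
  by apply: dQ; apply: lt_le_trans (andP ty).1; rewrite lt_min ay.
have -> : t = y + (t - y) by ring.
apply: Hd' => //; apply: le_lt_trans kd'; move: ty; rewrite ge_min le_max.
by case: (ger0P k) => k0 /andP[/orP[] ? /orP[] ?]; rewrite ler_norml; lra.
Qed.

Section Holomorphic.
Variable R : realType.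

(* Over the boundary of [0, T] x [0, beta] the closed form integrates to [0], and
   the two vertical sides contribute a bounded amount as [T] grows. *)
Lemma strip_mean (m n : R -> R -> R) (beta M c0 c1 e : R) :
  (forall x y, exists p q r, D2 m x y p q /\ D2 n x y q r) ->
  (forall x, 0 <= x -> `|m x 0 - c0| <= e) ->
  (forall x, 0 <= x -> `|m x beta - c1| <= e) ->
  (forall x y, 0 <= x -> Num.min 0 beta <= y <= Num.max 0 beta -> `|n x y| <= M) ->
  `|c0 - c1| <= 2 * e.
Proof.
move=> closed m0 m1 nM; have [G dG] := closed_form_potential (- (`|beta| + 1)) closed.
have a0 : - (`|beta| + 1) < 0 by have := normr_ge0 beta; lra.
have ab : - (`|beta| + 1) < Num.min 0 beta.
  by rewrite lt_min a0; have := ler_norm (- beta); rewrite normrN; lra.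
have ge0a (t : R) : 0 <= t -> - (`|beta| + 1) < t by move: a0; lra.
have hor y c (T : R) : - (`|beta| + 1) < y -> 0 <= T ->
    (forall x, 0 <= x -> `|m x y - c| <= e) -> `|G T y - G 0 y - c * T| <= e * T.
  move=> ay T0 H.
  have /= := @MVT_bound R (G^~ y) (m^~ y) 0 T c e.
  rewrite subr0 (ger0_norm T0); apply=> t; rewrite (min_idPl T0) => /andP[t0 _].
  by split; [apply: D2_dx (dG _ _ (ge0a _ t0) ay)|exact: H].
have ver (x : R) : 0 <= x -> `|G x beta - G x 0| <= M * `|beta|.
  move=> x0; have /= := @MVT_bound R (G x) (n x) 0 beta 0 M.
  rewrite mul0r !subr0; apply=> t tb; rewrite subr0; split; last exact: nM.
  by apply: D2_dy (dG _ _ (ge0a _ x0) _); apply: lt_le_trans ab _; case/andP: tb.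
rewrite leNgt; apply/negP => lt_e.
set del := `|c0 - c1| - 2 * e; have del0 : 0 < del by rewrite subr_gt0.
have M0 : 0 <= M by apply: le_trans (nM 0 0 (lexx _) _); rewrite ?ge_min ?le_max ?lexx.
(* Long enough for [del * T] to exceed [2 * M * |beta|], the most that the two vertical sides can
   contribute. *)
pose T := 2 * M * `|beta| / del + 1.
have T0 : 0 < T by rewrite ltr_wpDl// divr_ge0 ?(ltW del0)// !mulr_ge0.
have H0 := hor 0 c0 T a0 (ltW T0) m0.
have b1 : - (`|beta| + 1) < beta by apply: lt_le_trans ab _; rewrite ge_min lexx orbT.
have H1 := hor beta c1 T b1 (ltW T0) m1.
have V0 := ver 0 (lexx _); have V1 := ver T (ltW T0).
have : `|(c0 - c1) * T| <= 2 * e * T + 2 * M * `|beta|.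
  have -> : (c0 - c1) * T = (G T beta - G 0 beta - c1 * T) - (G T 0 - G 0 0 - c0 * T)
     - ((G T beta - G T 0) - (G 0 beta - G 0 0)) by ring.
  apply: (le_trans (ler_normB _ _)).
  have := ler_normB (G T beta - G 0 beta - c1 * T) (G T 0 - G 0 0 - c0 * T).
  have := ler_normB (G T beta - G T 0) (G 0 beta - G 0 0); lra.
rewrite normrM (gtr0_norm T0) leNgt => /negP; apply.
rewrite -ltrBrDl -mulrBl -/del /T mulrDr (mulrC del) divfK ?gt_eqF//.
by rewrite mulr1 ltrDl.
Qed.

Lemma is_derive_max (g g1 : R -> R) (t0 g2 d : R) : 0 < d ->
  (forall t, `|t - t0| < d -> is_derive t 1 g (g1 t)) -> is_derive t0 1 g1 g2 ->
  (forall t, `|t - t0| < d -> g t <= g t0) -> g1 t0 = 0 /\ g2 <= 0.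
Proof.
move=> d0 dg dg1 gmax; have c0 : `|t0 - t0| < d by rewrite subrr normr0.
have g10 : g1 t0 = 0.
  have [||||_ D] := @derive1_at_max R g (t0 - d) (t0 + d) t0.
  - by lra.
  - move=> t; rewrite in_itv/= => tt; apply: (@ex_derive _ _ _ _ _ _ _ (dg t _)).
    by rewrite ltr_norml; lra.
  - by rewrite in_itv/=; lra.
  - by move=> t; rewrite in_itv/= => tt; apply: gmax; rewrite ltr_norml; lra.
  by rewrite -D; have [_ ->] := dg _ c0.
split=> //; rewrite leNgt; apply/negP => g20.
have g22 : 0 < g2 / 2 by rewrite divr_gt0.
have [d' d'0 Hd'] := is_derive_epsE dg1 g22.
pose h := Num.min d d' / 2.
have dd0 : 0 < Num.min d d' by rewrite lt_min d0.
have h0 : 0 < h by rewrite divr_gt0.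
have [hd hd'] : h < d /\ h < d'.
  have : h < Num.min d d' by rewrite /h; lra.
  by rewrite lt_min => /andP[].
have [|||t + E] := @MVT R g g1 t0 (t0 + h).
- by rewrite ltrDl.
- by move=> t; rewrite in_itv/= => tt; apply: dg; rewrite ltr_norml; lra.
- apply: derivable_within_continuous => t; rewrite in_itv/= => tt.
  by apply: (@ex_derive _ _ _ _ _ _ _ (dg t _)); rewrite ltr_norml; lra.
rewrite in_itv/= => tt.
have : g (t0 + h) <= g t0 by apply: gmax; rewrite addrAC subrr add0r gtr0_norm.
rewrite -subr_le0 E (addrC t0 h) addrK pmulr_lle0// leNgt => /negP; apply.
have u0 : 0 < t - t0 by lra.
have := Hd' (t - t0); rewrite (gtr0_norm u0) (addrC t0) subrK g10 subr0.
have ud : t - t0 < d' by lra.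
move=> /(_ ud); rewrite ler_norml => /andP[H _].
have : 0 < g2 / 2 * (t - t0) by rewrite mulr_gt0// divr_gt0.
by move: H; lra.
Qed.

End Holomorphic.

(** * The identity theorem by a maximum principle *)

Section Uniqueness.
Variable R : realType.

Lemma is_derive_mul (f g : R -> R) (x a b : R) :
  is_derive x 1 f a -> is_derive x 1 g b ->
  is_derive x 1 (fun t => f t * g t) (a * g x + f x * b).
Proof.
move=> df dg; apply: is_derive_eq.
by rewrite /GRing.scale/= addrC (mulrC (g x)).
Qed.

Lemma is_derive_add (f g : R -> R) (x a b : R) :
  is_derive x 1 f a -> is_derive x 1 g b -> is_derive x 1 (fun t => f t + g t) (a + b).
Proof. exact: is_deriveD. Qed.

Lemma is_derive_sub (f g : R -> R) (x a b : R) :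
  is_derive x 1 f a -> is_derive x 1 g b -> is_derive x 1 (fun t => f t - g t) (a - b).
Proof. exact: is_deriveB. Qed.

Lemma is_derive_scal (k : R) (f : R -> R) (x a : R) :
  is_derive x 1 f a -> is_derive x 1 (fun t => k * f t) (k * a).
Proof. exact: is_deriveZ. Qed.

Lemma is_derive_const (k x : R) : is_derive x 1 (fun=> k) (0 : R).
Proof. exact: is_derive_cst. Qed.

(** First and second order conditions at a maximum of [s * expR h], divided by [expR h]. They stand
    in for the conditions on [ln s + h], which makes no sense where [s] vanishes. *)
Lemma log_max (s s1 h h1 : R -> R) (t0 s2 h2 d : R) : 0 < d ->
  (forall t, `|t - t0| < d -> is_derive t 1 s (s1 t)) -> is_derive t0 1 s1 s2 ->
  (forall t, `|t - t0| < d -> is_derive t 1 h (h1 t)) -> is_derive t0 1 h1 h2 ->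
  (forall t, `|t - t0| < d -> s t * expR (h t) <= s t0 * expR (h t0)) ->
  s1 t0 + s t0 * h1 t0 = 0 /\
  s2 + 2 * (s1 t0 * h1 t0) + s t0 * h1 t0 ^+ 2 + s t0 * h2 <= 0.
Proof.
move=> d0 ds ds1 dh dh1 smax.
have c0 : `|t0 - t0| < d by rewrite subrr normr0.
have dE (t : R) : `|t - t0| < d -> is_derive t 1 (fun t => expR (h t)) (expR (h t) * h1 t).
  by move=> /dh H; apply: (@is_derive1_comp R expR h t).
have [] := @is_derive_max R (fun t => s t * expR (h t))
  (fun t => (s1 t + s t * h1 t) * expR (h t)) t0
  ((s2 + (s1 t0 * h1 t0 + s t0 * h2)) * expR (h t0) +
   (s1 t0 + s t0 * h1 t0) * (expR (h t0) * h1 t0)) d d0.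
- move=> t td; apply: (is_derive_eq (is_derive_mul (ds t td) (dE t td))); ring.
- apply: is_derive_mul (dE _ c0).
  by apply: is_deriveD ds1 (is_derive_mul (ds _ c0) dh1).
- exact: smax.
move=> /eqP; rewrite mulf_eq0 (gt_eqF (expR_gt0 _)) orbF => /eqP E.
rewrite E mul0r addr0 pmulr_lle0 ?expR_gt0// => H; split=> //.
apply: le_trans H; rewrite le_eqVlt; apply/orP; left; apply/eqP.
transitivity (s2 + (s1 t0 * h1 t0 + s t0 * h2) + (s1 t0 + s t0 * h1 t0) * h1 t0).
  by ring.
by rewrite E mul0r addr0.
Qed.
End Uniqueness.

Section Vanishing.
Variable R : realType.
Implicit Types (u v : R -> R -> R) (x y t a b c d : R).

(** The Cauchy-Riemann equations for a Frechet differentiable pair; [p + i q] is the complex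
    derivative, on which no continuity is imposed. *)
Definition holomorphic u v := forall x y, exists p q,
  D2 u x y p (- q) /\ D2 v x y q p.

Lemma D2_cvg f (x y a b : R) : D2 f x y a b ->
  {for (x, y), continuous (fun z : R * R => f z.1 z.2)}.
Proof.
move=> D; apply/cvgrPdist_le => e e0; have [d d0 Hd] := D2_cont D e0.
exists (ball x d, ball y d); first by split; exact: nbhsx_ballx.
move=> -[s t] [/= sd td]; rewrite distrC; have := Hd (s - x) (t - y).
by rewrite (addrC x) (addrC y) !subrK; apply; rewrite distrC.
Qed.

(* Let [F1 + i F2] be the primitive of [u + i v] that vanishes on the real axis.
   If it is nonzero at [(x', y0)] then, for [N] large,
   [(F1^2 + F2^2) exp (N (1/4 - x^2 + 2 y^2 - 2 y))] attains its maximum over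
   [-1, 1] x [0, 1/2] in the interior, where the Laplacian of its logarithm is
   [2 N > 0]. *)
Lemma holomorphic_strip_vanish u v (y0 : R) : holomorphic u v ->
  (forall x, u x 0 = 0 /\ v x 0 = 0) -> 0 < y0 <= 1 / 8 ->
  u 0 y0 = 0 /\ v 0 y0 = 0.
Proof.
move=> CR ax0 /andP[y00 y01].
(* The primitive has the two derivatives that [log_max] asks for, while [u + i v] itself is only
   known to be differentiable once. The product [(u + i v) (dx + i dy)] splits into the closed forms
   [u dx - v dy] and [v dx + u dy]. *)
have [|F1' dF1'] := @closed_form_potential R u (fun x y => - v x y) (- 3).
  by move=> x y; have [p [q [Du Dv]]] := CR x y;
     exists p, (- q), (- p); split=> //; exact: D2N.
have [|F2' dF2'] := @closed_form_potential R v u (- 3).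
  by move=> x y; have [p [q [Du Dv]]] := CR x y; exists q, p, (- q).
pose F1 x y := F1' x y + - F1' 0 0; pose F2 x y := F2' x y + - F2' 0 0.
have dF1 x y : - 3 < x -> - 3 < y -> D2 F1 x y (u x y) (- v x y).
  move=> xa ya; rewrite -[u x y]addr0 -[X in D2 _ _ _ _ X]addr0.
  exact: D2D (dF1' _ _ xa ya) (D2_cst _ _ _).
have dF2 x y : - 3 < x -> - 3 < y -> D2 F2 x y (v x y) (u x y).
  move=> xa ya; rewrite -[v x y]addr0 -[u x y]addr0.
  exact: D2D (dF2' _ _ xa ya) (D2_cst _ _ _).
have bottom (w F : R -> R -> R) x : (forall x, -3 < x -> is_derive x 1 (F^~ 0) (w x 0)) ->
    (forall x, w x 0 = 0) -> -1 <= x <= 1 -> F x 0 = F 0 0.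
  move=> dF w0 /andP[x1 x2].
  have /= := @MVT_bound R (F^~ 0) (w^~ 0) 0 x 0 0.
  rewrite !mul0r subr0 normr_le0 subr_eq0 => H; apply/eqP; apply: H => t.
  rewrite ge_min le_max w0 subrr normr0 lexx => tx; split=> //; have := dF t; rewrite w0; apply.
  by case/andP: tx => /orP[] ? _; lra.
have F10 x : -1 <= x <= 1 -> F1 x 0 = 0.
  move=> xx; transitivity (F1 0 0); last by rewrite /F1 subrr.
  apply: (bottom u) xx; last by move=> t; have [] := ax0 t.
  by move=> t ta; apply: D2_dx (dF1 _ _ ta _); lra.
have F20 x : -1 <= x <= 1 -> F2 x 0 = 0.
  move=> xx; transitivity (F2 0 0); last by rewrite /F2 subrr.
  apply: (bottom v) xx; last by move=> t; have [] := ax0 t.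
  by move=> t ta; apply: D2_dx (dF2 _ _ ta _); lra.
pose s x y := F1 x y * F1 x y + F2 x y * F2 x y.
have s_ge0 x y : 0 <= s x y by rewrite addr_ge0// -expr2 sqr_ge0.
have ds x y : - 3 < x -> - 3 < y -> exists a b, D2 s x y a b.
  move=> xa ya; do 2 eexists.
  exact: D2D (D2M (dF1 _ _ xa ya) (dF1 _ _ xa ya)) (D2M (dF2 _ _ xa ya) (dF2 _ _ xa ya)).
pose K : set (R * R) := `[-1, 1] `*` `[0, 1/2].
have KE z : K z <-> (-1 <= z.1 <= 1) /\ (0 <= z.2 <= 1/2).
  by rewrite /K/= !in_itv.
have Kc : compact K by apply: compact_setX; exact: segment_compact.
have K0 : K !=set0 by exists (0, 0); apply/KE => /=; split; lra.
(* For [N > 0] this is negative on the sides [x = -1], [x = 1] and [y = 1/2], and positive at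
   [(x', y0)] as soon as [|x'| < 1/8] and [0 < y0 <= 1/8]; its Laplacian is [2 * N]. On the side
   [y = 0] the primitive vanishes. *)
pose h (N x y : R) := N * (1/4 - x * x) + N * (2 * (y * y) - 2 * y).
have dH1 (N t : R) : is_derive t 1 (fun t => N * (1/4 - t * t)) (N * (- 2 * t)).
  have D : is_derive t 1 (fun t : R => t * t) (1 * t + t * 1) by exact: is_derive_mul.
  apply: (is_derive_eq (is_derive_scal N (is_derive_sub (is_derive_const (1/4) t) D))).
  ring.
have dH2 (N t : R) : is_derive t 1 (fun t => N * (2 * (t * t) - 2 * t)) (N * (4 * t - 2)).
  have D : is_derive t 1 (fun t : R => t * t) (1 * t + t * 1) by exact: is_derive_mul.
  have D' : is_derive t 1 (fun t : R => t) 1 by exact: is_derive_id.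
  apply: (is_derive_eq (is_derive_scal N (is_derive_sub (is_derive_scal 2 D) (is_derive_scal 2 D')))).
  ring.
have W_cont N : {in K, continuous (fun z : R * R => s z.1 z.2 * expR (h N z.1 z.2))}.
  move=> [x y]; rewrite inE => /KE /= [/andP[x1 x2] /andP[y1 y2]].
  have xa : -3 < x by lra. have ya : -3 < y by lra.
  have [a [b Ds]] := ds x y xa ya.
  apply: (cvgM (D2_cvg Ds)).
  apply: (@continuous_comp _ _ _ (fun z : R * R => h N z.1 z.2) expR); last exact: continuous_expR.
  exact: (D2_cvg (D2D (D2_x y (dH1 N x)) (D2_y x (dH2 N y)))).
have s0 x' : - (1/8) < x' < 1/8 -> s x' y0 = 0.
  move=> /andP[xl xr]; apply: contrapT => /eqP sn0.
  have sp : 0 < s x' y0 by rewrite lt_neqAle eq_sym sn0 s_ge0.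
  have [cM _ Mmax] := compact_EVT_max K0 Kc (continuous_in_subspaceT (W_cont 0)).
  pose M := s cM.1 cM.2 * expR (h 0 cM.1 cM.2).
  have {}Mmax x y : -1 <= x <= 1 -> 0 <= y <= 1/2 -> s x y <= M.
    move=> Hx Hy; have := Mmax (x, y); rewrite -/M /= {1}/h !mul0r add0r expR0 mulr1; apply.
    by rewrite inE; apply/KE.
  have k0 : 0 < 1/4 - x' * x' + (2 * (y0 * y0) - 2 * y0) by nra.
  set kk := (X in 0 < X) in k0.
  (* By [expR t >= 1 + t], this [N] lifts the weighted value at [(x', y0)] above the maximum [M] of
     [s] over the rectangle. The weighted function therefore attains its maximum where the exponent
     is positive and [s] is nonzero, that is, off all four sides. *)
  pose N := M / (s x' y0 * kk) + 1.
  have M0 : 0 <= M by apply: le_trans (Mmax 0 0 _ _) => //; lra.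
  have N0 : 0 < N by rewrite ltr_wpDl// divr_ge0// mulr_ge0// ltW.
  have big : M < s x' y0 * expR (h N x' y0).
    have -> : h N x' y0 = N * kk by rewrite /h /kk; ring.
    apply: (@lt_le_trans _ _ (s x' y0 * (1 + N * kk))).
      rewrite mulrDr mulr1 ltr_wpDl ?(ltW sp)//.
      rewrite /N mulrCA mulrA mulrDl mul1r (_ : _ * kk = s x' y0 * kk * (M / (s x' y0 * kk)) + s x' y0 * kk).
        rewrite mulrCA divff ?mulr1 ?ltrDl ?mulr_gt0// mulf_neq0//; first exact: lt0r_neq0.
      by ring.
    by rewrite ler_wpM2l ?(ltW sp)// expR_ge1Dx.
  have [[x1 y1] + Wmax] := compact_EVT_max K0 Kc (continuous_in_subspaceT (W_cont N)).
  rewrite inE => /KE /= [/andP[xx1 xx2] /andP[yy1 yy2]].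
  have {}Wmax x y : -1 <= x <= 1 -> 0 <= y <= 1/2 ->
      s x y * expR (h N x y) <= s x1 y1 * expR (h N x1 y1).
    by move=> Hx Hy; apply: (Wmax (x, y)); rewrite inE; apply/KE.
  have W1 : M < s x1 y1 * expR (h N x1 y1).
    by apply: (lt_le_trans big); apply: Wmax; lra.
  have hpos : 0 < h N x1 y1.
    rewrite ltNge; apply/negP => hle.
    move: W1; rewrite ltNge => /negP; apply.
    apply: (@le_trans _ _ (s x1 y1 * 1)); last by rewrite mulr1; apply: Mmax; rewrite ?xx1 ?yy1.
    by rewrite ler_wpM2l// -expR0 ler_expR.
  have hpos' : 0 < 1/4 - x1 * x1 + (2 * (y1 * y1) - 2 * y1).
    move: hpos; have -> : h N x1 y1 = N * (1/4 - x1 * x1 + (2 * (y1 * y1) - 2 * y1)).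
      by rewrite /h; ring.
    by rewrite pmulr_rgt0.
  have y10 : 0 < y1.
    rewrite lt_neqAle yy1 andbT; apply/eqP => y1E; move: W1; rewrite /s -y1E.
    have xI : -1 <= x1 <= 1 by rewrite xx1 xx2.
    by rewrite (F10 _ xI) (F20 _ xI) !mul0r add0r mul0r ltNge M0.
  have sp1 : 0 < s x1 y1.
    rewrite lt_neqAle s_ge0 andbT; apply/eqP => sE; move: W1.
    by rewrite -sE mul0r ltNge M0.
  have [d d0 [dx dx' dy dy']] : exists2 d : R, 0 < d & [/\ d <= 1 - x1, d <= x1 + 1, d <= y1 & d <= 1/2 - y1].
    exists (Num.min (Num.min (1 - x1) (x1 + 1)) (Num.min y1 (1/2 - y1))).
      by rewrite !lt_min y10; nra.
    by split; rewrite !ge_min lexx ?orbT.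
  have xa : -3 < x1 by lra. have ya : -3 < y1 by lra.
  have [p [q [Du Dv]]] := CR x1 y1.
  have near_x t : `|t - x1| < d -> -1 <= t <= 1 by rewrite ltr_norml; lra.
  have near_y t : `|t - y1| < d -> 0 <= t <= 1/2 by rewrite ltr_norml; lra.
  have [] := @log_max R (s^~ y1) (fun t => 2 * (F1 t y1 * u t y1 + F2 t y1 * v t y1))
    ((h N)^~ y1) (fun t => N * (- 2 * t)) x1
    (2 * (u x1 y1 ^+ 2 + v x1 y1 ^+ 2 + F1 x1 y1 * p + F2 x1 y1 * q)) (- 2 * N) d d0.
  - move=> t /near_x tx; have ta : -3 < t by lra.
    have D1 := D2_dx (dF1 _ _ ta ya); have D2' := D2_dx (dF2 _ _ ta ya).
    apply: (is_derive_eq (is_derive_add (is_derive_mul D1 D1) (is_derive_mul D2' D2'))); ring.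
  - have D1 := D2_dx (dF1 _ _ xa ya); have D2' := D2_dx (dF2 _ _ xa ya).
    apply: (is_derive_eq (is_derive_scal 2 (is_derive_add (is_derive_mul D1 (D2_dx Du))
      (is_derive_mul D2' (D2_dx Dv))))).
    ring.
  - move=> t _; apply: (is_derive_eq (is_derive_add (dH1 N t) (is_derive_const _ t))).
    by rewrite addr0.
  - have D' : is_derive x1 1 (fun t : R => t) 1 by exact: is_derive_id.
    apply: (is_derive_eq (is_derive_scal N (is_derive_scal (- 2) D'))).
    ring.
  - by move=> t /near_x tx; apply: Wmax => //; lra.
  move=> Ax Bx.
  have [] := @log_max R (s x1) (fun t => 2 * (F1 x1 t * - v x1 t + F2 x1 t * u x1 t))
    (h N x1) (fun t => N * (4 * t - 2)) y1
    (2 * (u x1 y1 ^+ 2 + v x1 y1 ^+ 2 - F1 x1 y1 * p - F2 x1 y1 * q)) (4 * N) d d0.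
  - move=> t /near_y ty; have ta : -3 < t by lra.
    have D1 := D2_dy (dF1 _ _ xa ta); have D2' := D2_dy (dF2 _ _ xa ta).
    apply: (is_derive_eq (is_derive_add (is_derive_mul D1 D1) (is_derive_mul D2' D2'))); ring.
  - have D1 := D2_dy (dF1 _ _ xa ya); have D2' := D2_dy (dF2 _ _ xa ya).
    apply: (is_derive_eq (is_derive_scal 2 (is_derive_add (is_derive_mul D1 (D2_dy (D2N Dv)))
      (is_derive_mul D2' (D2_dy Du))))).
    ring.
  - move=> t _; apply: (is_derive_eq (is_derive_add (is_derive_const _ t) (dH2 N t))).
    by rewrite add0r.
  - have D' : is_derive y1 1 (fun t : R => t) 1 by exact: is_derive_id.
    apply: (is_derive_eq (is_derive_scal N (is_derive_sub (is_derive_scal 4 D') (is_derive_const 2 y1)))).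
    ring.
  - by move=> t /near_y ty; apply: Wmax => //; lra.
  move=> Ay By.
  set hx := N * (- 2 * x1) in Ax Bx; set hy := N * (4 * y1 - 2) in Ay By.
  set S := s x1 y1 in Ax Bx Ay By sp1.
  set A := 2 * (_ + _) in Ax Bx; set B := 2 * (_ + _) in Ay By.
  set U := u x1 y1 ^+ 2 + v x1 y1 ^+ 2 in Bx By.
  have SE : S = F1 x1 y1 ^+ 2 + F2 x1 y1 ^+ 2 by rewrite /S /s !expr2.
  (* For [F = F1 + i F2] this is [|grad |F|^2|^2 = 4 |F|^2 |F'|^2]. Together with the cancellation
     of [p] and [q] between [Bx] and [By] it expresses that [log |F|] is harmonic, so only the
     Laplacian of the weight survives in the sum. *)
  have AB : A ^+ 2 + B ^+ 2 = 4 * S * U by rewrite SE /A /B /U; ring.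
  have AE : A = - (S * hx) by lra.
  have BE : B = - (S * hy) by lra.
  have hU : S * (hx ^+ 2 + hy ^+ 2) = 4 * U.
    apply: (mulfI (lt0r_neq0 sp1)); transitivity (A ^+ 2 + B ^+ 2); last by rewrite AB; ring.
    by rewrite AE BE; ring.
  have : S * (2 * N) <= 0.
    have -> : S * (2 * N) = 4 * U - S * (hx ^+ 2 + hy ^+ 2) + S * (2 * N) by rewrite hU subrr add0r.
    by move: Bx By; rewrite AE BE; lra.
  by rewrite leNgt mulr_gt0// mulr_gt0.
(* [F1] and [F2] vanish on a horizontal segment through [(0, y0)], hence so do their [x]-derivatives
   there, which are [u] and [v]. *)
have deriv0 (F : R -> R) (a : R) : (forall x, - (1/8) < x < 1/8 -> F x = 0) ->
    is_derive (0 : R) 1 F a -> a = 0.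
  move=> F0 dF; have lt18 (t : R) : `|t - 0| < 1/8 -> F t = 0.
    by rewrite subr0 ltr_norml => ?; rewrite F0//; lra.
  have D1 := @derive1_at_max R F (- (1/8)) (1/8) 0.
  have [||||_ <-] := D1.
  - lra.
  - move=> t; rewrite in_itv/= => tt.
    have D : is_derive t 1 F 0.
      apply: is_derive_eps => e e0; exists (Num.min (t + 1/8) (1/8 - t)).
        by rewrite lt_min; lra.
      move=> k; rewrite lt_min => /andP[]; rewrite !ltr_norml => ? ?.
      by rewrite !F0; try lra; rewrite mul0r !subrr normr0 mulr_ge0// ltW.
    exact: (@ex_derive _ _ _ _ _ _ _ D).
  - by rewrite in_itv/=; lra.
  - by move=> t; rewrite in_itv/= => tt; rewrite !F0//; lra.
  by have [_ ->] := dF.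
have FF0 x' : - (1/8) < x' < 1/8 -> F1 x' y0 = 0 /\ F2 x' y0 = 0.
  move=> /s0; rewrite /s -!expr2 => /eqP.
  by rewrite paddr_eq0 ?sqr_ge0// !expf_eq0/= => /andP[/eqP -> /eqP ->].
have za : -3 < 0 :> R by lra. have ya : -3 < y0 by lra.
split.
- apply: (deriv0 (F1^~ y0)); first by move=> x /FF0[].
  exact: D2_dx (dF1 _ _ za ya).
- apply: (deriv0 (F2^~ y0)); first by move=> x /FF0[].
  exact: D2_dx (dF2 _ _ za ya).
Qed.

End Vanishing.

Section HolomorphicVanishing.
Variable R : realType.
Implicit Types (u v : R -> R -> R) (x y t a b c d : R).

Lemma D2_shift f (x y a b c d : R) : D2 f (x + c) (y + d) a b ->
  D2 (fun x y => f (x + c) (y + d)) x y a b.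
Proof.
move=> D e /D[r r0 Hr]; exists r => // h k hr kr.
by have := Hr _ _ hr kr; rewrite (addrAC x) (addrAC y).
Qed.

Lemma D2_opp f (x y a b : R) : D2 f (- x) (- y) a b ->
  D2 (fun x y => f (- x) (- y)) x y (- a) (- b).
Proof.
move=> D e /D[r r0 Hr]; exists r => // h k hr kr.
have := Hr (- h) (- k); rewrite !normrN !opprD => /(_ hr kr).
by rewrite !mulrN !mulNr.
Qed.

(** Horizontal translation brings every abscissa to [0], vertical translation climbs in steps of
    [1/8], and [z |-> - z] exchanges the two half planes. *)
Lemma holomorphic_vanish u v : holomorphic u v ->
  (forall x, u x 0 = 0 /\ v x 0 = 0) -> forall x y, u x y = 0 /\ v x y = 0.
Proof.
have shift w z c d : holomorphic w z ->
    holomorphic (fun x y => w (x + c) (y + d)) (fun x y => z (x + c) (y + d)).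
  move=> H x y; have [p [q [? ?]]] := H (x + c) (y + d).
  by exists p, q; split; exact: D2_shift.
have up (k : nat) : forall w z, holomorphic w z ->
    (forall x, w x 0 = 0 /\ z x 0 = 0) -> forall x y, 0 <= y <= k%:R / 8 ->
    w x y = 0 /\ z x y = 0.
  elim: k => [|k IH] w z H H0 x y /andP[y0 yk].
    have -> : y = 0 by apply/eqP; rewrite eq_le y0 andbT (le_trans yk)// mul0r.
    exact: H0.
  have [y8|y8] := leP y (1/8).
    have [->|yn0] := eqVneq y 0; first exact: H0.
    have /= := @holomorphic_strip_vanish R _ _ y (shift w z x 0 H).
    rewrite (add0r x) (addr0 y); apply.
      by move=> t; rewrite addr0; exact: H0.
    by rewrite lt_neqAle eq_sym yn0 y0.
  have H8 t : w (t + 0) (0 + 1/8) = 0 /\ z (t + 0) (0 + 1/8) = 0.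
    have /= := @holomorphic_strip_vanish R _ _ (1/8) (shift w z t 0 H).
    rewrite (add0r t) (addr0 (1/8)) (addr0 t) (add0r (1/8)); apply; last by lra.
    by move=> t'; rewrite addr0; exact: H0.
  have /= := IH _ _ (shift w z 0 (1/8) H) H8 x (y - 1/8).
  rewrite (addr0 x) subrK; apply.
  by rewrite subr_ge0 (ltW y8)/= lerBlDr; move: yk; rewrite -natr1; lra.
have pos w z : holomorphic w z -> (forall x, w x 0 = 0 /\ z x 0 = 0) ->
    forall x y, 0 <= y -> w x y = 0 /\ z x y = 0.
  move=> H H0 x y y0; apply: (up (Num.truncn (8 * y)).+1 w z) => //.
  by rewrite y0/= ler_pdivlMr// mulrC ltW// truncnS_gt.
move=> H H0 x y; have [y0|y0] := leP 0 y; first exact: pos.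
have Ho : holomorphic (fun x y => u (- x) (- y)) (fun x y => v (- x) (- y)).
  move=> s t; have [p [q [Du Dv]]] := H (- s) (- t).
  exists (- p), (- q); split; last exact: D2_opp.
  exact: D2_opp.
have H1 t : u (- t) (- 0) = 0 /\ v (- t) (- 0) = 0 by rewrite oppr0; exact: H0.
by have := pos _ _ Ho H1 (- x) (- y); rewrite !opprK oppr_ge0; apply; exact: ltW.
Qed.
End HolomorphicVanishing.

(** * Complex numbers and semi-inner products *)

Section ComplexNumbers.
Variable R : realType.
Implicit Types (z w : Cx R) (r s : R).

HB.instance Definition _ := GRing.isAdditive.Build R (Cx R) (@ofR R)
  (@ComplexField.real_complex_is_additive R).
HB.instance Definition _ := GRing.isMultiplicative.Build R (Cx R) (@ofR R)
  (@ComplexField.real_complex_is_multiplicative R).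

Definition cRe z : R := complex.Re z.
Definition cIm z : R := complex.Im z.

Lemma cReD z w : cRe (z + w) = cRe z + cRe w. Proof. by case: z w => [? ?] [? ?]. Qed.
Lemma cImD z w : cIm (z + w) = cIm z + cIm w. Proof. by case: z w => [? ?] [? ?]. Qed.
Lemma cReN z : cRe (- z) = - cRe z. Proof. by case: z. Qed.
Lemma cImN z : cIm (- z) = - cIm z. Proof. by case: z. Qed.
Lemma cReB z w : cRe (z - w) = cRe z - cRe w. Proof. by rewrite cReD cReN. Qed.
Lemma cImB z w : cIm (z - w) = cIm z - cIm w. Proof. by rewrite cImD cImN. Qed.
Lemma cReM z w : cRe (z * w) = cRe z * cRe w - cIm z * cIm w.
Proof. by case: z w => [? ?] [? ?]. Qed.
Lemma cImM z w : cIm (z * w) = cRe z * cIm w + cIm z * cRe w.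
Proof. by case: z w => [? ?] [? ?]. Qed.
Lemma cRe_conj z : cRe z^* = cRe z. Proof. by case: z. Qed.
Lemma cIm_conj z : cIm z^* = - cIm z. Proof. by case: z. Qed.
Lemma cRe_ofR r : cRe (ofR r) = r. Proof. by []. Qed.
Lemma cIm_ofR r : cIm (ofR r) = 0. Proof. by []. Qed.
Lemma cRe_i : cRe 'i = 0. Proof. by []. Qed.
Lemma cIm_i : cIm 'i = 1. Proof. by []. Qed.
Lemma cRe0 : cRe 0 = 0. Proof. by []. Qed.
Lemma cIm0 : cIm 0 = 0. Proof. by []. Qed.
Lemma cRe1 : cRe 1 = 1. Proof. by []. Qed.
Lemma cIm1 : cIm 1 = 0. Proof. by []. Qed.

Definition cReIm := (cRe0, cIm0, cRe1, cIm1, cReD, cImD, cReN, cImN, cReM, cImM, cRe_conj, cIm_conj,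
  cRe_ofR, cIm_ofR, cRe_i, cIm_i).

Lemma complex_ext z w : cRe z = cRe w -> cIm z = cIm w -> z = w.
Proof. by case: z w => [a b] [c d] /= -> ->. Qed.

Lemma complexEri z : z = ofR (cRe z) + 'i * ofR (cIm z).
Proof. by apply: complex_ext; rewrite !cReIm; ring. Qed.

Lemma ler_ofR r s : (ofR r <= ofR s) = (r <= s). Proof. exact: lecR. Qed.
Lemma ltr_ofR r s : (ofR r < ofR s) = (r < s). Proof. exact: ltcR. Qed.
Lemma ofR_ge0 r : (0 <= ofR r) = (0 <= r). Proof. exact: ler0c. Qed.
Lemma ofR_gt0 r : (0 < ofR r) = (0 < r). Proof. exact: ltr_ofR 0 r. Qed.

Lemma cIm_ge0 z : 0 <= z -> cIm z = 0. Proof. exact: ger0_Im. Qed.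
Lemma ge0_ofR z : 0 <= z -> z = ofR (cRe z).
Proof. by move=> z0; apply: complex_ext; rewrite // cIm_ofR cIm_ge0. Qed.
Lemma cRe_ge0 z : 0 <= z -> 0 <= cRe z.
Proof. by move=> z0; rewrite -ofR_ge0 -ge0_ofR. Qed.

Lemma norm_ofR r : `|ofR r| = ofR `|r|.
Proof. by rewrite /ofR normc_def /= expr0n/= addr0 sqrtr_sqr. Qed.

(** Norms are values in [Cx R]; a real-valued version lets the estimates run in the totally ordered
    field [R]. *)
Definition rnorm (V : normedModType (Cx R)) (x : V) : R := cRe `|x|.

Lemma rnormE (V : normedModType (Cx R)) (x : V) : `|x| = ofR (rnorm x).
Proof. exact/ge0_ofR/normr_ge0. Qed.

Definition cabs z : R := cRe `|z|.

Lemma cabsE z : `|z| = ofR (cabs z). Proof. exact/ge0_ofR/normr_ge0. Qed.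

Lemma cabs_ge0 z : 0 <= cabs z. Proof. exact/cRe_ge0/normr_ge0. Qed.

Lemma cabs_sqr z : cabs z ^+ 2 = cRe z ^+ 2 + cIm z ^+ 2.
Proof. by apply: (@complexI R); rewrite rmorphXn/= -/(ofR _) -cabsE -add_Re2_Im2. Qed.

Lemma cabsD z w : cabs (z + w) <= cabs z + cabs w.
Proof. by rewrite -ler_ofR rmorphD/= -!cabsE ler_normD. Qed.

Lemma cabsN z : cabs (- z) = cabs z. Proof. by rewrite /cabs normrN. Qed.

Lemma cabsM z w : cabs (z * w) = cabs z * cabs w.
Proof. by apply: (@complexI R); rewrite -/(ofR _) -cabsE normrM !cabsE -rmorphM. Qed.

Lemma cabs_ofR r : cabs (ofR r) = `|r|. Proof. by rewrite /cabs norm_ofR. Qed.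

Lemma cabs_conj z : cabs z^* = cabs z. Proof. by rewrite /cabs norm_conjC. Qed.

Lemma cabs_eq0 z : cabs z = 0 -> z = 0.
Proof. by move=> z0; apply/eqP; rewrite -normr_eq0 cabsE z0 rmorph0. Qed.

Lemma cabs0 : cabs 0 = 0. Proof. by rewrite /cabs normr0. Qed.
Lemma cabs1 : cabs 1 = 1. Proof. by rewrite /cabs normr1. Qed.

Lemma cRe_le_cabs z : `|cRe z| <= cabs z.
Proof.
by rewrite -ler_sqr ?nnegrE ?cabs_ge0// cabs_sqr -normrX ger0_norm ?sqr_ge0// lerDl sqr_ge0.
Qed.

Lemma cIm_le_cabs z : `|cIm z| <= cabs z.
Proof.
by rewrite -ler_sqr ?nnegrE ?cabs_ge0// cabs_sqr -normrX ger0_norm ?sqr_ge0// lerDr sqr_ge0.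
Qed.

Lemma cabs_le_ReIm z : cabs z <= `|cRe z| + `|cIm z|.
Proof.
rewrite [X in cabs X]complexEri; apply: (le_trans (cabsD _ _)).
by rewrite cabsM !cabs_ofR {1}/cabs normCi mul1r.
Qed.

Lemma cabs_ball z (e : Cx R) : 0 < e -> `|z| < e = (cabs z < cRe e).
Proof. by move=> e0; rewrite cabsE {1}(ge0_ofR (ltW e0)) ltr_ofR. Qed.

Lemma Cx_complete (F : set_system (Cx R)) : ProperFilter F -> cauchy F -> cvg F.
Proof.
move=> FF /cauchy_ballP Fc.
have part (p : Cx R -> R) : (forall z w, `|p z - p w| <= cabs (z - w)) -> cvg (p @ F).
  move=> pL; apply: cauchy_cvg; apply/cauchy_ballP => e e0.
  have e0' : 0 < ofR e by rewrite ofR_gt0.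
  have := Fc _ e0'; rewrite !near_simpl /= => -[[A B]/= [FA FB] AB].
  exists (p @` A, p @` B).
    split; rewrite /= nbhs_simpl/=; [apply: filterS FA|apply: filterS FB] => z Az; exact: imageP.
  move=> [_ _] [/= [z Az <-] [w Bw <-]]; rewrite /ball/=.
  apply: le_lt_trans (pL _ _) _.
  have := AB (z, w) (conj Az Bw); rewrite /ball/= /ball_ => zw.
  by rewrite -ltr_ofR -cabsE.
have /cvg_ex[/= a Fa] := part cRe (fun z w => le_trans
  (eq_ind _ (fun t => `|t| <= cabs (z - w)) (cRe_le_cabs _) _ (cReB z w)) (lexx _)).
have /cvg_ex[/= b Fb] := part cIm (fun z w => le_trans
  (eq_ind _ (fun t => `|t| <= cabs (z - w)) (cIm_le_cabs _) _ (cImB z w)) (lexx _)).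
apply: (cvgP (ofR a + 'i * ofR b)); apply/cvgrPdist_lt => e e0.
have e20 : 0 < cRe e / 2 by rewrite divr_gt0// -ofR_gt0 -ge0_ofR// ltW.
move/cvgrPdist_lt : Fa => /(_ _ e20) Fa; move/cvgrPdist_lt : Fb => /(_ _ e20) Fb.
near=> z; rewrite cabs_ball//; apply: le_lt_trans (cabs_le_ReIm _) _.
rewrite (splitr (cRe e)); apply: ltrD.
  by rewrite !cReIm !(mul0r, mulr0, subr0, addr0, mul1r, add0r); near: z.
by rewrite !cReIm !(mul0r, mulr0, subr0, addr0, mul1r, add0r); near: z.
Unshelve. all: by end_near. Qed.

End ComplexNumbers.

Section SemiInner.
Variables (R : realType) (V : lmodType (Cx R)).

Record semi_inner (s : V -> V -> Cx R) : Prop := SemiInner {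
  si_scalar : forall v, scalar (s^~ v) ;
  si_conj : forall u v, s v u = (s u v)^* ;
  si_pos : forall u, 0 <= s u u }.

Variable s : V -> V -> Cx R.
Hypothesis hs : semi_inner s.

Lemma siDl u u' v : s (u + u') v = s u v + s u' v.
Proof. by have := si_scalar hs v 1 u u'; rewrite scale1r mul1r. Qed.
Lemma si0l v : s 0 v = 0.
Proof. by apply: (addrI (s 0 v)); rewrite -siDl !addr0. Qed.
Lemma siZl k u v : s (k *: u) v = k * s u v.
Proof. by have := si_scalar hs v k u 0; rewrite addr0 si0l addr0. Qed.
Lemma siNl u v : s (- u) v = - s u v.
Proof. by rewrite -scaleN1r siZl mulN1r. Qed.
Lemma siBl u u' v : s (u - u') v = s u v - s u' v.
Proof. by rewrite siDl siNl. Qed.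
Lemma siDr u v v' : s u (v + v') = s u v + s u v'.
Proof. by rewrite (si_conj hs) siDl rmorphD/= -!(si_conj hs). Qed.
Lemma siZr k u v : s u (k *: v) = k^* * s u v.
Proof. by rewrite (si_conj hs) siZl rmorphM/= -(si_conj hs). Qed.
Lemma siNr u v : s u (- v) = - s u v.
Proof. by rewrite (si_conj hs) siNl rmorphN/= -(si_conj hs). Qed.
Lemma siBr u v v' : s u (v - v') = s u v - s u v'.
Proof. by rewrite siDr siNr. Qed.

Definition sq u : R := cRe (s u u).

Lemma sqE u : s u u = ofR (sq u). Proof. exact/ge0_ofR/si_pos. Qed.
Lemma sq_ge0 u : 0 <= sq u. Proof. exact/cRe_ge0/si_pos. Qed.

(** Positivity at [u - (t * s u v) *: v] for real [t]: take [t = 1 / sq v], or, for a null vector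
    [v], a [t] so large that the expression is negative unless [s u v = 0]. *)
Lemma si_CauchySchwarz u v : cabs (s u v) ^+ 2 <= sq u * sq v.
Proof.
set a := s u v; set A := cabs a ^+ 2.
have A0 : 0 <= A by rewrite sqr_ge0.
have H t : 0 <= sq u - 2 * t * A + t ^+ 2 * A * sq v.
  have := sq_ge0 (u - (ofR t * a) *: v); rewrite /sq.
  rewrite siBl !siBr !siZl !siZr (si_conj hs u v) -/a !sqE.
  rewrite !rmorphM/= !cReIm /A cabs_sqr => Ht.
  apply: (le_trans Ht); rewrite le_eqVlt; apply/orP; left; apply/eqP; ring.
have [v0|v0] := eqVneq (sq v) 0; last first.
  have vp : 0 < sq v by rewrite lt_neqAle eq_sym v0 sq_ge0.
  have := H (sq v)^-1; rewrite -(pmulr_lge0 _ vp) => Hv.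
  rewrite -subr_ge0; apply: (le_trans Hv).
  by rewrite le_eqVlt; apply/orP; left; apply/eqP; field.
rewrite v0 mulr0 leNgt; apply/negP => Ap.
have := H ((sq u + 1) / (2 * A)); rewrite v0 mulr0 addr0.
rewrite (_ : 2 * _ * A = sq u + 1); first lra.
by field; rewrite gt_eqF.
Qed.

Definition snorm u : R := Num.sqrt (sq u).

Lemma snorm_ge0 u : 0 <= snorm u. Proof. exact: sqrtr_ge0. Qed.

Lemma snorm_sqr u : snorm u ^+ 2 = sq u.
Proof. by rewrite sqr_sqrtr ?sq_ge0. Qed.

Lemma si_le u v : cabs (s u v) <= snorm u * snorm v.
Proof.
rewrite -ler_sqr ?nnegrE ?cabs_ge0 ?mulr_ge0 ?snorm_ge0//.
by rewrite exprMn !snorm_sqr si_CauchySchwarz.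
Qed.

Lemma snormD u v : snorm (u + v) <= snorm u + snorm v.
Proof.
rewrite -ler_sqr ?nnegrE ?addr_ge0 ?snorm_ge0// snorm_sqr /sq siDl !siDr.
rewrite (si_conj hs u v) !cReIm sqrrD !snorm_sqr -/(sq u) -/(sq v).
have := si_le u v; have := cRe_le_cabs (s u v); have := ler_norm (cRe (s u v)); lra.
Qed.

Lemma snormZ k u : snorm (k *: u) = cabs k * snorm u.
Proof.
apply/eqP; rewrite -(@eqrXn2 _ 2) ?mulr_ge0 ?snorm_ge0 ?cabs_ge0//; apply/eqP.
rewrite exprMn !snorm_sqr /sq siZl siZr sqE mulrA !cReIm cabs_sqr; ring.
Qed.

Lemma snormN u : snorm (- u) = snorm u.
Proof. by rewrite -scaleN1r snormZ cabsN cabs1 mul1r. Qed.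

Lemma snormB u v : snorm (u - v) = snorm (v - u).
Proof. by rewrite -snormN opprB. Qed.

End SemiInner.

(** * Norm estimates and square roots near the unit *)

Section CstarBasics.
Variables (R : realType) (A : cstarType R).
Implicit Types (a b : A) (k : Cx R).

Lemma starN a : star (- a) = - star a.
Proof. by rewrite -scaleN1r starZ rmorphN rmorph1 scaleN1r. Qed.
Lemma starB a b : star (a - b) = star a - star b.
Proof. by rewrite starD starN. Qed.
Lemma star0 : star (0 : A) = 0.
Proof. by rewrite -{1}(subrr (0 : A)) starB subrr. Qed.
Lemma star1 : star (1 : A) = 1.
Proof. by rewrite -[star 1]mulr1 -{2}(starK 1) -starM mulr1 starK. Qed.

Lemma rnormM_le a b : rnorm (a * b) <= rnorm a * rnorm b.
Proof. by rewrite -ler_ofR rmorphM/= -!rnormE normcM_le. Qed.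
Lemma rnorm_starM a : rnorm (star a * a) = rnorm a ^+ 2.
Proof. by apply: (@complexI R); rewrite rmorphXn/= -!/(ofR _) -!rnormE norm_starM. Qed.
Lemma rnorm_ge0 a : 0 <= rnorm a. Proof. exact/cRe_ge0/normr_ge0. Qed.
Lemma rnormD a b : rnorm (a + b) <= rnorm a + rnorm b.
Proof. by rewrite -ler_ofR rmorphD/= -!rnormE ler_normD. Qed.
Lemma rnormN a : rnorm (- a) = rnorm a. Proof. by rewrite /rnorm normrN. Qed.
Lemma rnormZ k a : rnorm (k *: a) = cabs k * rnorm a.
Proof.
by apply: (@complexI R); rewrite -/(ofR _) -rnormE normrZ (cabsE k) (rnormE a) -rmorphM.
Qed.
Lemma rnorm0 : rnorm (0 : A) = 0. Proof. by rewrite /rnorm normr0. Qed.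

Lemma rnorm_star a : rnorm (star a) = rnorm a.
Proof.
have le b : rnorm b <= rnorm (star b).
  have [->|b0] := eqVneq (rnorm b) 0; first exact: rnorm_ge0.
  have bp : 0 < rnorm b by rewrite lt_neqAle eq_sym b0 rnorm_ge0.
  by rewrite -(ler_pM2r bp) -expr2 -rnorm_starM rnormM_le.
by apply/eqP; rewrite eq_le le -{2}(starK a) le.
Qed.

(* The square root of [1 - h] is [1 - y], where [y] is the fixed point of the
   contraction [y |-> (h + y ^ 2) / 2] of the ball of radius [1 / 2]. *)
Lemma sqrt_1B (h : A) : star h = h -> rnorm h <= 3 / 4 ->
  exists b, star b * b = 1 - h.
Proof.
move=> hh hn; pose T y := (ofR (1/2) : Cx R) *: (h + y * y).
pose y := fix y n := if n is n'.+1 then T (y n') else 0.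
have half : cabs (ofR (1/2 : R)) = 1/2 by rewrite cabs_ofR ger0_norm//; lra.
(* [(3/4 + (1/2)^2) / 2 = 1/2], which explains the bound on [h]; the Lipschitz constant of [T] on
   this ball is [1/2] as well. *)
have yb n : rnorm (y n) <= 1/2.
  elim: n => [|n IH] /=; first by rewrite rnorm0; lra.
  rewrite /T rnormZ half; have := rnormD h (y n * y n).
  have := rnormM_le (y n) (y n); have := rnorm_ge0 (y n); nra.
have ys n : star (y n) = y n.
  elim: n => [|n IH] /=; first exact: star0.
  by rewrite /T starZ starD starM IH hh; congr (_ *: _); apply: complex_ext; rewrite !cReIm ?oppr0.
have TL u v : rnorm u <= 1/2 -> rnorm v <= 1/2 -> rnorm (T u - T v) <= 1/2 * rnorm (u - v).
  move=> un vn; rewrite /T -scalerBr rnormZ half opprD addrACA subrr add0r.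
  have -> : u * u - v * v = u * (u - v) + (u - v) * v.
    by rewrite mulrBr mulrBl addrA subrK.
  rewrite ler_pM2l ?divr_gt0//; apply: (le_trans (rnormD _ _)).
  have := rnormM_le u (u - v); have := rnormM_le (u - v) v; have := rnorm_ge0 (u - v); nra.
have step n : rnorm (y n.+1 - y n) <= (1/2) ^+ n.
  elim: n => [|n IH].
    by rewrite expr0 [y 0%N]/= subr0; apply: (le_trans (yb 1%N)); lra.
  by rewrite exprS; apply: (le_trans (TL (y n.+1) (y n) (yb _) (yb _))); rewrite ler_wpM2l// divr_ge0.
have dist n m : rnorm (y (n + m)%N - y n) <= 2 * (1/2) ^+ n - 2 * (1/2) ^+ (n + m).
  elim: m => [|m IH]; first by rewrite addn0 !subrr rnorm0.
  have -> : y (n + m.+1)%N - y n = (y (n + m).+1 - y (n + m)%N) + (y (n + m)%N - y n).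
    by rewrite addrA subrK addnS.
  apply: (le_trans (rnormD _ _)); rewrite addnS exprS; have := step (n + m)%N; lra.
have tail (e : R) : 0 < e -> exists N, forall n, (N <= n)%N -> 2 * (1/2 : R) ^+ n <= e.
  move=> e0; exists (Num.truncn (2 / e)).+1 => n Nn.
  rewrite expr_div_n expr1n mulrA mulr1 ler_pdivrMr ?exprn_gt0// mulrC -ler_pdivrMr//.
  apply: (@le_trans _ _ n%:R); last by rewrite -natrX ler_nat ltnW// ltn_expl.
  by apply: (@le_trans _ _ (Num.truncn (2 / e)).+1%:R); rewrite ?ler_nat// ltW// truncnS_gt.
have cy : cvg (y n @[n --> \oo]).
  apply: cauchy_cvg; apply: cauchy_exP => e e0.
  have e0' : 0 < cRe e by rewrite -ofR_gt0 -ge0_ofR// ltW.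
  have [|N HN] := tail (cRe e / 2); first by rewrite divr_gt0.
  exists (y N); rewrite /=; exists N => // n /= Nn.
  rewrite -ball_normE /ball_/= rnormE (ge0_ofR (ltW e0)) ltr_ofR -rnormN opprB.
  have := dist N (n - N)%N; rewrite subnKC// => H; apply: (le_lt_trans H).
  have := HN _ (leqnn _); have : 0 <= (1/2 : R) ^+ n by rewrite exprn_ge0// divr_ge0.
  lra.
pose l := lim (y n @[n --> \oo]).
have yl : y n @[n --> \oo] --> l by [].
have near_l (e : R) : 0 < e -> exists n, rnorm (l - y n) <= e /\ rnorm (l - y n.+1) <= e.
  move=> e0; have e0' : 0 < ofR e by rewrite ofR_gt0.
  move/cvgrPdist_le : yl => /(_ _ e0')[N _ HN]; exists N.
  by split; rewrite -ler_ofR -rnormE; apply: HN => /=.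
have eq0 a : (forall e : R, 0 < e -> rnorm a <= e) -> a = 0.
  move=> H; apply/eqP; rewrite -normr_eq0 rnormE.
  suff -> : rnorm a = 0 by rewrite rmorph0.
  by apply/eqP; rewrite eq_le rnorm_ge0 andbT; apply/ler_addgt0Pr => e /H; rewrite add0r.
have lb : rnorm l <= 1/2.
  apply/ler_addgt0Pr => e /near_l[n [H _]]; have := rnormD (l - y n) (y n).
  by rewrite subrK; have := yb n; lra.
have ls : star l = l.
  apply/eqP; rewrite -subr_eq0; apply/eqP/eq0 => e e0.
  have [|n [H _]] := near_l (e / 2); first by rewrite divr_gt0.
  have -> : star l - l = star (l - y n) - (l - y n).
    by rewrite starB ys opprB addrA subrK.
  by apply: (le_trans (rnormD _ _)); rewrite rnormN rnorm_star; lra.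
have lT : l = T l.
  apply/eqP; rewrite -subr_eq0; apply/eqP/eq0 => e e0.
  have [|n [H H']] := near_l (e / 2); first by rewrite divr_gt0.
  have -> : l - T l = (l - y n.+1) + (T (y n) - T l) by rewrite addrA subrK.
  apply: (le_trans (rnormD _ _)); have := TL _ _ (yb n) lb.
  by rewrite -(rnormN (y n - l)) opprB; have := rnorm_ge0 (l - y n); lra.
have l2 : l + l = h + l * l.
  rewrite {1 2}lT /T -scalerDl (_ : _ + _ = 1) ?scale1r//.
  by apply: complex_ext; rewrite !cReIm/=; lra.
exists (1 - l); rewrite starB star1 ls mulrBl mul1r mulrBr mulr1 opprB addrA.
by rewrite addrAC -[1 - l - l]addrA -opprD l2 opprD addrA subrK.
Qed.

End CstarBasics.

(** * Positive functionals *)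

Section PositiveFunctionals.
Variables (R : realType) (A : cstarType R).
Implicit Types (a b c : A) (k : Cx R).

Definition positive (psi : A -> Cx R) : Prop :=
  scalar psi /\ forall a, 0 <= psi (star a * a).

Section OnePositive.
Variable psi : A -> Cx R.
Hypothesis hpsi : positive psi.

Lemma posD a b : psi (a + b) = psi a + psi b.
Proof. by have := hpsi.1 1 a b; rewrite scale1r mul1r. Qed.
Lemma pos0 : psi 0 = 0.
Proof. by apply: (addrI (psi 0)); rewrite -posD !addr0. Qed.
Lemma posZ k a : psi (k *: a) = k * psi a.
Proof. by have := hpsi.1 k a 0; rewrite !addr0 pos0 addr0. Qed.
Lemma posN a : psi (- a) = - psi a.
Proof. by rewrite -scaleN1r posZ mulN1r. Qed.
Lemma posB a b : psi (a - b) = psi a - psi b.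
Proof. by rewrite posD posN. Qed.

(** [psi] is real at [star (1 + k *: a) * (1 + k *: a)]; the case [k = 1] compares the imaginary
    parts and [k = 'i] the real parts. *)
Lemma pos_conj a : psi (star a) = (psi a)^*.
Proof.
have H k : 0 <= psi (star (1 + k *: a) * (1 + k *: a)) by exact: hpsi.2.
have real k : cIm (k * psi a + k^* * psi (star a)) = 0.
  have p1 : cIm (psi 1) = 0 by have := cIm_ge0 (hpsi.2 1); rewrite star1 mulr1.
  have := cIm_ge0 (H k); rewrite starD star1 starZ mulrDl mul1r mulrDr mulr1.
  rewrite mulcZl mulcZr !posD !posZ !cImD p1 add0r (cImM k^* (k * _)) (cImM k (psi (_ * _))).
  rewrite (cReM k (psi (_ * _))) (cIm_ge0 (hpsi.2 a)) !cReIm; lra.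
have := real 1; have := real 'i; rewrite !cReIm => H1 H2.
by apply: complex_ext; rewrite !cReIm; lra.
Qed.

Definition gns_form (a b : A) : Cx R := psi (star b * a).

Lemma gns_semi_inner : semi_inner gns_form.
Proof.
split; rewrite /gns_form; last by move=> a; exact: hpsi.2.
- by move=> b k a a'; rewrite mulrDr mulcZr posD posZ.
- by move=> a b; rewrite -pos_conj starM starK.
Qed.

Lemma pos_CauchySchwarz a b :
  cabs (psi (star b * a)) ^+ 2 <= cRe (psi (star a * a)) * cRe (psi (star b * b)).
Proof. exact: si_CauchySchwarz gns_semi_inner a b. Qed.

(** With [h = star a * a], the element [1 - h / (2 |h|)] is within reach of [sqrt_1B], hence of the
    form [star b * b], and positivity of [psi] there is the bound. The factor 2 in place of the
    sharp 1 is the price of keeping away from norm 1; the later estimates tolerate any constant. *)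
Lemma pos_star_le a : cRe (psi (star a * a)) <= 2 * rnorm a ^+ 2 * cRe (psi 1).
Proof.
set h := star a * a; rewrite -rnorm_starM -/h.
have psi1 : 0 <= cRe (psi 1).
  by have := cRe_ge0 (hpsi.2 1); rewrite star1 mulr1.
have hs : star h = h by rewrite /h starM starK.
have [h0|hn0] := eqVneq (rnorm h) 0.
  have -> : h = 0 by apply/eqP; rewrite -normr_eq0 rnormE h0 rmorph0.
  by rewrite pos0 rnorm0 mulr0 mul0r.
have hp : 0 < rnorm h by rewrite lt_neqAle eq_sym hn0 rnorm_ge0.
pose t : R := 1 / (2 * rnorm h).
have t0 : 0 < t by rewrite divr_gt0// mulr_gt0.
have [|| b bE] := @sqrt_1B R A (ofR t *: h).
- by rewrite starZ hs; congr (_ *: _); apply: complex_ext; rewrite !cReIm ?oppr0.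
- rewrite rnormZ cabs_ofR (gtr0_norm t0) /t (_ : _ * rnorm h = 1 / 2); first lra.
  by field; rewrite gt_eqF.
have := cRe_ge0 (hpsi.2 b); rewrite bE posB posZ !cReIm mul0r subr0 subr_ge0.
rewrite -ler_pdivlMl// => H; apply: (le_trans H).
by rewrite /t invf_div divr1.
Qed.

Lemma pos_le a : cabs (psi a) <= 2 * cRe (psi 1) * rnorm a.
Proof.
have psi1 : 0 <= cRe (psi 1).
  by have := cRe_ge0 (hpsi.2 1); rewrite star1 mulr1.
rewrite -ler_sqr ?nnegrE ?cabs_ge0 ?mulr_ge0 ?rnorm_ge0//.
have := pos_CauchySchwarz a 1; rewrite star1 !mul1r => H; apply: (le_trans H).
apply: (le_trans (ler_wpM2r psi1 (pos_star_le a))).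
have := sqr_ge0 (rnorm a * cRe (psi 1)).
rewrite !exprMn (_ : 2 ^+ 2 = 4 :> R); last by rewrite -natrX.
by lra.
Qed.

End OnePositive.

Lemma state_positive psi : is_state psi -> positive psi.
Proof. by case. Qed.

Lemma state_le psi a : is_state psi -> cabs (psi a) <= 2 * rnorm a.
Proof.
by move=> hpsi; have := pos_le (state_positive hpsi) a; case: hpsi => _ _ ->; rewrite mulr1.
Qed.

Lemma state_star_le psi a : is_state psi ->
  cRe (psi (star a * a)) <= 2 * rnorm a ^+ 2.
Proof.
move=> hpsi; have := pos_star_le (state_positive hpsi) a.
by case: hpsi => _ _ ->; rewrite mulr1.
Qed.

Lemma state_hom (B : cstarType R) (f : B -> A) (psi : A -> Cx R) :
  star_hom f -> f 1 = 1 -> is_state psi -> is_state (psi \o f).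
Proof.
move=> [fl fM fs] f1 [pl pp p1]; split=> [k a b|a|] /=.
- by rewrite fl pl.
- by rewrite fM fs.
- by rewrite f1.
Qed.

End PositiveFunctionals.

(** * Hilbert space completion *)

Section Completion.
Variables (R : realType) (V : lmodType (Cx R)) (s : V -> V -> Cx R).

Definition approx_by (F : V -> Cx R) (e : R) (u : V) : Prop :=
  forall v, cabs (F v - s u v) <= e * snorm s v.

(* The completion of [V] is modelled as the norm closure of [V] in its
   conjugate dual; the proof argument makes the type depend on [hs]. *)
Definition approximable (hs : semi_inner s) : {pred V -> Cx R} :=
  fun F => `[< forall e : R, 0 < e -> exists u, approx_by F e u >].

Variable hs : semi_inner s.

Lemma approx_byS F e e' u : e <= e' -> approx_by F e u -> approx_by F e' u.
Proof. by move=> ee Fu v; apply: (le_trans (Fu v)); rewrite ler_wpM2r ?snorm_ge0. Qed.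

Lemma approx_by_lin k F G e e' u v : approx_by F e u -> approx_by G e' v ->
  approx_by (k *: F + G) (cabs k * e + e') (k *: u + v).
Proof.
move=> Fu Gv w; rewrite (siDl hs) (siZl hs).
have -> : (k *: F + G) w - (k * s u w + s v w) = k * (F w - s u w) + (G w - s v w).
  by rewrite /= opprD addrACA mulrBr.
apply: (le_trans (cabsD _ _)); rewrite mulrDl lerD//.
by rewrite cabsM -mulrA ler_wpM2l ?cabs_ge0.
Qed.

Fact approximable_submod : submod_closed (approximable hs).
Proof.
split=> [|k F G /asboolP HF /asboolP HG]; apply/asboolP => e e0.
  by exists 0 => v; rewrite (si0l hs) subr0 cabs0 mulr_ge0 ?snorm_ge0// ltW.
have k0 : 0 < cabs k + 1 by rewrite ltr_wpDl ?cabs_ge0.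
have [|u Fu] := HF (e / (2 * (cabs k + 1))); first by rewrite divr_gt0// mulr_gt0.
have [|v Gv] := HG (e / 2); first by rewrite divr_gt0.
exists (k *: u + v); apply: approx_byS (approx_by_lin k Fu Gv).
have -> : cabs k * (e / (2 * (cabs k + 1))) = e / 2 * (cabs k / (cabs k + 1)).
  by field; rewrite gt_eqF.
rewrite [leRHS](splitr e) lerD2r ler_piMr ?divr_ge0 ?(ltW e0)//.
by rewrite ler_pdivrMr// mul1r lerDl.
Qed.

HB.instance Definition _ := GRing.isSubmodClosed.Build (Cx R) (V -> Cx R)
  (approximable hs) approximable_submod.

Definition completion : Type := {F : V -> Cx R | approximable hs F}.

HB.instance Definition _ := [isSub of completion for @sval _ _].
HB.instance Definition _ := [Choice of completion by <:].
HB.instance Definition _ := [SubChoice_isSubLmodule of completion by <:].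

Implicit Types F G : completion.

Lemma completion_ext F G : (forall v, val F v = val G v) -> F = G.
Proof. by move=> FG; apply/val_inj/funext. Qed.

Lemma approximants F : exists u : nat -> V, forall n, approx_by (val F) (n.+1%:R)^-1 (u n).
Proof.
have /asboolP HF := valP F.
have H n : exists u, approx_by (val F) (n.+1%:R)^-1 u by apply: HF; rewrite invr_gt0.
by have [u Hu] := choice H; exists u.
Qed.

Definition approximant F (n : nat) : V := sval (cid (approximants F)) n.

Lemma approximantP F n : approx_by (val F) (n.+1%:R)^-1 (approximant F n).
Proof. by rewrite /approximant; case: cid. Qed.

Lemma le0_invS (x c : R) : (forall n, x <= c * (n.+1%:R)^-1) -> x <= 0.
Proof.
move=> H; rewrite leNgt; apply/negP => x0.
have c0 : 0 < c by have := H 0%N; rewrite invr1 mulr1; exact: lt_le_trans.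
have := H (Num.truncn (c / x)); rewrite leNgt => /negP; apply.
by rewrite ltr_pdivrMr// -ltr_pdivrMl// mulrC truncnS_gt.
Qed.

Lemma cabs_eq0_invS (z : Cx R) (c : R) : (forall n, cabs z <= c * (n.+1%:R)^-1) -> z = 0.
Proof.
by move=> /le0_invS z0; apply: cabs_eq0; apply/eqP; rewrite eq_le z0 cabs_ge0.
Qed.

Lemma approx_le F e e' u u' w :
  approx_by (val F) e u -> approx_by (val F) e' u' ->
  cabs (s (u - u') w) <= (e + e') * snorm s w.
Proof.
move=> Fu Fu'; rewrite (siBl hs).
have -> : s u w - s u' w = (val F w - s u' w) - (val F w - s u w).
  by ring.
apply: (le_trans (cabsD _ _)); rewrite cabsN addrC mulrDl lerD//.
Qed.

Lemma approx_dist F e e' u u' : 0 <= e -> 0 <= e' ->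
  approx_by (val F) e u -> approx_by (val F) e' u' -> snorm s (u - u') <= e + e'.
Proof.
move=> e0 e0' Fu Fu'; have [->|n0] := eqVneq (snorm s (u - u')) 0; first exact: addr_ge0.
have np : 0 < snorm s (u - u') by rewrite lt_neqAle eq_sym n0 snorm_ge0.
have := approx_le (u - u') Fu Fu'; rewrite (sqE hs) cabs_ofR -(snorm_sqr hs).
by rewrite ger0_norm ?sqr_ge0// expr2 ler_pM2r.
Qed.

Lemma completion_lin F k u v : val F (k *: u + v) = k^* * val F u + val F v.
Proof.
apply/eqP; rewrite -subr_eq0; apply/eqP.
apply: (@cabs_eq0_invS _ (snorm s (k *: u + v) + cabs k * snorm s u + snorm s v)) => n.
have H := approximantP F n; set t := approximant F n in H.
have -> : val F (k *: u + v) - (k^* * val F u + val F v) =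
  (val F (k *: u + v) - s t (k *: u + v)) - k^* * (val F u - s t u) - (val F v - s t v).
  by rewrite (siDr hs) (siZr hs); ring.
apply: (le_trans (cabsD _ _)); rewrite cabsN mulrDl lerD//; last by rewrite mulrC.
apply: (le_trans (cabsD _ _)); rewrite cabsN mulrDl lerD//; first by rewrite mulrC.
by rewrite cabsM cabs_conj -mulrA ler_wpM2l ?cabs_ge0// mulrC.
Qed.

Lemma completionB F u v : val F (u - v) = val F u - val F v.
Proof.
by rewrite addrC -scaleN1r completion_lin rmorphN rmorph1 mulN1r addrC.
Qed.

Lemma completion_le F e u w : approx_by (val F) e u ->
  cabs (val F w) <= (snorm s u + e) * snorm s w.
Proof.
move=> Fu; rewrite -(subrK (s u w) (val F w)); apply: (le_trans (cabsD _ _)).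
by rewrite mulrDl addrC lerD// si_le.
Qed.

(** The extension of [s] by continuity. A functional [F] already gives its pairing with the vectors
    of [V], so only the second argument is approximated. *)
Definition dot F G : Cx R := lim (val F (approximant G n) @[n --> \oo]).

Lemma dot_cvg F G : val F (approximant G n) @[n --> \oo] --> dot F G.
Proof.
apply: Cx_complete; apply: cauchy_exP => e e0.
have e0' : 0 < cRe e by rewrite -ofR_gt0 -ge0_ofR// ltW.
have := @completion_le F _ _ _ (approximantP F 0).
set c := snorm _ _ + _ => Hc.
have c0 : 0 <= c by rewrite addr_ge0 ?snorm_ge0// invr_ge0.
pose N := Num.truncn (2 * c / cRe e).
exists (val F (approximant G N)); exists N => // n /= Nn.
rewrite -ball_normE /ball_/= cabs_ball// -completionB.
apply: (le_lt_trans (Hc _)).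
have H : snorm s (approximant G N - approximant G n) <= 2 * (N.+1%:R)^-1.
  apply: le_trans (approx_dist _ _ (approximantP G N) (approximantP G n)) _; rewrite ?invr_ge0//.
  have : (n.+1%:R)^-1 <= (N.+1%:R)^-1 :> R by rewrite lef_pV2 ?posrE// ler_nat.
  by move: (N.+1%:R^-1) (n.+1%:R^-1) => x y xy; lra.
apply: (le_lt_trans (ler_wpM2l c0 H)).
by rewrite mulrA ltr_pdivrMr// -ltr_pdivrMl// mulrC (mulrC c) truncnS_gt.
Qed.

Lemma cvg_cabs_le (u : nat -> Cx R) (l z : Cx R) (b : nat -> R) (c : R) :
  u n @[n --> \oo] --> l -> (forall n, cabs (u n - z) <= b n) ->
  (forall n, b n <= c + b 0%N * (n.+1%:R)^-1) -> cabs (l - z) <= c.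
Proof.
move=> ul H Hb; apply/ler_addgt0Pr => e e0.
have e20 : 0 < ofR (e / 2) by rewrite ofR_gt0 divr_gt0.
move/cvgrPdist_le : ul => /(_ _ e20)[N _ HN].
pose M := maxn N (Num.truncn (2 * `|b 0%N| / e)).
have := HN M (leq_maxl _ _); rewrite cabsE ler_ofR => H1.
have H2 := H M; have := Hb M.
have H3 : b 0%N * (M.+1%:R)^-1 <= e / 2.
  apply: (@le_trans _ _ (`|b 0%N| * (M.+1%:R)^-1)).
    by rewrite ler_wpM2r ?invr_ge0 ?ler_norm.
  rewrite ler_pdivrMr// -ler_pdivrMl ?divr_gt0// invf_div.
  rewrite mulrAC; apply: ltW; apply: (lt_le_trans (truncnS_gt _)).
  by rewrite ler_nat ltnS leq_maxr.
move=> H4; have {}H4 : b M <= c + e / 2 by apply: le_trans H4 _; rewrite lerD2l.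
have := cabsD (l - u M) (u M - z); rewrite addrA subrK; lra.
Qed.

Lemma dot_approx F G e e' u v : 0 <= e -> 0 <= e' ->
  approx_by (val F) e u -> approx_by (val G) e' v ->
  cabs (dot F G - s u v) <= e * snorm s v + (snorm s u + e) * e'.
Proof.
move=> e0 e0' Fu Gv; set c := snorm s u + e.
have c0 : 0 <= c by rewrite addr_ge0 ?snorm_ge0.
apply: (cvg_cabs_le (b := fun n => e * snorm s v + c * (e' + (n.+1%:R)^-1)) (dot_cvg (G := G))) => n.
  have -> : val F (approximant G n) - s u v =
    (val F v - s u v) + val F (approximant G n - v) by rewrite completionB; ring.
  apply: (le_trans (cabsD _ _)); apply: lerD; first exact: Fu.
  apply: (le_trans (completion_le _ Fu)); rewrite -/c ler_wpM2l//.
  by rewrite (addrC e'); apply: approx_dist (approximantP G n) Gv => //; rewrite invr_ge0.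
rewrite invr1 (mulrDr c) addrA lerD2l.
rewrite ler_wpM2r ?invr_ge0//.
have : 0 <= e * snorm s v by rewrite mulr_ge0 ?snorm_ge0.
by have := mulr_ge0 c0 e0'; lra.
Qed.

Lemma approximant_bounded F : exists M : R, forall n, snorm s (approximant F n) <= M.
Proof.
exists (snorm s (approximant F 0) + 2) => n.
rewrite -(subrK (approximant F 0) (approximant F n)) addrC.
apply: (le_trans (snormD hs _ _)); rewrite lerD2l.
apply: le_trans (approx_dist _ _ (approximantP F n) (approximantP F 0)) _; rewrite ?invr_ge0//.
by rewrite invr1 -[2]/(1 + 1) lerD2r invf_le1// ler1n.
Qed.

Lemma dot_approximant F G : exists c : R, forall n,
  cabs (dot F G - s (approximant F n) (approximant G n)) <= c * (n.+1%:R)^-1.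
Proof.
have [M HM] := approximant_bounded F; have [N HN] := approximant_bounded G.
exists (N + (M + 1)) => n.
have i0 : 0 <= (n.+1%:R)^-1 :> R by rewrite invr_ge0.
have i1 : (n.+1%:R)^-1 <= 1 :> R by rewrite invf_le1// ler1n.
apply: (le_trans (dot_approx i0 i0 (approximantP F n) (approximantP G n))).
by rewrite (mulrDl N); apply: lerD; [rewrite mulrC ler_wpM2r|rewrite ler_wpM2r// lerD].
Qed.

Lemma dot_lin k F F' G : dot (k *: F + F') G = k * dot F G + dot F' G.
Proof.
apply: (cvg_unique (@norm_hausdorff _ (Cx R)) (@dot_cvg (k *: F + F') G)).
have -> : (fun n => val (k *: F + F') (approximant G n)) =
  (fun n => k * val F (approximant G n) + val F' (approximant G n)) by [].
by apply: cvgD; [apply: cvgM; [exact: cvg_cst|]|]; exact: dot_cvg.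
Qed.

Lemma dot_semi_inner : semi_inner dot.
Proof.
have dC F G : dot G F = (dot F G)^*.
  apply/eqP; rewrite -subr_eq0; apply/eqP.
  have [c Hc] := dot_approximant F G; have [c' Hc'] := dot_approximant G F.
  apply: (@cabs_eq0_invS _ (c + c')) => n.
  have -> : dot G F - (dot F G)^* = (dot G F - s (approximant G n) (approximant F n)) -
     (dot F G - s (approximant F n) (approximant G n))^*.
    by rewrite rmorphB/= -(si_conj hs) opprB addrA subrK.
  apply: (le_trans (cabsD _ _)); rewrite cabsN cabs_conj mulrDl addrC; exact: lerD.
split=> [G k F F'|//|F]; first exact: dot_lin.
have -> : dot F F = ofR (cRe (dot F F)).
  apply: complex_ext; rewrite ?cIm_ofR// .
  by have := congr1 (@cIm R) (dC F F); rewrite cIm_conj; lra.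
rewrite ofR_ge0 -oppr_le0; have [c Hc] := dot_approximant F F.
apply: (@le0_invS _ c) => n; have := Hc n; set u := approximant F n.
have := cRe_le_cabs (dot F F - s u u); rewrite ler_norml cReB => /andP[H _].
by have := sq_ge0 hs u; rewrite /sq; move: H; move: (c / _) => q; lra.
Qed.

Fact embed_subproof u : approximable hs (s u).
Proof. by apply/asboolP => e e0; exists u => v; rewrite subrr cabs0 mulr_ge0 ?snorm_ge0// ltW. Qed.

Definition embed u : completion := Sub (s u) (embed_subproof u).

Lemma embed_approx u : approx_by (val (embed u)) 0 u.
Proof. by move=> v; rewrite SubK subrr cabs0 mul0r. Qed.

Lemma dot_embed F u : dot F (embed u) = val F u.
Proof.
apply/eqP; rewrite -subr_eq0; apply/eqP; apply: (@cabs_eq0_invS _ (2 * snorm s u)) => n.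
have H := approximantP F n; have i0 : 0 <= (n.+1%:R)^-1 :> R by rewrite invr_ge0.
have := dot_approx i0 (lexx 0) H (embed_approx u); rewrite mulr0 addr0 => H1.
have -> : dot F (embed u) - val F u = (dot F (embed u) - s (approximant F n) u) -
  (val F u - s (approximant F n) u) by ring.
apply: (le_trans (cabsD _ _)); rewrite cabsN; have := H u; rewrite -mulrA (mulrC 2).
by move: H1; rewrite (mulrC (snorm s u)); move: (_^-1 * snorm s u) => q; lra.
Qed.

Lemma snorm_embed u : snorm dot (embed u) = snorm s u.
Proof. by rewrite /snorm /sq dot_embed. Qed.

Lemma completion_bound F w : cabs (val F w) <= snorm dot F * snorm s w.
Proof. by rewrite -dot_embed -snorm_embed (si_le dot_semi_inner). Qed.

Lemma snorm_dot_eq0 F : snorm dot F = 0 -> F = 0.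
Proof.
move=> F0; apply: completion_ext => v; apply: cabs_eq0; apply/eqP.
by rewrite eq_le cabs_ge0 andbT; have := completion_bound F v; rewrite F0 mul0r.
Qed.

Lemma embed_dense F (e : R) : 0 < e -> exists u, snorm dot (F - embed u) <= e.
Proof.
move=> e0; have [c Hc] := dot_approximant F F.
apply: contrapT => /forallNP H.
suff : e ^+ 2 <= 0 by rewrite leNgt exprn_gt0.
have [c' Hc'] := approximant_bounded F.
apply: (@le0_invS _ (c + 2 * c')) => n; set u := approximant F n.
have /negP := H u; rewrite -ltNge => He.
have : e ^+ 2 <= snorm dot (F - embed u) ^+ 2 by rewrite ler_sqr ?nnegrE ?snorm_ge0 ?ltW.
move=> /le_trans; apply; rewrite (snorm_sqr dot_semi_inner) /sq.
rewrite (siBl dot_semi_inner) !(siBr dot_semi_inner) !dot_embed.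
rewrite (si_conj dot_semi_inner F (embed u)) dot_embed SubK !(cReB, cRe_conj).
have H1 := Hc n; rewrite -/u in H1.
have H2 := approximantP F n u; rewrite -/u in H2.
have := cRe_le_cabs (dot F F - s u u); have := cRe_le_cabs (val F u - s u u).
rewrite !ler_norml !cReB => /andP[A1 A2] /andP[B1 B2].
have : (n.+1%:R)^-1 * snorm s u <= (n.+1%:R)^-1 * c'.
  by rewrite ler_wpM2l ?invr_ge0// Hc'.
by move: H1 H2; move: (n.+1%:R^-1) => i H1 H2 H3; lra.
Qed.

(** [dot F F] is nearly [val F u] for [u] close to [F]. Together with [completion_bound] this
    identifies the Hilbert space norm with the dual norm, so that pointwise estimates on functionals
    become norm estimates. *)
Lemma snorm_dot_le F (M : R) : (forall w, cabs (val F w) <= M * snorm s w) ->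
  0 <= M -> snorm dot F <= M.
Proof.
move=> HM M0; have [->//|n0] := eqVneq (snorm dot F) 0.
have np : 0 < snorm dot F by rewrite lt_neqAle eq_sym n0 snorm_ge0.
rewrite -(ler_pM2r np) -expr2 (snorm_sqr dot_semi_inner).
apply/ler_addgt0Pr => e e0; pose d := e / (snorm dot F + M).
have p0 : 0 < snorm dot F + M by rewrite ltr_wpDr.
have d0 : 0 < d by rewrite divr_gt0.
have [u Hu] := embed_dense F d0.
have E : dot F F = dot F (F - embed u) + val F u.
  by rewrite (siBr dot_semi_inner) dot_embed subrK.
rewrite /sq E cReD.
have h1 := le_trans (ler_norm _) (cRe_le_cabs (dot F (F - embed u))).
have h2 := le_trans (ler_norm _) (cRe_le_cabs (val F u)).
have h3 := si_le dot_semi_inner F (F - embed u).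
have h4 := HM u.
have h5 : snorm s u <= snorm dot F + d.
  rewrite -snorm_embed -(subrK F (embed u)) addrC.
  apply: (le_trans (snormD dot_semi_inner _ _)).
  by rewrite lerD2l (snormB dot_semi_inner).
have h6 := ler_wpM2l (ltW np) Hu.
have h7 := ler_wpM2l M0 h5.
have -> : M * snorm dot F + e = M * (snorm dot F + d) + snorm dot F * d.
  by rewrite /d; field; rewrite gt_eqF.
by lra.
Qed.

Definition cnorm F : Cx R := ofR (snorm dot F).

Fact cnormD F G : cnorm (F + G) <= cnorm F + cnorm G.
Proof. by rewrite /cnorm -rmorphD/= ler_ofR (snormD dot_semi_inner). Qed.
Fact cnormZ k F : cnorm (k *: F) = `|k| * cnorm F.
Proof. by rewrite /cnorm (snormZ dot_semi_inner) rmorphM/= -cabsE. Qed.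
Fact cnorm_eq0 F : cnorm F = 0 -> F = 0.
Proof. by move=> /(congr1 (@cRe R)) /=; exact: snorm_dot_eq0. Qed.

HB.instance Definition _ := Lmodule_isNormed.Build (Cx R) completion
  cnormD cnormZ cnorm_eq0.

Lemma completion_normE F : `|F| = ofR (snorm dot F). Proof. by []. Qed.

Fact completion_complete (Phi : set_system completion) :
  ProperFilter Phi -> cauchy Phi -> cvg Phi.
Proof.
move=> FF /cauchy_ballP Fc.
have Fc' (e : R) : 0 < e -> exists A B : set completion, [/\ Phi A, Phi B &
    forall F G, A F -> B G -> snorm dot (F - G) < e].
  move=> e0; have e0' : 0 < ofR e by rewrite ofR_gt0.
  have := Fc _ e0'; rewrite !near_simpl /= => -[[A B]/= [FA FB] AB].
  exists A, B; split=> // F G AF BG.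
  have := AB (F, G) (conj AF BG); rewrite /= -ball_normE /ball_/= completion_normE ltr_ofR.
  by [].
have ev w : exists l : Cx R, (fun F : completion => val F w : Cx R) @ Phi --> l.
  exists (lim ((fun F : completion => val F w : Cx R) @ Phi)).
  apply: Cx_complete; apply/cauchy_ballP => e e0.
  have e0' : 0 < cRe e by rewrite -ofR_gt0 -ge0_ofR// ltW.
  have [|A [B [FA FB AB]]] := Fc' (cRe e / (snorm s w + 1)).
    by rewrite divr_gt0// ltr_wpDl ?snorm_ge0.
  exists ((fun F => val F w) @` A, (fun F => val F w) @` B).
    by split; rewrite /= nbhs_simpl/=; [apply: filterS FA|apply: filterS FB] => F ?; exact: imageP.
  move=> [_ _] [/= [F AF <-] [G BG <-]]; rewrite -ball_normE /ball_/= cabs_ball//.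
  have := completion_bound (F - G) w; rewrite /= => /le_lt_trans; apply.
  have n0 := snorm_ge0 s w; have np : 0 < snorm s w + 1 by lra.
  apply: (@le_lt_trans _ _ (cRe e / (snorm s w + 1) * snorm s w)).
    by rewrite ler_wpM2r// ltW// AB.
  by rewrite mulrAC ltr_pdivrMr// ltr_pM2l//; lra.
(* The candidate limit is taken pointwise; [close] makes the approach uniform relative to [snorm],
   which keeps [L] in the norm closure of [V]. *)
have [L HL] := choice ev.
have close (e : R) : 0 < e -> exists2 B, Phi B &
    forall G, B G -> forall w, cabs (L w - val G w) <= e * snorm s w.
  move=> e0; have [A [B [FA FB AB]]] := Fc' _ e0.
  exists B => // G BG w; apply/ler_addgt0Pr => d d0.
  have d0' : 0 < ofR d by rewrite ofR_gt0.
  have /cvgrPdist_le/(_ _ d0') HLw := HL w.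
  have [F [AF HF]] : exists F, A F /\ `|L w - val F w| <= ofR d.
    by apply: (@filter_ex _ Phi); apply: filterI.
  have -> : L w - val G w = (L w - val F w) + val (F - G) w by rewrite /= addrA subrK.
  apply: (le_trans (cabsD _ _)); rewrite addrC lerD//; last by rewrite -ler_ofR -cabsE.
  apply: (le_trans (completion_bound _ _)); rewrite ler_wpM2r ?snorm_ge0//.
  exact/ltW/AB.
have La : approximable hs L.
  apply/asboolP; move=> r r0; have e20 : 0 < r / 2 by rewrite divr_gt0.
  have [B FB HB] := close _ e20.
  have [G BG] := @filter_ex _ Phi _ _ FB.
  have /asboolP/(_ _ e20)[u Gu] := valP G; exists u => v.
  rewrite -(subrK (val G v) (L v)) -addrA; apply: (le_trans (cabsD _ _)).
  by rewrite (splitr r) mulrDl lerD ?HB.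
apply: (cvgP (Sub L La : completion)); apply/cvgrPdist_le => e e0.
have e0' : 0 < cRe e by rewrite -ofR_gt0 -ge0_ofR// ltW.
have [B FB HB] := close _ e0'.
apply: filterS FB => G BG; rewrite completion_normE (ge0_ofR (ltW e0)) ler_ofR.
by apply: snorm_dot_le (ltW e0') => w; exact: HB.
Qed.

HB.instance Definition _ := Uniform_isComplete.Build completion completion_complete.

Fact dot_norm F : dot F F = `|F| ^+ 2.
Proof. by rewrite completion_normE -rmorphXn/= (snorm_sqr dot_semi_inner) (sqE dot_semi_inner). Qed.

HB.instance Definition _ := isHilbert.Build R completion
  (si_scalar dot_semi_inner) (si_conj dot_semi_inner) dot_norm.

End Completion.

Lemma lipschitz_continuous (R : realType) (V W : normedModType (Cx R)) (f : V -> W) (K : R) :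
  0 <= K -> (forall x y, rnorm (f x - f y) <= K * rnorm (x - y)) -> continuous f.
Proof.
move=> K0 HK x; apply/cvgrPdist_le => e e0.
have K1 : 0 < K + 1 by rewrite ltr_wpDl.
have e0' : 0 < cRe e by rewrite -ofR_gt0 -ge0_ofR// ltW.
apply/nbhs_ballP; exists (ofR (cRe e / (K + 1))) => /=.
  by rewrite ofR_gt0 divr_gt0.
move=> y; rewrite -ball_normE /ball_/= rnormE ltr_ofR => xy.
rewrite rnormE {1}(ge0_ofR (ltW e0)) ler_ofR.
apply: (le_trans (HK _ _)); apply: (@le_trans _ _ (K * (cRe e / (K + 1)))).
  by rewrite ler_wpM2l// ltW.
by rewrite mulrCA ler_piMr ?(ltW e0')// ler_pdivrMr// mul1r lerDl.
Qed.

Section Lift.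
Variables (R : realType) (V : lmodType (Cx R)) (s : V -> V -> Cx R).
Variable hs : semi_inner s.
Local Notation H := (completion hs).

Definition bounded_adjoint (T T' : V -> V) : Prop :=
  (forall u v, s (T u) v = s u (T' v)) /\
  exists2 K : R, 0 <= K & forall v,
    snorm s (T v) <= K * snorm s v /\ snorm s (T' v) <= K * snorm s v.

Lemma bounded_adjointC T T' : bounded_adjoint T T' -> bounded_adjoint T' T.
Proof.
move=> [TT [K K0 HK]]; split; last by exists K => // v; have [] := HK v.
by move=> u v; rewrite (si_conj hs v) -TT -(si_conj hs).
Qed.

(* On functionals, the extension of an operator is precomposition with its
   adjoint. *)
Definition lift (T' : V -> V) (F : H) : H := insubd 0 (fun v => val F (T' v)).

Variables T T' : V -> V.
Hypothesis hT : bounded_adjoint T T'.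

(** If [val F] is close to [s u], its composite with [T'] is close to [s (T u)], hence approximable;
    the default value of [insubd] is never taken. *)
Lemma liftE F v : val (lift T' F) v = val F (T' v).
Proof.
rewrite /lift insubdK//; apply/asboolP => e e0.
have [TT [K K0 HK]] := hT.
have K1 : 0 < K + 1 by rewrite ltr_wpDl.
have /asboolP HF := valP F.
have [|u Fu] := HF (e / (K + 1)); first by rewrite divr_gt0.
exists (T u) => w; rewrite TT; apply: (le_trans (Fu _)).
apply: (@le_trans _ _ (e / (K + 1) * (K * snorm s w))).
  by apply: ler_wpM2l; [rewrite divr_ge0// ltW|exact: (HK w).2].
rewrite mulrA ler_wpM2r ?snorm_ge0// mulrAC ler_pdivrMr// ler_wpM2l ?(ltW e0)//.
by rewrite lerDl.
Qed.

Lemma lift_linear : linear (lift T').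
Proof.
move=> k F G; apply: completion_ext => v; rewrite liftE.
transitivity (k * val (lift T' F) v + val (lift T' G) v); last by [].
by rewrite !liftE.
Qed.

Lemma liftB F G : lift T' (F - G) = lift T' F - lift T' G.
Proof.
apply: completion_ext => v; rewrite liftE.
transitivity (val (lift T' F) v - val (lift T' G) v); last by [].
by rewrite !liftE.
Qed.

Lemma lift_embed u : lift T' (embed hs u) = embed hs (T u).
Proof. by apply: completion_ext => v; rewrite liftE /= hT.1. Qed.

Lemma lift_bound : exists2 K : R, 0 <= K & forall F : H,
  snorm (@dot R V s hs) (lift T' F) <= K * snorm (@dot R V s hs) F.
Proof.
have [TT [K K0 HK]] := hT; exists K => // F.
apply: snorm_dot_le; last by rewrite mulr_ge0 ?snorm_ge0.
move=> w; rewrite liftE; apply: (le_trans (completion_bound _ _)).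
rewrite (mulrC K) -mulrA ler_wpM2l ?snorm_ge0//; exact: (HK w).2.
Qed.

Lemma lift_continuous : continuous (lift T' : H -> H).
Proof.
have [K K0 HK] := lift_bound.
apply: (@lipschitz_continuous R (H : normedModType (Cx R)) (H : normedModType (Cx R)) _ K K0) => F G.
by rewrite -liftB; exact: HK.
Qed.

End Lift.

Section LiftAdjoint.
Variables (R : realType) (V : lmodType (Cx R)) (s : V -> V -> Cx R).
Variables (hs : semi_inner s) (T T' : V -> V).
Hypothesis hT : bounded_adjoint s T T'.
Local Notation H := (completion hs : hilbertType R).

(** Both sides agree when the second vector comes from [V]; density and the bounds on the two lifted
    operators do the rest. *)
Lemma lift_adjoint : @is_adjoint R H (lift T') (lift T).
Proof.
have hT' := bounded_adjointC hs hT; have hd := dot_semi_inner hs.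
have [K K0 HK] := lift_bound hs hT; have [K' K0' HK'] := lift_bound hs hT'.
move=> F G; rewrite /dotp /=; change (dot (lift T' F) G = dot F (lift T G)).
have E v : dot (lift T' F) (embed hs v) = dot F (lift T (embed hs v)).
  by rewrite (lift_embed hs hT') !dot_embed (liftE hT).
apply/eqP; rewrite -subr_eq0; apply/eqP; apply: cabs_eq0.
apply/eqP; rewrite eq_le cabs_ge0 andbT; apply/ler_addgt0Pr => e e0; rewrite add0r.
set nF := snorm (@dot R V s hs) F.
have nF0 : 0 <= nF by exact: snorm_ge0.
have c0 : 0 < (K + K') * nF + 1 by rewrite ltr_wpDl// mulr_ge0// addr_ge0.
have [|v Hv] := @embed_dense R V s hs G (e / ((K + K') * nF + 1)); first by rewrite divr_gt0.
have -> : dot (lift T' F) G - dot F (lift T G) =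
    dot (lift T' F) (G - embed hs v) - dot F (lift T (G - embed hs v)).
  by rewrite (liftB hT') !(siBr hd) E; ring.
apply: (le_trans (cabsD _ _)); rewrite cabsN.
have H1 := si_le hd (lift T' F) (G - embed hs v).
have H2 := si_le hd F (lift T (G - embed hs v)).
have H3 := HK F; have H4 := HK' (G - embed hs v).
rewrite -/nF in H2 H3.
set d := snorm _ (G - _) in Hv H1 H4.
have d0 : 0 <= d by exact: snorm_ge0.
have H5 : cabs (dot (lift T' F) (G - embed hs v)) <= K * nF * d.
  by apply: (le_trans H1); rewrite ler_wpM2r.
have H6 : cabs (dot F (lift T (G - embed hs v))) <= K' * nF * d.
  by apply: (le_trans H2); rewrite (mulrC K') -mulrA ler_wpM2l.
apply: (le_trans (lerD H5 H6)); rewrite -!mulrDl.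
apply: (@le_trans _ _ ((K + K') * nF * (e / ((K + K') * nF + 1)))).
  by rewrite ler_wpM2l// mulr_ge0// addr_ge0.
by rewrite mulrCA ler_piMr ?(ltW e0)// ler_pdivrMr// mul1r lerDl.
Qed.

End LiftAdjoint.

(** * Unordered sums *)

#[local] Existing Instance summability.totally_filter.

Section UnorderedSums.
Variables (R : realType) (I : choiceType).
Implicit Types (f g : I -> Cx R) (l : Cx R) (J : {fset I}).

Definition psum (V : nmodType) (f : I -> V) J : V := \sum_(i <- J) f i.

Definition has_sum f l : Prop := forall e : R, 0 < e ->
  exists J0, forall J, (J0 `<=` J)%fset -> cabs (l - psum f J) <= e.

Lemma partial_sumE f J : summability.partial_sum f J = psum f J.
Proof. by rewrite /summability.partial_sum /psum big_seq_fsetE. Qed.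

Lemma has_sum_cvg f l : has_sum f l ->
  summability.partial_sum f @ summability.totally --> l.
Proof.
move=> H; apply/cvgrPdist_le => e e0.
have e0' : 0 < cRe e by rewrite -ofR_gt0 -ge0_ofR// ltW.
have [J0 HJ] := H _ e0'; exists J0 => // J /= JJ.
by rewrite partial_sumE cabsE (ge0_ofR (ltW e0)) ler_ofR HJ.
Qed.

Lemma has_sum_sum f l : has_sum f l -> summability.sum f = l.
Proof.
by move=> /has_sum_cvg H; apply: cvg_lim => //; exact: (@norm_hausdorff _ (Cx R)).
Qed.

Lemma has_sum_unique f l l' : has_sum f l -> has_sum f l' -> l = l'.
Proof. by move=> /has_sum_sum <- /has_sum_sum <-. Qed.

Lemma psum_lin k f g J : psum (fun i => k * f i + g i) J = k * psum f J + psum g J.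
Proof. by rewrite /psum big_split mulr_sumr. Qed.

Lemma has_sum_lin k f g l l' : has_sum f l -> has_sum g l' ->
  has_sum (fun i => k * f i + g i) (k * l + l').
Proof.
move=> Hf Hg e e0; have k0 : 0 < cabs k + 1 by rewrite ltr_wpDl ?cabs_ge0.
have [|J0 HJ] := Hf (e / 2 / (cabs k + 1)); first by rewrite !divr_gt0.
have [|J1 HJ1] := Hg (e / 2); first by rewrite divr_gt0.
exists (J0 `|` J1)%fset => J; rewrite fsubUset => /andP[/HJ H0 /HJ1 H1].
rewrite psum_lin opprD addrACA -mulrBr; apply: (le_trans (cabsD _ _)).
rewrite (splitr e) lerD// cabsM; apply: (le_trans (ler_wpM2l (cabs_ge0 _) H0)).
by rewrite mulrCA ler_piMr ?divr_ge0 ?(ltW e0)// ler_pdivrMr// mul1r lerDl.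
Qed.

Lemma has_sum_ge0 f l : (forall i, 0 <= f i) -> has_sum f l -> 0 <= l.
Proof.
move=> f0 H; have p0 J : 0 <= psum f J by apply: sumr_ge0 => i _.
have part (e : R) : 0 < e -> `|cIm l| <= e /\ - e <= cRe l.
  move=> e0; have [J HJ] := H _ e0; have := HJ J (fsubset_refl _) => {}HJ.
  have := cIm_le_cabs (l - psum f J); have := cRe_le_cabs (l - psum f J).
  rewrite cReB cImB (cIm_ge0 (p0 J)) subr0 => A B; split; first exact: le_trans HJ.
  by have := cRe_ge0 (p0 J); move: (le_trans A HJ); rewrite ler_norml; lra.
have -> : l = ofR (cRe l).
  apply: complex_ext; rewrite ?cIm_ofR//; apply/eqP; rewrite -normr_le0.
  by apply/ler_addgt0Pr => e /part[]; rewrite add0r.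
by rewrite ofR_ge0; apply/ler_addgt0Pr => e /part[_]; lra.
Qed.

Lemma cabs_psum f J : cabs (psum f J) <= psum (fun i => cabs (f i)) J.
Proof.
rewrite /psum; elim/big_ind2 : _ => //=; first by rewrite cabs0.
by move=> x a y b xa yb; apply: (le_trans (cabsD _ _)); rewrite lerD.
Qed.

Lemma psumD (V : zmodType) (f : I -> V) J0 J : (J0 `<=` J)%fset ->
  psum f J - psum f J0 = psum f (J `\` J0)%fset.
Proof.
move=> JJ; rewrite /psum (big_fsetID _ (mem J0) J)/=.
have -> : [fset x in J | x \in J0]%fset = J0.
  by apply/fsetP => x; rewrite !inE/= andbC; case: (boolP (x \in J0)) => //= /(fsubsetP JJ).
have -> : [fset x in J | x \notin J0]%fset = (J `\` J0)%fset.
  by apply/fsetP => x; rewrite !inE/= andbC.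
by rewrite addrC addKr.
Qed.

Lemma psum_ge0_tail (b : I -> R) (M : R) : (forall i, 0 <= b i) ->
  (forall J, psum b J <= M) -> forall e : R, 0 < e ->
  exists J0, forall J, (J0 `<=` J)%fset -> psum b J - psum b J0 <= e.
Proof.
move=> b0 bM e e0.
have hs : has_sup (range (psum b)).
  by split; [exists (psum b fset0), fset0|exists M => _ [J _ <-]].
have [_ [J0 _ <-] HJ0] := sup_adherent e0 hs.
exists J0 => J JJ; have : psum b J <= sup (range (psum b)).
  by apply: sup_ubound; [exact: hs.2|exists J].
by move: HJ0; lra.
Qed.

(* [J0] depends only on the dominating family. *)
Lemma dominated_has_sum (b : I -> R) (M : R) : (forall i, 0 <= b i) ->
  (forall J, psum b J <= M) -> forall e : R, 0 < e -> exists J0, forall f,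
    (forall i, cabs (f i) <= b i) -> forall l, has_sum f l ->
    cabs (l - psum f J0) <= e.
Proof.
move=> b0 bM e e0; have [J0 HJ0] := psum_ge0_tail b0 bM e0.
exists J0 => f fb l Hl; apply/ler_addgt0Pr => d d0.
have [J1 HJ1] := Hl _ d0; set J := (J0 `|` J1)%fset.
have J0J : (J0 `<=` J)%fset by rewrite fsubsetUl.
have -> : l - psum f J0 = (l - psum f J) + psum f (J `\` J0)%fset.
  by rewrite -psumD// addrA subrK.
apply: (le_trans (cabsD _ _)); rewrite addrC lerD//; last by rewrite HJ1// fsubsetUr.
apply: (le_trans (cabs_psum _ _)); apply: le_trans (HJ0 _ J0J); rewrite psumD//.
by apply: ler_sum => i _ /=.
Qed.

Lemma abs_has_sum (b : I -> R) (M : R) f : (forall i, cabs (f i) <= b i) ->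
  (forall J, psum b J <= M) -> exists l, has_sum f l.
Proof.
move=> fb bM; have b0 i : 0 <= b i by apply: le_trans (fb i); exact: cabs_ge0.
have cv : cvg (psum f @ summability.totally).
  apply: Cx_complete; apply: cauchy_exP => e e0.
  have e0' : 0 < cRe e by rewrite -ofR_gt0 -ge0_ofR// ltW.
  have [|J0 HJ0] := @psum_ge0_tail _ _ b0 bM (cRe e / 2); first by rewrite divr_gt0.
  exists (psum f J0); exists J0 => // J /= JJ.
  rewrite -ball_normE /ball_/= cabs_ball// -cabsN opprB psumD//.
  apply: (le_lt_trans (cabs_psum _ _)); apply: (@le_lt_trans _ _ (cRe e / 2)); last by lra.
  by apply: le_trans (HJ0 _ JJ); rewrite psumD//; apply: ler_sum => i _ /=.
exists (lim (psum f @ summability.totally)) => e e0.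
have e0' : 0 < ofR e by rewrite ofR_gt0.
move/cvgrPdist_le : cv => /(_ _ e0')[J0 _ HJ0]; exists J0 => J JJ.
by have := HJ0 J JJ; rewrite /= cabsE ler_ofR.
Qed.

(** As [g] is a left inverse of [h], the second hypothesis is vanishing off the range of [h]. The
    intended [h] are the translations of [Zplus n], which are injective but in general not onto. *)
Lemma has_sum_reindex (h g : I -> I) f l : cancel h g ->
  (forall i, h (g i) != i -> f i = 0) -> has_sum (f \o h) l -> has_sum f l.
Proof.
move=> hg f0 H e e0; have [J0 HJ0] := H _ e0.
exists [fset h i | i in J0]%fset => J JJ.
have := HJ0 [fset g i | i in J & h (g i) == i]%fset.
have -> : psum (f \o h) [fset g i | i in J & h (g i) == i]%fset = psum f J.
  rewrite /psum big_imfset/=; last first.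
    move=> x y /andP[_ /eqP hx] /andP[_ /eqP hy] /= gxy.
    by rewrite -hx -hy gxy.
  rewrite big_filter [RHS](bigID (fun i => h (g i) == i))/=.
  rewrite [X in _ = _ + X]big1 ?addr0; last by move=> i; exact: f0.
  by apply: eq_bigr => i /eqP ->.
apply; apply/fsubsetP => j jJ; apply/imfsetP; exists (h j); last by rewrite hg.
rewrite !inE hg eqxx andbT; apply: (fsubsetP JJ); apply/imfsetP; by exists j.
Qed.

Lemma has_sum_finite f i0 : (forall i, i != i0 -> f i = 0) -> has_sum f (f i0).
Proof.
move=> f0 e e0; exists [fset i0]%fset => J; rewrite fsub1set => iJ.
rewrite /psum (big_fsetD1 i0)//= big1_fset ?addr0 ?subrr ?cabs0 ?ltW//.
by move=> i; rewrite !inE => /andP[ii _] _; exact: f0.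
Qed.

End UnorderedSums.

(** * Exponentially weighted sums over the semigroup *)

Section Weights.
Variables (R : realType) (n : nat) (lam : 'I_n -> R) (beta : R).
Hypothesis hbeta : forall k : 'I_n, 0 < lam k * beta.
Implicit Types (w x y : Zplus n) (g : Zplus n -> Cx R) (i : 'I_n).

Definition weight w : R := expR (- (pairing w lam * beta)).
Definition ratio i : R := expR (- (lam i * beta)).

Lemma weight_gt0 w : 0 < weight w. Proof. exact: expR_gt0. Qed.

Lemma pairingD x y : pairing (x + y) lam = pairing x lam + pairing y lam.
Proof. by rewrite /pairing -big_split; apply: eq_bigr => i _; rewrite ffunE natrD mulrDl. Qed.

Lemma weightD x y : weight (x + y) = weight x * weight y.
Proof. by rewrite /weight pairingD mulrDl opprD expRD. Qed.

Lemma pairing_egen i : pairing (egen i) lam = lam i.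
Proof.
rewrite /pairing (bigD1 i)//= big1 ?addr0; last first.
  by move=> j ji; rewrite ffunE eq_sym (negbTE ji) mul0r.
by rewrite ffunE eqxx mul1r.
Qed.

Lemma weight_egen i : weight (egen i) = ratio i.
Proof. by rewrite /weight pairing_egen. Qed.

Lemma weight_prod w : weight w = \prod_(i < n) ratio i ^+ w i.
Proof.
rewrite /weight /pairing mulr_suml -sumrN expR_sum; apply: eq_bigr => i _.
by rewrite /ratio -expRM_natl mulrN mulrA.
Qed.

Lemma weight0 : weight 0 = 1.
Proof. by rewrite weight_prod big1// => i _; rewrite ffunE expr0. Qed.

Lemma ratio_lt1 i : ratio i < 1.
Proof. by rewrite -expR0 ltr_expR oppr_lt0. Qed.

Lemma pairing_gt0 x : x != 0 -> 0 < pairing x lam * beta.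
Proof.
move=> x0; rewrite /pairing mulr_suml.
have [i xi] : exists i, x i != 0%N.
  apply: contrapT => /forallNP H; move/eqP: x0; apply; apply/ffunP => i.
  by have /negP := H i; rewrite negbK => /eqP ->; rewrite ffunE.
rewrite (bigD1 i)//= ltr_wpDr//; last by rewrite -mulrA mulr_gt0// ltr0n lt0n.
by apply: sumr_ge0 => j _; rewrite -mulrA mulr_ge0// ltW.
Qed.

(** A finite set lies in a box [{0, ..., N - 1}^n], over which the sum factors into [n] truncated
    geometric series. *)
Lemma weight_bounded : exists M : R, forall J : {fset Zplus n}, psum weight J <= M.
Proof.
have r1 i : 0 < 1 - ratio i by rewrite subr_gt0 ratio_lt1.
exists (\prod_(i < n) (1 - ratio i)^-1) => J.
pose N := (\max_(w <- J) \max_(i < n) w i).+1.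
have HN w i : w \in J -> (w i < N)%N.
  move=> wJ; rewrite ltnS; apply: leq_trans (leq_bigmax_seq _ wJ isT).
  exact: (leq_bigmax i).
pose emb (f : {ffun 'I_n -> 'I_N}) : Zplus n := [ffun i => (f i : nat)].
apply: (@le_trans _ _ (\sum_(f : {ffun 'I_n -> 'I_N}) weight (emb f))).
  rewrite /psum; apply: (@le_trans _ _ (\sum_(w <- J) \sum_(f : {ffun 'I_n -> 'I_N})
      if emb f == w then weight (emb f) else 0)).
    rewrite !big_seq; apply: ler_sum => w wJ.
    pose f : {ffun 'I_n -> 'I_N} := [ffun i => Ordinal (HN w i wJ)].
    have ew : emb f = w by apply/ffunP => i; rewrite !ffunE.
    rewrite (bigD1 f)//= ew eqxx lerDl; apply: sumr_ge0 => f' _.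
    by case: ifP => // _; rewrite ltW// weight_gt0.
  rewrite exchange_big/=; apply: ler_sum => f _.
  have [fJ|fJ] := boolP (emb f \in J).
    rewrite (big_fsetD1 (emb f))//= eqxx big1_fset ?addr0// => w.
    by rewrite !inE => /andP[/negP wf _] _; case: eqP => // fw; case: wf; rewrite fw.
  rewrite big1_fset ?ltW ?weight_gt0// => w wJ _.
  by case: eqP => // fw; rewrite fw wJ in fJ.
rewrite (eq_bigr (fun f : {ffun 'I_n -> 'I_N} => \prod_(i < n) ratio i ^+ (f i))); last first.
  by move=> f _; rewrite weight_prod; apply: eq_bigr => i _; rewrite ffunE.
rewrite -(bigA_distr_bigA (fun (i : 'I_n) (j : 'I_N) => ratio i ^+ j))/=.
apply: ler_prod => i _; apply/andP; split.
  by apply: sumr_ge0 => j _; rewrite exprn_ge0// expR_ge0.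
rewrite -[leLHS]mul1r -[X in X * _](divff (lt0r_neq0 (r1 i))).
rewrite mulrAC -[leRHS]mul1r; apply: ler_wpM2r; first by rewrite invr_ge0 ltW.
have -> : (1 - ratio i) * (\sum_(j < N) ratio i ^+ j) = 1 - ratio i ^+ N.
  by rewrite -[in RHS](expr1n _ N) subrXX; congr (_ * _); apply: eq_bigr => j _;
     rewrite expr1n mul1r.
by rewrite gerBl exprn_ge0// expR_ge0.
Qed.

(** Restricting to such [w] is the counterpart of multiplying by [Q_k]: for the state attached to
    [tau], the value at [rho a * Q_k] is, up to the normalizing constant, the restricted sum over
    the orbit of [a]. *)
Definition vanish_below (k : nat) w : bool := [forall i : 'I_n, (i < k)%N ==> (w i == 0%N)].

Definition kms_family k g w : Cx R :=
  if vanish_below k w then ofR (weight w) * g w else 0.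

Definition kms_sum k g : Cx R := summability.sum (kms_family k g).

Definition cbounded g : Prop := exists B : R, forall w, cabs (g w) <= B.

Lemma kms_family_bound k g (B : R) : (forall w, cabs (g w) <= B) ->
  forall w, cabs (kms_family k g w) <= weight w * B.
Proof.
move=> gB w; have B0 : 0 <= B by apply: le_trans (gB 0); exact: cabs_ge0.
rewrite /kms_family; case: ifP => _; last by rewrite cabs0 mulr_ge0// ltW// weight_gt0.
by rewrite cabsM cabs_ofR gtr0_norm ?weight_gt0// ler_wpM2l// ltW// weight_gt0.
Qed.

Lemma weight_bounded_by (B : R) : 0 <= B ->
  exists M : R, forall J : {fset Zplus n}, psum (fun w => weight w * B) J <= M.
Proof.
move=> B0; have [M HM] := weight_bounded; exists (M * B) => J.
by rewrite /psum -mulr_suml ler_wpM2r//; exact: HM.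
Qed.

Lemma kms_has_sum k g : cbounded g -> has_sum (kms_family k g) (kms_sum k g).
Proof.
move=> [B gB]; have B0 : 0 <= B by apply: le_trans (gB 0); exact: cabs_ge0.
have [M HM] := weight_bounded_by B0.
have [l Hl] := abs_has_sum (kms_family_bound k gB) HM.
by rewrite /kms_sum (has_sum_sum Hl).
Qed.

Lemma vanish_belowS i w : vanish_below i.+1 w = vanish_below i w && (w i == 0%N).
Proof.
apply/forallP/andP => [H|[/forallP H wi] j].
  split; last by have := H i; rewrite ltnSn.
  by apply/forallP => j; apply/implyP => ji; have := H j; rewrite ltnS (ltnW ji).
rewrite ltnS leq_eqVlt; apply/implyP => /orP[/eqP/val_inj -> //|ji].
by have := H j; rewrite ji.
Qed.

(** The terms with [w i != 0] are those at [w + egen i], and shifting by [egen i] costs the factor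
    [ratio i]. The recursion has the same form as the one for KMS states along the defect
    products. *)
Lemma kms_sumS i g : cbounded g ->
  kms_sum i.+1 g = kms_sum i g - ofR (ratio i) * kms_sum i (fun w => g (w + egen i)).
Proof.
move=> gb; have gb' : cbounded (fun w => g (w + egen i)).
  by case: gb => B HB; exists B => w.
have H := kms_has_sum i gb; have H' := kms_has_sum i gb'.
pose h w : Zplus n := w + egen i; pose h' w : Zplus n := [ffun j => (w j - egen i j)%N].
have hh : cancel h h' by move=> w; apply/ffunP => j; rewrite !ffunE addnK.
pose F w := if w i == 0%N then 0 else kms_family i g w.
have HF : has_sum F (ofR (ratio i) * kms_sum i (fun w => g (w + egen i)) + 0).
  apply: (has_sum_reindex hh) => [w|].
    rewrite /F; case: (eqVneq (w i) 0%N) => // wi /eqP; case.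
    apply/ffunP => j; rewrite !ffunE; case: (eqVneq i j) => [<-|_].
      by apply: subnK; rewrite lt0n.
    by rewrite subn0 addr0.
  have H0 : has_sum (fun _ : Zplus n => 0 : Cx R) 0.
    by move=> e e0; exists fset0 => J _; rewrite /psum big1 ?subrr ?cabs0 ?ltW.
  have := has_sum_lin (ofR (ratio i)) H' H0; congr has_sum; apply/funext => w /=.
  have -> : F (h w) = kms_family i g (w + egen i).
    by rewrite /F /h ifF//; apply/negbTE; rewrite !ffunE eqxx -lt0n; exact: (leq_addl (w i) 1).
  rewrite addr0 /kms_family.
  have -> : vanish_below i (w + egen i) = vanish_below i w.
    apply: eq_forallb => j; rewrite !ffunE.
    by case: (ltnP j i) => //= ji; rewrite (_ : i == j = false) ?addr0// -val_eqE gtn_eqF.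
  by case: ifP => _; rewrite ?mulr0// weightD weight_egen rmorphM/=; ring.
apply: (has_sum_unique (f := kms_family i.+1 g)); first exact: kms_has_sum.
have := has_sum_lin (-1) HF H; rewrite addr0 mulN1r addrC.
congr has_sum; apply/funext => w; rewrite mulN1r /F /kms_family vanish_belowS.
by case: (vanish_below i w); case: (w i == 0%N); rewrite /= ?oppr0 ?add0r ?addNr.
Qed.

Lemma kms_sum_last g : cbounded g -> kms_sum n g = g 0.
Proof.
move=> gb; apply: (has_sum_unique (kms_has_sum n gb)).
have E : kms_family n g 0 = g 0.
  rewrite /kms_family ifT; first by rewrite weight0 rmorph1 mul1r.
  by apply/forallP => j; rewrite ffunE eqxx implybT.
rewrite -E; apply: has_sum_finite => w w0; rewrite /kms_family ifF//.
apply: contraNF w0 => /forallP H; apply/eqP/ffunP => j; rewrite ffunE.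
by have := H j; rewrite ltn_ord => /eqP.
Qed.

Lemma kms_sum_lin k c g g' : cbounded g -> cbounded g' ->
  kms_sum k (fun w => c * g w + g' w) = c * kms_sum k g + kms_sum k g'.
Proof.
move=> gb gb'; apply: has_sum_sum.
have := has_sum_lin c (kms_has_sum k gb) (kms_has_sum k gb').
congr has_sum; apply/funext => w; rewrite /kms_family.
by case: ifP => _; ring.
Qed.

(** For a constant family each use of [kms_sumS] is multiplication by [1 - ratio i]; after [n] of
    them only the term at [w = 0] is left. *)
Lemma kms_sum1 : ofR (\prod_(i < n) (1 - ratio i)) * kms_sum 0 (fun=> 1) = 1.
Proof.
have b1 : cbounded (fun=> 1) by exists 1 => w; rewrite cabs1.
have H k : (k <= n)%N ->
    kms_sum k (fun=> 1) = ofR (\prod_(i < n | (i < k)%N) (1 - ratio i)) * kms_sum 0 (fun=> 1).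
  elim: k => [_|k IH kn]; first by rewrite big_pred0 ?rmorph1 ?mul1r.
  have := kms_sumS (Ordinal kn) b1 => /= ->; rewrite (IH (ltnW kn)).
  rewrite [in RHS](bigD1 (Ordinal kn))/= ?ltnSn//.
  rewrite [in RHS](eq_bigl (fun i : 'I_n => (i < k)%N)); last first.
    move=> i; rewrite ltnS (leq_eqVlt i) -val_eqE /=.
    by case: (ltngtP i k).
  by rewrite rmorphM rmorphB/= rmorph1; ring.
have := kms_sum_last b1; rewrite H// => E; rewrite -[RHS]E.
by congr (ofR _ * _); apply: eq_bigl => i; rewrite ltn_ord.
Qed.

Lemma kms_sum_shift g x : cbounded g ->
  has_sum (fun w => if [forall i, (x i <= w i)%N] then
     ofR (weight w) * g [ffun i => (w i - x i)%N] else 0)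
   (ofR (weight x) * kms_sum 0 g).
Proof.
move=> gb; have H := kms_has_sum 0 gb.
pose h w : Zplus n := w + x; pose h' w : Zplus n := [ffun j => (w j - x j)%N].
have hh : cancel h h' by move=> w; apply/ffunP => j; rewrite !ffunE addnK.
apply: (has_sum_reindex hh) => [w|].
  case: ifP => // /forallP xw /eqP; case; by apply/ffunP => j; rewrite !ffunE; exact: subnK.
have H0 : has_sum (fun _ : Zplus n => 0 : Cx R) 0.
  by move=> e e0; exists fset0 => J _; rewrite /psum big1 ?subrr ?cabs0 ?ltW.
have := has_sum_lin (ofR (weight x)) H H0; rewrite addr0; congr has_sum; apply/funext => w /=.
rewrite /h ifT; last by apply/forallP => i; rewrite ffunE leq_addl.
rewrite -/(h' _) hh addr0 /kms_family ifT; last by apply/forallP.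
by rewrite weightD rmorphM/=; ring.
Qed.

Lemma kms_sum_ge0 k g : cbounded g -> (forall w, 0 <= g w) -> 0 <= kms_sum k g.
Proof.
move=> gb g0; apply: has_sum_ge0 (kms_has_sum k gb) => w; rewrite /kms_family.
by case: ifP => // _; rewrite mulr_ge0// ofR_ge0 ltW// weight_gt0.
Qed.

End Weights.

(** * Covariant pairs and monomials *)

Section HilbertFacts.
Variables (R : realType) (H : hilbertType R).
Implicit Types (x y z : H) (S T : H -> H).

Lemma dotp_semi_inner : semi_inner (@dotp R H).
Proof.
split; [exact: dotp_linearl|exact: dotpC|move=> x; rewrite dotp_norm exprn_ge0//].
Qed.
Local Notation hd := dotp_semi_inner.

Lemma dotp_ext y z : (forall x, dotp x y = dotp x z) -> y = z.
Proof.
move=> yz; apply/eqP; rewrite -subr_eq0 -normr_eq0 -sqrf_eq0 -dotp_norm.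
by rewrite (siBr hd) yz subrr.
Qed.

Lemma adjoint_unique T S S' : is_adjoint T S -> is_adjoint T S' -> S = S'.
Proof. by move=> TS TS'; apply/funext => y; apply: dotp_ext => x; rewrite -TS TS'. Qed.

Lemma adjointC T S : is_adjoint T S -> is_adjoint S T.
Proof. by move=> TS x y; rewrite dotpC -TS -dotpC. Qed.

Lemma adjoint_comp T S T' S' : is_adjoint T S -> is_adjoint T' S' ->
  is_adjoint (T \o T') (S' \o S).
Proof. by move=> TS TS' x y /=; rewrite TS TS'. Qed.

Lemma isometry_adjoint T S : Defs.isometry T -> is_adjoint T S -> S \o T = idfun.
Proof.
move=> [Tl Tn] TS; have nT x : dotp (T x) (T x) = dotp x x by rewrite !dotp_norm Tn.
have TT x y : dotp (T x) (T y) = dotp x y.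
  have key k : cRe (k^* * dotp (T x) (T y)) = cRe (k^* * dotp x y).
    have := congr1 (@cRe R) (nT (k *: y + x)).
    rewrite Tl !(siDl hd) !(siDr hd) !(siZl hd) !(siZr hd) !nT.
    rewrite (dotpC (T x)) (dotpC x y) !cReIm; lra.
  have := key 1; have := key 'i; rewrite !cReIm => H1 H2.
  by apply: complex_ext; lra.
by apply/funext => y; apply: dotp_ext => x /=; rewrite -TS TT.
Qed.

End HilbertFacts.

Section Zplus.
Variable n : nat.
Implicit Types x y z w : Zplus n.

Definition vsub x y : Zplus n := [ffun j => (x j - y j)%N].

Lemma Zplus_ind (P : Zplus n -> Prop) : P 0 ->
  (forall i x, P x -> P (x + egen i)) -> forall x, P x.
Proof.
move=> P0 PS x; move: {2}(\sum_(i < n) x i)%N (leqnn (\sum_(i < n) x i)%N) => k.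
elim: k x => [|k IH] x xk.
  suff -> : x = 0 by [].
  apply/ffunP => i; rewrite ffunE; apply/eqP; rewrite -leqn0; apply: leq_trans xk.
  by rewrite (bigD1 i)//= leq_addr.
have [->//|x0] := eqVneq x 0.
have [i xi] : exists i, x i != 0%N.
  apply: contrapT => /forallNP H; move/eqP: x0; apply; apply/ffunP => i.
  by have /negP := H i; rewrite negbK => /eqP ->; rewrite ffunE.
have E : x = vsub x (egen i) + egen i.
  apply/ffunP => j; rewrite !ffunE; case: (eqVneq i j) => [<-|_].
    by apply/esym/subnK; rewrite lt0n.
  by rewrite subn0 addr0.
rewrite E; apply/PS/IH; rewrite -ltnS; apply: leq_trans xk.
rewrite [X in (_ < X)%N](bigD1 i)// [X in (X < _)%N](bigD1 i)//= !ffunE eqxx.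
rewrite (eq_bigr x) => [|j ji]; last by rewrite !ffunE eq_sym (negbTE ji) subn0.
by rewrite ltn_add2r subn1 prednK// lt0n.
Qed.

End Zplus.

Section Covariance.
Variables (R : realType) (n : nat) (A : cstarType R) (alpha : Zplus n -> A -> A).
Variables (N : cstarType R) (rho : A -> N) (v : Zplus n -> N).
Local Notation e := egen.

Definition defect (i : 'I_n) : N := 1 - v (e i) * star (v (e i)).

Record covariant_relations : Prop := CovariantRelations {
  cr_hom : star_hom rho ;
  cr_rho1 : rho 1 = 1 ;
  cr_v0 : v 0 = 1 ;
  cr_vD : forall x y, v (x + y) = v x * v y ;
  cr_iso : forall x, star (v x) * v x = 1 ;
  cr_nica : forall i j, i != j -> v (e i) * star (v (e j)) = star (v (e j)) * v (e i) ;
  cr_cov : forall a i, rho a * v (e i) = v (e i) * rho (alpha (e i) a) ;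
  cr_gen : forall S : set N, star_subalg S -> closed S ->
        (forall x a, S (v x * rho a)) -> S = setT }.

Hypothesis halpha : unital_dynamical_system alpha.
Hypothesis hN : is_NO alpha rho v.

(** The relations are read off a faithful pair. As [pi] may be degenerate, [P = pi(1)] is only a
    projection; it commutes with all isometries and their adjoints, [v x] is represented by
    [V x \o P], and each relation is checked after this cut-down. *)
Lemma NO_relations : covariant_relations /\
  forall a, I_ideal alpha (ones n) a -> rho a * \prod_(i < n) defect i = 0.
Proof.
have [[rho1 v0] gen [H [p [Th [[nc cn] [Thr ThE] Thi]]]] _] := hN.
have [[rc rl rM radj] [Viso Vadj V0 VD] nica cov] := nc.
have [Thc Thl ThM Thadj] := Thr.
pose P := rep p 1; pose V x := iso p x; pose W x := iso_adj p x.
have Thrho a : Th (rho a) = rep p a.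
  by have := ThE 0 a; rewrite v0 mul1r V0.
have Thv x : Th (v x) = V x \o P by rewrite -ThE rho1 mulr1.
have PM a : P \o rep p a = rep p a by rewrite -rM mul1r.
have MP a : rep p a \o P = rep p a by rewrite -rM mulr1.
have [a1 aD] : (forall x, alpha x 1 = 1) /\ (forall x y, alpha (x + y) = alpha x \o alpha y).
  by case: halpha.
(* Covariance at [a = 1], where [alpha] is unital. *)
have PVi i : P \o V (e i) = V (e i) \o P by rewrite cov a1.
have PV x : P \o V x = V x \o P.
  elim/(@Zplus_ind n) : x => [|i x IH]; first by rewrite /V V0.
  apply/funext => z; rewrite /V VD /= -[LHS]/((P \o V x) (V (e i) z)) IH /=.
  by rewrite -[P _]/((P \o V (e i)) z) PVi.
have Padj : is_adjoint P P by have := radj 1; rewrite star1.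
have PW x : P \o W x = W x \o P.
  apply: (@adjoint_unique _ _ (V x \o P)); first exact: adjoint_comp (Vadj x) Padj.
  by rewrite -PV; exact: adjoint_comp Padj (Vadj x).
have Thvs x : Th (star (v x)) = P \o W x.
  apply: (@adjoint_unique _ _ (V x \o P)); last exact: adjoint_comp (Vadj x) Padj.
  by rewrite -Thv; exact: Thadj.
have WV x : W x \o V x = idfun by exact: isometry_adjoint (Viso x) (Vadj x).
have PP : P \o P = P by exact: PM.
have Th1 : Th 1 = P by rewrite -rho1 Thrho.
have Thlin k a b xi : Th (k *: a + b) xi = k *: Th a xi + Th b xi by exact: Thl.
have ThB a b xi : Th (a - b) xi = Th a xi - Th b xi.
  by rewrite addrC -scaleN1r Thlin scaleN1r addrC.
have Pl k x y : P (k *: x + y) = k *: P x + P y by exact: (rc 1).1.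
have PB x y : P (x - y) = P x - P y.
  by rewrite addrC -scaleN1r Pl scaleN1r addrC.
have PPx z : P (P z) = P z by rewrite -[LHS]/((P \o P) z) PP.
have PVx x z : P (V x z) = V x (P z) by rewrite -[LHS]/((P \o V x) z) PV.
have PWx x z : P (W x z) = W x (P z) by rewrite -[LHS]/((P \o W x) z) PW.
have WVx x z : W x (V x z) = z by rewrite -[LHS]/((W x \o V x) z) WV.
have PMx a z : P (rep p a z) = rep p a z by rewrite -[LHS]/((P \o rep p a) z) PM.
have MPx a z : rep p a (P z) = rep p a z by rewrite -[LHS]/((rep p a \o P) z) MP.
have covx a i z : rep p a (V (e i) z) = V (e i) (rep p (alpha (e i) a) z).
  by rewrite -[LHS]/((rep p a \o V (e i)) z) cov.
have nicax i j z : i != j -> V (e i) (W (e j) z) = W (e j) (V (e i) z).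
  by move=> ij; rewrite -[LHS]/((V (e i) \o W (e j)) z) (nica i j ij).
split; first split=> //.
- split=> [k a b|a b|a]; apply: Thi; rewrite ?ThM ?Thrho.
  + by apply/funext => xi; rewrite Thlin !Thrho; exact: rl.
  + exact: rM.
  + apply: (@adjoint_unique _ _ (rep p a)); first exact: radj.
    by rewrite -Thrho; exact: Thadj.
- move=> x y; apply: Thi; rewrite ThM !Thv; apply/funext => z /=.
  by rewrite /V VD /= PVx PPx.
- move=> x; apply: Thi; rewrite ThM Thv Thvs Th1; apply/funext => z /=.
  by rewrite WVx PPx.
- move=> i j ij; apply: Thi; rewrite !ThM !Thv !Thvs; apply/funext => z /=.
  by rewrite PPx !PWx PVx PPx nicax.
- move=> a i; apply: Thi; rewrite !ThM !Thv !Thrho; apply/funext => z /=.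
  by rewrite covx -/P MPx PMx.
move=> a aI; apply: Thi; rewrite ThM Thrho.
(* [Th] sends [1] to [P], so each factor is represented by the spatial defect cut down by [P], and
   the copies of [P] merge into one. *)
have Thdef : Th (\prod_(i < n) defect i) = P \o defect_product p (ones n).
  rewrite /defect_product (eq_bigl (fun i => ones n i != 0%N)); last first.
    by move=> i; rewrite ffunE.
  elim/big_rec2 : _ => [|i S T _ IH]; first by rewrite Th1.
  rewrite ThM IH; apply/funext => xi.
  rewrite /= /defect ThB Th1 ThM Thv Thvs.
  set z := S xi.
  by rewrite /= PB !PPx PVx !PWx !PPx.
rewrite Thdef; transitivity (rep p a \o defect_product p (ones n)).
  by apply/funext => xi /=; rewrite MPx.
rewrite cn//.
by apply/funext => xi; have := ThB 0 0 xi; rewrite subrr => ->; rewrite subrr.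
Qed.

End Covariance.

Section Monomials.
Variables (R : realType) (n : nat) (A : cstarType R) (alpha : Zplus n -> A -> A).
Variables (N : cstarType R) (rho : A -> N) (v : Zplus n -> N).
Local Notation e := egen.
Implicit Types (a : A) (x y z w : Zplus n) (i j : 'I_n).

Hypothesis halpha : unital_dynamical_system alpha.
Hypothesis hv : covariant_relations alpha rho v.

Lemma alphaD x y a : alpha (x + y) a = alpha x (alpha y a).
Proof. by case: halpha => _ _ _ ->. Qed.
Lemma alpha0 a : alpha 0 a = a.
Proof. by case: halpha => _ _ -> _. Qed.
Lemma alphaM x a b : alpha x (a * b) = alpha x a * alpha x b.
Proof. by case: halpha => H _ _ _; case: (H x). Qed.
Lemma alpha_star x a : alpha x (star a) = star (alpha x a).
Proof. by case: halpha => H _ _ _; case: (H x). Qed.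
Lemma alpha_lin x (k : Cx R) a b : alpha x (k *: a + b) = k *: alpha x a + alpha x b.
Proof. by case: halpha => H _ _ _; case: (H x) => Hl _ _; exact: Hl. Qed.
Lemma alpha_zero x : alpha x 0 = 0.
Proof.
apply: (addrI (alpha x 0)).
by rewrite -{2}(scale1r (alpha x 0)) addrC -alpha_lin scale1r !addr0.
Qed.
Lemma alpha1 x : alpha x 1 = 1.
Proof. by case: halpha. Qed.

Lemma rho_lin (k : Cx R) a b : rho (k *: a + b) = k *: rho a + rho b.
Proof. by have [Hl _ _] := cr_hom hv; exact: Hl. Qed.
Lemma rhoM a b : rho (a * b) = rho a * rho b.
Proof. by case: (cr_hom hv). Qed.
Lemma rho_star a : rho (star a) = star (rho a).
Proof. by case: (cr_hom hv). Qed.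
Lemma rho0 : rho 0 = 0.
Proof. by apply: (addrI (rho 0)); rewrite -{2}(scale1r (rho 0)) addrC -rho_lin scale1r !addr0. Qed.
Lemma rhoZ (k : Cx R) a : rho (k *: a) = k *: rho a.
Proof. by rewrite -[k *: a]addr0 rho_lin rho0 addr0. Qed.

Lemma cov x a : rho a * v x = v x * rho (alpha x a).
Proof.
elim/(@Zplus_ind n) : x a => [|i x IH] a; first by rewrite (cr_v0 hv) mul1r mulr1 alpha0.
by rewrite addrC (cr_vD hv) mulrA (cr_cov hv) -mulrA IH mulrA (addrC (e i)) alphaD.
Qed.

Lemma cov_star x a : star (v x) * rho a = rho (alpha x a) * star (v x).
Proof. by rewrite -[a]starK rho_star -starM cov starM -rho_star alpha_star !starK. Qed.

Lemma star_v_egen i w : star (v (e i)) * v w =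
  if w i == 0%N then v w * star (v (e i)) else v (vsub w (e i)).
Proof.
case: (eqVneq (w i) 0%N) => [wi|wi].
  elim/(@Zplus_ind n) : w wi => [_|j w IH].
    by rewrite (cr_v0 hv) mul1r mulr1.
  rewrite !ffunE => /eqP; rewrite addn_eq0 => /andP[/eqP wi /eqP ji].
  have ij : j != i by apply/eqP => E; move: ji; rewrite E eqxx.
  by rewrite (cr_vD hv) mulrA IH// -mulrA -(cr_nica hv)// mulrA.
have {1}-> : w = e i + vsub w (e i).
  apply/ffunP => j; rewrite !ffunE addrC; case: (eqVneq i j) => [<-|_].
    by apply/esym/subnK; rewrite lt0n.
  by rewrite subn0 addr0.
by rewrite (cr_vD hv) mulrA (cr_iso hv) mul1r.
Qed.

(** The normal form given by Nica covariance: the common part of [y] and [z] cancels because [v] is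
    isometric, and the truncated differences left over have disjoint supports. It is what makes a
    product of monomials a monomial. *)
Lemma star_v_v y z : star (v y) * v z = v (vsub z y) * star (v (vsub y z)).
Proof.
elim/(@Zplus_ind n) : y z => [|i y IH] z.
  rewrite (cr_v0 hv) star1 mul1r.
  have -> : vsub z 0 = z by apply/ffunP => j; rewrite !ffunE subn0.
  have -> : vsub 0 z = 0 by apply/ffunP => j; rewrite !ffunE sub0n.
  by rewrite (cr_v0 hv) star1 mulr1.
rewrite (cr_vD hv) starM -mulrA IH mulrA star_v_egen ffunE.
have [zy|yz] := leqP (z i) (y i).
  rewrite (_ : (z i - y i)%N == 0%N); last by rewrite subn_eq0.
  rewrite -mulrA -starM -(cr_vD hv); congr (v _ * star (v _)); apply/ffunP => j; rewrite !ffunE.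
    rewrite -[(_ + _)%R]/(_ + _)%N; case: (eqVneq i j) => [<-|_]; last by rewrite addn0.
    by move: zy; rewrite -subn_eq0 => /eqP zy; rewrite subnDA zy.
  rewrite -![(_ + _)%R]/(_ + _)%N; case: (eqVneq i j) => [<-|_]; last by rewrite !addn0.
  by rewrite !addn1 subSn.
rewrite ifF; last by rewrite subn_eq0 leqNgt yz.
congr (v _ * star (v _)); apply/ffunP => j; rewrite !ffunE.
  by rewrite -subnDA.
rewrite -[(_ + _)%R]/(_ + _)%N; case: (eqVneq i j) => [<-|_]; last by rewrite addn0.
have -> : (y i - z i)%N = 0%N by apply/eqP; rewrite subn_eq0 ltnW.
by apply/esym/eqP; rewrite subn_eq0 addn1.
Qed.

Definition monomial x a y : N := v x * rho a * star (v y).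

Lemma monomial_mul x a y z b w : monomial x a y * monomial z b w =
  monomial (x + vsub z y) (alpha (vsub z y) a * alpha (vsub y z) b) (w + vsub y z).
Proof.
rewrite /monomial -!mulrA (mulrA (star (v y))) star_v_v -!mulrA.
rewrite (mulrA (star _) (rho b)) cov_star -!mulrA (mulrA (rho a)) cov -!mulrA.
by rewrite rhoM !(cr_vD hv) starM -!mulrA.
Qed.

Lemma monomial_star x a y : star (monomial x a y) = monomial y (star a) x.
Proof. by rewrite /monomial !starM starK -rho_star mulrA. Qed.

Lemma monomialZ (k : Cx R) x a y : k *: monomial x a y = monomial x (k *: a) y.
Proof. by rewrite /monomial rhoZ mulcZr mulcZl. Qed.

Lemma monomial_rho a : monomial 0 a 0 = rho a.
Proof. by rewrite /monomial (cr_v0 hv) star1 mul1r mulr1. Qed.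

Definition mono_sum (s : seq (Zplus n * A * Zplus n)) : N :=
  \sum_(t <- s) monomial t.1.1 t.1.2 t.2.

Definition mono_span : set N := [set b | exists s, b = mono_sum s].

Lemma mono_span_monomial x a y : mono_span (monomial x a y).
Proof. by exists [:: ((x, a), y)]; rewrite /mono_sum big_seq1. Qed.

Lemma mono_span_ind (P : N -> Prop) : P 0 ->
  (forall x a y b, P b -> P (monomial x a y + b)) -> forall b, mono_span b -> P b.
Proof.
move=> P0 PS _ [s ->]; elim: s => [|[[x a] y] s IH]; rewrite /mono_sum ?big_nil//.
by rewrite big_cons; exact: PS.
Qed.

Lemma mono_spanD b c : mono_span b -> mono_span c -> mono_span (b + c).
Proof. by move=> [s ->] [t ->]; exists (s ++ t); rewrite /mono_sum big_cat. Qed.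

Lemma mono_span0 : mono_span 0.
Proof. by exists [::]; rewrite /mono_sum big_nil. Qed.

Lemma mono_span_subalg : star_subalg mono_span.
Proof.
have spZ k b : mono_span b -> mono_span (k *: b).
  elim/mono_span_ind => [|x a y c IH]; first by rewrite scaler0; exact: mono_span0.
  by rewrite scalerDr monomialZ; apply: mono_spanD => //; exact: mono_span_monomial.
split.
- exact: mono_span0.
- by move=> k b c Hb Hc; apply: mono_spanD => //; exact: spZ.
- move=> b c Hb Hc; move: b Hb; apply: mono_span_ind => [|x a y b IH].
    by rewrite mul0r; exact: mono_span0.
  rewrite mulrDl; apply: mono_spanD => // {IH}; move: c Hc; apply: mono_span_ind => [|z a' w c IH].
    by rewrite mulr0; exact: mono_span0.
  rewrite mulrDr; apply: mono_spanD => //; rewrite monomial_mul; exact: mono_span_monomial.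
- apply: mono_span_ind => [|x a y b IH]; first by rewrite star0; exact: mono_span0.
  by rewrite starD monomial_star; apply: mono_spanD => //; exact: mono_span_monomial.
Qed.

(** The elements that can be so approximated form a closed star subalgebra containing the
    generators, hence everything by [cr_gen]. *)
Lemma mono_span_approx b (d : R) : 0 < d -> exists2 c, mono_span c & rnorm (b - c) <= d.
Proof.
pose S := [set b : N | forall d : R, 0 < d -> exists2 c, mono_span c & rnorm (b - c) <= d].
suff Sb : S b by exact: Sb.
have spS c : mono_span c -> S c by move=> Hc r r0; exists c => //; rewrite subrr rnorm0 ltW.
have [_ spL spM spstar] := mono_span_subalg.
rewrite (cr_gen hv (S := S))//.
- split.
  + exact/spS/mono_span0.
  + move=> k a c Ha Hc r r0; have k0 : 0 < cabs k + 1 by rewrite ltr_wpDl ?cabs_ge0.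
    have [|a' Sa' aa'] := Ha (r / 2 / (cabs k + 1)); first by rewrite !divr_gt0.
    have [|c' Sc' cc'] := Hc (r / 2); first by rewrite divr_gt0.
    exists (k *: a' + c'); first exact: spL.
    rewrite opprD addrACA -scalerBr; apply: (le_trans (rnormD _ _)).
    rewrite (splitr r) lerD// rnormZ; apply: (le_trans (ler_wpM2l (cabs_ge0 _) aa')).
    by rewrite mulrCA ler_piMr ?divr_ge0 ?(ltW r0)// ler_pdivrMr// mul1r lerDl.
  + move=> a c Ha Hc r r0; have c0 : 0 < rnorm c + 1 by rewrite ltr_wpDl ?rnorm_ge0.
    have [|a' Sa' aa'] := Ha (r / 2 / (rnorm c + 1)); first by rewrite !divr_gt0.
    have a0 : 0 < rnorm a' + 1 by rewrite ltr_wpDl ?rnorm_ge0.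
    have [|c' Sc' cc'] := Hc (r / 2 / (rnorm a' + 1)); first by rewrite !divr_gt0.
    exists (a' * c'); first exact: spM.
    have -> : a * c - a' * c' = (a - a') * c + a' * (c - c').
      by rewrite mulrBl mulrBr addrA subrK.
    apply: (le_trans (rnormD _ _)); rewrite (splitr r) lerD//.
      apply: (le_trans (rnormM_le _ _)); apply: (le_trans (ler_wpM2r (rnorm_ge0 _) aa')).
      by rewrite mulrAC ler_pdivrMr// ler_wpM2l ?divr_ge0 ?(ltW r0)// lerDl.
    apply: (le_trans (rnormM_le _ _)); apply: (le_trans (ler_wpM2l (rnorm_ge0 _) cc')).
    by rewrite mulrCA ler_piMr ?divr_ge0 ?(ltW r0)// ler_pdivrMr// mul1r lerDl.
  + move=> a Ha r /Ha[c Sc ac]; exists (star c); first exact: spstar.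
    by rewrite -starB rnorm_star.
- move=> c cS r r0; have r20 : 0 < ofR (r / 2) by rewrite ofR_gt0 divr_gt0.
  have [c' [Sc' cc']] := cS _ (nbhsx_ballx c _ r20).
  have [|d' Sd' dd'] := Sc' (r / 2); first by rewrite divr_gt0.
  exists d' => //; rewrite -(subrK c' c) -addrA; apply: (le_trans (rnormD _ _)).
  rewrite (splitr r) lerD//; move: cc'; rewrite -ball_normE /ball_/= rnormE ltr_ofR; exact: ltW.
- move=> x a; apply: spS; have := mono_span_monomial x a 0.
  by rewrite /monomial (cr_v0 hv) star1 mulr1.
Qed.

Lemma mono_span_dense : dense mono_span.
Proof.
move=> O [b Ob] Oo.
have /nbhs_ballP[d /= d0 Hd] : nbhs b O by exact: open_nbhs_nbhs.
have d0' : 0 < cRe d by rewrite -ofR_gt0 -ge0_ofR// ltW.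
have [|c Sc bc] := @mono_span_approx b (cRe d / 2); first by rewrite divr_gt0.
exists c; split=> //; apply: Hd; rewrite -ball_normE /ball_/= rnormE (ge0_ofR (ltW d0)) ltr_ofR.
by apply: (le_lt_trans bc); lra.
Qed.

Lemma states_eq (psi1 psi2 : N -> Cx R) : is_state psi1 -> is_state psi2 ->
  (forall x a y, psi1 (monomial x a y) = psi2 (monomial x a y)) -> psi1 = psi2.
Proof.
move=> h1 h2 E; have p1 := state_positive h1; have p2 := state_positive h2.
have Esp c : mono_span c -> psi1 c = psi2 c.
  move: c; apply: mono_span_ind => [|x a y b IH]; first by rewrite !pos0.
  by rewrite !posD// E IH.
apply/funext => b; apply/eqP; rewrite -subr_eq0; apply/eqP/cabs_eq0/eqP.
rewrite eq_le cabs_ge0 andbT; apply/ler_addgt0Pr => d d0; rewrite add0r.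
have [|c Sc bc] := @mono_span_approx b (d / 4); first by rewrite divr_gt0.
have -> : psi1 b - psi2 b = psi1 (b - c) - psi2 (b - c).
  by rewrite (posB p1) (posB p2) (Esp c Sc); ring.
apply: (le_trans (cabsD _ _)); rewrite cabsN.
have := state_le (b - c) h1; have := state_le (b - c) h2; lra.
Qed.

End Monomials.

(** * The Fock representation *)

Section FockSpace.
Variables (R : realType) (n : nat) (A : cstarType R).
Implicit Types (x y z w p : Zplus n) (a b : A).

Definition finsupp : {pred (Zplus n -> A)} :=
  fun f => `[< exists J : {fset Zplus n}, forall p, p \notin J -> f p = 0 >].

Fact finsupp_submod : submod_closed finsupp.
Proof.
split=> [|k f g /asboolP[J HJ] /asboolP[J' HJ']]; apply/asboolP.
  by exists fset0 => p _.
exists (J `|` J')%fset => p; rewrite inE negb_or => /andP[pJ pJ'].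
rewrite -[LHS]/(k *: f p + g p) HJ// HJ'// scaler0 addr0//.
Qed.

HB.instance Definition _ := GRing.isSubmodClosed.Build (Cx R) (Zplus n -> A)
  finsupp finsupp_submod.

Definition fock : Type := {f : Zplus n -> A | finsupp f}.

HB.instance Definition _ := [isSub of fock for @sval _ _].
HB.instance Definition _ := [Choice of fock by <:].
HB.instance Definition _ := [SubChoice_isSubLmodule of fock by <:].

Implicit Types f g : fock.

Lemma fock_ext f g : (forall p, val f p = val g p) -> f = g.
Proof. by move=> fg; apply/val_inj/funext. Qed.

Lemma fock_lin (k : Cx R) f g p : val (k *: f + g) p = k *: val f p + val g p.
Proof. by []. Qed.

(** Some finite set containing the support, picked by choice; [fock_formE] shows that the form does
    not depend on it. *)
Definition fsupp f : {fset Zplus n} := sval (cid (asboolP _ (valP f))).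

Lemma fsuppP f p : p \notin fsupp f -> val f p = 0.
Proof. by rewrite /fsupp; case: cid => /= J HJ; exact: HJ. Qed.

Fact delta_subproof w : finsupp (fun p => if p == w then 1 else 0 : A).
Proof. by apply/asboolP; exists [fset w]%fset => p; rewrite inE => /negbTE ->. Qed.
Definition delta w : fock := Sub _ (delta_subproof w).

Definition below z p : bool := [forall i : 'I_n, (z i <= p i)%N].

Lemma below_add z p : below z (p + z).
Proof. by apply/forallP => i; rewrite ffunE; exact: leq_addl. Qed.

Lemma vsub_add z p : vsub (p + z) z = p.
Proof. by apply/ffunP => i; rewrite !ffunE; exact: addnK. Qed.

Lemma add_vsub z p : below z p -> vsub p z + z = p.
Proof. by move=> /forallP zp; apply/ffunP => i; rewrite !ffunE; exact: subnK. Qed.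

Fact shift_subproof z f : finsupp (fun p => if below z p then val f (vsub p z) else 0).
Proof.
apply/asboolP; exists [fset (p + z)%R | p in fsupp f]%fset => p pJ; case: ifP => // zp.
apply: fsuppP; apply: contra pJ => pJ; apply/imfsetP; exists (vsub p z) => //=.
by rewrite add_vsub.
Qed.
Definition shift z f : fock := Sub _ (shift_subproof z f).

Fact unshift_subproof z f : finsupp (fun p => val f (p + z)).
Proof.
apply/asboolP; exists [fset vsub p z | p in fsupp f]%fset => p pJ.
apply: fsuppP; apply: contra pJ => pJ; apply/imfsetP; exists (p + z) => //=.
by rewrite vsub_add.
Qed.
Definition unshift z f : fock := Sub _ (unshift_subproof z f).

Fact cut_subproof (B : pred 'I_n) f :
  finsupp (fun p => if [forall i, B i ==> (p i == 0%N)] then val f p else 0).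
Proof. by apply/asboolP; exists (fsupp f) => p /fsuppP ->; case: ifP. Qed.
Definition cut B f : fock := Sub _ (cut_subproof B f).

Lemma unshiftK z f : unshift z (shift z f) = f.
Proof. by apply: fock_ext => p; rewrite !SubK below_add vsub_add. Qed.

Section Form.
Variable (alpha : Zplus n -> A -> A) (tau : A -> Cx R).
Hypothesis halpha : unital_dynamical_system alpha.
Hypothesis htau : is_state tau.
Let ptau := state_positive htau.

Fact mult_subproof a f : finsupp (fun p => alpha p a * val f p).
Proof. by apply/asboolP; exists (fsupp f) => p /fsuppP ->; rewrite mulr0. Qed.
Definition mult a f : fock := Sub _ (mult_subproof a f).

Definition fock_form f g : Cx R := psum (fun p => tau (star (val g p) * val f p)) (fsupp f).

Lemma fock_formE f g (J : {fset Zplus n}) : (forall p, p \notin J -> val f p = 0) ->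
  fock_form f g = psum (fun p => tau (star (val g p) * val f p)) J.
Proof.
move=> fJ; rewrite /fock_form.
have sub (J1 J2 : {fset Zplus n}) : (J1 `<=` J2)%fset ->
    (forall p, p \notin J1 -> val f p = 0) ->
    psum (fun p => tau (star (val g p) * val f p)) J1 =
    psum (fun p => tau (star (val g p) * val f p)) J2.
  move=> J12 fJ1; rewrite /psum; apply: big_fset_incl => // p _ /fJ1 ->.
  by rewrite mulr0 (pos0 ptau).
rewrite (sub _ (fsupp f `|` J)%fset) ?fsubsetUl//; last exact: fsuppP.
by rewrite -(sub J) ?fsubsetUr.
Qed.

Lemma fock_form_semi_inner : semi_inner fock_form.
Proof.
split=> [g k f f'|f g|f].
- pose J := (fsupp f `|` fsupp f')%fset.
  have H p : p \notin J -> val f p = 0 /\ val f' p = 0.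
    by rewrite inE negb_or => /andP[/fsuppP -> /fsuppP ->].
  rewrite (@fock_formE (k *: f + f') g J); last first.
    by move=> p /H[H1 H2]; rewrite fock_lin H1 H2 scaler0 addr0.
  rewrite (@fock_formE f g J); last by move=> p /H[].
  rewrite (@fock_formE f' g J); last by move=> p /H[].
  rewrite -psum_lin /psum; apply: eq_bigr => p _.
  by rewrite fock_lin mulrDr mulcZr (posD ptau) (posZ ptau).
- pose J := (fsupp f `|` fsupp g)%fset.
  have H p : p \notin J -> val f p = 0 /\ val g p = 0.
    by rewrite inE negb_or => /andP[/fsuppP -> /fsuppP ->].
  rewrite (@fock_formE f g J); last by move=> p /H[].
  rewrite (@fock_formE g f J); last by move=> p /H[].
  rewrite /psum rmorph_sum; apply: eq_bigr => p _ /=.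
  by rewrite -(pos_conj ptau) starM starK.
- by rewrite /fock_form /psum; apply: sumr_ge0 => p _; exact: ptau.2.
Qed.
Local Notation hs := fock_form_semi_inner.

Lemma shift_unshift z f g : fock_form (shift z f) g = fock_form f (unshift z g).
Proof.
rewrite (@fock_formE (shift z f) g [fset (p + z)%R | p in fsupp f]%fset); last first.
  move=> p pJ; rewrite SubK; case: ifP => // zp.
  apply: fsuppP; apply: contra pJ => pJ; apply/imfsetP; exists (vsub p z) => //=.
  by rewrite add_vsub.
rewrite /fock_form /psum big_imfset/=; last by move=> p q _ _ pq; rewrite -(vsub_add z p) pq vsub_add.
by apply: eq_bigr => p _; rewrite below_add vsub_add.
Qed.

Lemma mult_adj a f g : fock_form (mult a f) g = fock_form f (mult (star a) g).
Proof.
rewrite (@fock_formE (mult a f) g (fsupp f)); last by move=> p /fsuppP H; rewrite SubK H mulr0.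
apply: eq_bigr => p _; rewrite !SubK.
by rewrite (alpha_star halpha) starM starK mulrA.
Qed.

Lemma snorm_shift z f : snorm fock_form (shift z f) = snorm fock_form f.
Proof. by rewrite /snorm /sq shift_unshift unshiftK. Qed.

Lemma snorm_unshift z f : snorm fock_form (unshift z f) <= snorm fock_form f.
Proof.
have [->|n0] := eqVneq (snorm fock_form (unshift z f)) 0; first exact: snorm_ge0.
have np : 0 < snorm fock_form (unshift z f) by rewrite lt_neqAle eq_sym n0 snorm_ge0.
rewrite -(ler_pM2l np) -expr2 (snorm_sqr hs) /sq -shift_unshift.
apply: (le_trans (ler_norm _)); apply: (le_trans (cRe_le_cabs _)).
by apply: (le_trans (si_le hs _ _)); rewrite snorm_shift.
Qed.

Lemma snorm_mult a f : snorm fock_form (mult a f) <= 2 * rnorm a * snorm fock_form f.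
Proof.
rewrite -ler_sqr ?nnegrE ?mulr_ge0 ?snorm_ge0 ?rnorm_ge0//.
rewrite !exprMn !(snorm_sqr hs) /sq.
rewrite (@fock_formE (mult a f) _ (fsupp f)); last by move=> p /fsuppP H; rewrite SubK H mulr0.
rewrite /fock_form /psum.
have cRe_sum (r : seq (Zplus n)) (F : Zplus n -> Cx R) :
    cRe (\sum_(p <- r) F p) = \sum_(p <- r) cRe (F p).
  by elim: r => [|p r IH]; rewrite ?big_nil// !big_cons cReD IH.
rewrite !cRe_sum mulr_sumr; apply: ler_sum => p _; rewrite SubK.
(* Left multiplication is bounded one coefficient at a time: compressing [tau] by [val f p] along
   [alpha p] gives a positive functional, to which [pos_star_le] applies. *)
pose chi (c : A) := tau (star (val f p) * alpha p c * val f p).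
have pchi : positive chi.
  split=> [k c c'|c]; rewrite /chi.
    by rewrite (alpha_lin halpha) mulrDr mulrDl mulcZr mulcZl (posD ptau) (posZ ptau).
  rewrite (alphaM halpha) (alpha_star halpha) mulrA -starM -mulrA; exact: ptau.2.
have := pos_star_le pchi a; rewrite /chi (alpha1 halpha) mulr1.
rewrite (alphaM halpha) (alpha_star halpha) mulrA -starM -mulrA => H.
apply: (le_trans H); rewrite ler_wpM2r//; first exact/cRe_ge0/ptau.2.
by rewrite ler_wpM2r ?sqr_ge0// expr2; lra.
Qed.

Lemma shift_bounded z : bounded_adjoint fock_form (shift z) (unshift z).
Proof.
split; first exact: shift_unshift.
by exists 1 => // f; rewrite !mul1r snorm_shift snorm_unshift.
Qed.

Lemma mult_bounded a : bounded_adjoint fock_form (mult a) (mult (star a)).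
Proof.
split; first exact: mult_adj.
exists (2 * rnorm a) => [|f]; first by rewrite mulr_ge0 ?rnorm_ge0.
by split; rewrite ?snorm_mult// -(rnorm_star a) snorm_mult.
Qed.

End Form.
End FockSpace.

Lemma annihilatorMr (R : realType) (A : cstarType R) (J : set A) (a d : A) :
  (forall b c, J b -> J (c * b)) -> annihilator J a -> annihilator J (a * d).
Proof. by move=> Jl Ja b Jb; rewrite -mulrA Ja//; exact: Jl. Qed.

Lemma I_ideal_ones (R : realType) (n : nat) (A : cstarType R) (alpha : Zplus n -> A -> A) :
  unital_dynamical_system alpha ->
  I_ideal alpha (ones n) = annihilator (\bigcap_(i in setT) kernel_at alpha i).
Proof.
(* If [n = 0], then [ones n = 0] and the left side is [[set 0]] by convention; the empty
   intersection on the right is all of [A], whose annihilator is zero because [A] has a unit.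
   Otherwise the only [y] orthogonal to [ones n] is [0]. *)
move=> halpha; rewrite /I_ideal; case: eqP => [n0|n0].
  have no (i : 'I_n) : False by have /ffunP/(_ i) := n0; rewrite !ffunE.
  apply/seteqP; split=> [a -> b _|a Ha]; first by rewrite mul0r.
  by rewrite /= -(mulr1 a); apply: Ha => i; case: (no i).
have supp1 : supp (ones n) = setT by apply/seteqP; split=> // i _; rewrite /supp /= ffunE.
rewrite supp1; apply/seteqP; split=> [a Ha|a Ha y].
  have := Ha 0; rewrite /= (alpha0 halpha); apply.
  by rewrite /orth/= supp1 setIT; apply/seteqP; split=> // i; rewrite /supp /= ffunE.
rewrite /orth/= supp1 setIT => y0.
suff -> : y = 0 by rewrite (alpha0 halpha).
apply/ffunP => i; rewrite ffunE; apply: contrapT => /eqP yi.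
by have : supp y i by []; rewrite y0.
Qed.

Section FockRepresentation.
Variables (R : realType) (n : nat) (A : cstarType R) (alpha : Zplus n -> A -> A).
Variable tau : A -> Cx R.
Hypothesis halpha : unital_dynamical_system alpha.
Hypothesis htau : is_state tau.
Local Notation hs := (fock_form_semi_inner n htau).
Local Notation H := (completion hs : hilbertType R).
Local Notation e := egen.
Implicit Types (F G : completion hs) (f g : fock n A) (a b : A).

(** [lift] takes the adjoint of the operator that it extends: [iso x] extends [shift x], and [rep a]
    extends multiplication by [alpha p a] at each point [p]. *)
Definition fock_pair : @op_pair R n A H := @OpPair R n A H
  (fun a => lift (mult alpha (star a)) : H -> H)
  (fun x => lift (unshift x) : H -> H)
  (fun x => lift (shift x) : H -> H).

Let multE a F f : val (lift (mult alpha (star a)) F) f = val F (mult alpha (star a) f).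
Proof. exact: (liftE (mult_bounded halpha htau a)). Qed.
Let unshiftE x F f : val (lift (unshift x) F) f = val F (unshift x f).
Proof. exact: (liftE (shift_bounded htau x)). Qed.
Let shiftE x F f : val (lift (shift x) F) f = val F (shift x f).
Proof. exact: (liftE (bounded_adjointC hs (shift_bounded htau x))). Qed.

Lemma mult_lin (k : Cx R) a b f :
  mult alpha (k *: a + b) f = k *: mult alpha a f + mult alpha b f.
Proof.
apply: fock_ext => p; rewrite fock_lin !SubK (alpha_lin halpha) mulrDl.
by rewrite mulcZl.
Qed.

Lemma fock_pair_nica : nica_covariant alpha fock_pair.
Proof.
split.
- split.
  + move=> a; split; first by move=> k F G; have := @lift_linear _ _ _ hs _ _ (mult_bounded halpha htau a) k F G; exact.
    exact: (lift_continuous (mult_bounded halpha htau a)).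
  + move=> F k a b; apply: completion_ext => f /=.
    rewrite multE starD starZ mult_lin completion_lin conjCK.
    transitivity (k * val (lift (mult alpha (star a)) F) f + val (lift (mult alpha (star b)) F) f); last by [].
    by rewrite !multE.
  + move=> a b; apply/funext => F; apply: completion_ext => f /=.
    rewrite !multE; congr (val F _); apply: fock_ext => p; rewrite !SubK.
    by rewrite starM (alphaM halpha) mulrA.
  + move=> a; have := @lift_adjoint _ _ _ hs _ _ (mult_bounded halpha htau a).
    by rewrite /= starK.
- split.
  + move=> x; split; first by move=> k F G; have := @lift_linear _ _ _ hs _ _ (shift_bounded htau x) k F G; exact.
    move=> F; apply/eqP; rewrite -(@eqrXn2 _ 2)// -!dotp_norm; apply/eqP.
    rewrite (@lift_adjoint _ _ _ hs _ _ (shift_bounded htau x)); congr (dotp F _).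
    by apply: completion_ext => f; rewrite shiftE unshiftE unshiftK.
  + move=> x; exact: @lift_adjoint _ _ _ hs _ _ (shift_bounded htau x).
  + apply/funext => F; apply: completion_ext => f /=; rewrite unshiftE; congr (val F _).
    by apply: fock_ext => p; rewrite SubK addr0.
  + move=> x y; apply/funext => F; apply: completion_ext => f /=.
    rewrite !unshiftE; congr (val F _); apply: fock_ext => p; rewrite !SubK.
    by rewrite -addrA (addrC y).
- move=> i j ij; apply/funext => F; apply: completion_ext => f /=.
  rewrite unshiftE !shiftE unshiftE; congr (val F _); apply: fock_ext => p; rewrite !SubK.
  have -> : below (e j) (p + e i) = below (e j) p.
    apply: eq_forallb => k; rewrite !ffunE; case: (eqVneq j k) => // <-.
    by rewrite (negbTE ij) addr0.
  case: ifP => // /forallP jp; congr (val f _); apply/ffunP => k; rewrite !ffunE.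
  have := jp k; rewrite ffunE; case: (eqVneq j k) => [<-|] /=.
    by rewrite (negbTE ij) !addr0.
  by rewrite !subn0.
- move=> a i; apply/funext => F; apply: completion_ext => f /=.
  rewrite multE !unshiftE multE; congr (val F _); apply: fock_ext => p; rewrite !SubK.
  by rewrite -(alpha_star halpha) -(alphaD halpha).
Qed.

(** The range projection of the isometry at [egen i] keeps the points with [p i != 0], so each
    factor of the defect keeps those with [p i = 0]. *)
Lemma defect_productE x F f :
  val (defect_product fock_pair x F) f = val F (cut (fun i => x i != 0%N) f).
Proof.
pose D (i : 'I_n) : H -> H := fun G => G - iso fock_pair (e i) (iso_adj fock_pair (e i) G).
have DE i G g : val (D i G) g = val G (cut (pred1 i) g).
  rewrite /D /=; transitivity (val G g - val (lift (unshift (e i)) (lift (shift (e i)) G)) g); first by [].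
  rewrite unshiftE shiftE -completionB; congr (val G _); apply: fock_ext => p.
  rewrite -[val (g - _) p]/(val g p - val (shift (e i) (unshift (e i) g)) p) !SubK.
  have -> : [forall j, pred1 i j ==> (p j == 0%N)] = (p i == 0%N).
    apply/forallP/eqP => [/(_ i)|pi j]; first by rewrite /= eqxx => /eqP.
    by apply/implyP => /eqP ->; rewrite pi.
  have -> : below (e i) p = (p i != 0%N).
    apply/forallP/idP => [/(_ i)|pi j]; first by rewrite ffunE eqxx -lt0n.
    by rewrite ffunE; case: (eqVneq i j) => [<-|//]; rewrite lt0n.
  case: (eqVneq (p i) 0%N) => [_|pi]; first by rewrite subr0.
  rewrite add_vsub ?subrr//; apply/forallP => j; rewrite ffunE.
  by case: (eqVneq i j) => [<-|//]; rewrite lt0n.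
have key (r : seq 'I_n) : forall g, val ((\big[(fun S T : H -> H => S \o T)/idfun]_(i <- r | x i != 0%N) D i) F) g
    = val F (cut (fun i => (i \in r) && (x i != 0%N)) g).
  elim: r => [|i r IH] g.
    rewrite big_nil; congr (val F _); apply: fock_ext => p; rewrite SubK ifT//.
    exact/forallP.
  rewrite big_cons; case: ifP => xi.
    set S := \big[_/_]_(_ <- r | _) _ in IH *.
    transitivity (val (D i (S F)) g); first by [].
    rewrite DE IH; congr (val F _); apply: fock_ext => p; rewrite !SubK.
    have -> : [forall j, (j \in i :: r) && (x j != 0%N) ==> (p j == 0%N)] =
        [forall j, (j \in r) && (x j != 0%N) ==> (p j == 0%N)] && [forall j, pred1 i j ==> (p j == 0%N)].
      apply/forallP/andP => [Hp|[/forallP H1 /forallP H2] j].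
        split; apply/forallP => j; apply/implyP; have := Hp j; rewrite inE.
          by move=> /implyP Hj /andP[jr xj]; apply: Hj; rewrite jr orbT.
        by move=> _ /eqP ->; have := Hp i; rewrite inE eqxx xi.
      rewrite inE; apply/implyP => /andP[/orP[/eqP ->|jr] xj].
        by have := H2 i; rewrite /= ?eqxx ?inE ?eqxx.
      by have := H1 j; rewrite jr xj.
    by case: [forall j, _ ==> _]; case: [forall j, _ ==> _].
  rewrite IH; congr (val F _); apply: fock_ext => p; rewrite !SubK.
  congr (if _ then _ else _); apply: eq_forallb => j; rewrite inE.
  by case: (eqVneq j i) => [->|//]; rewrite xi !andbF.
rewrite -[LHS]/(val ((\big[(fun S T : H -> H => S \o T)/idfun]_(i < n | x i != 0%N) D i) F) f).
rewrite key; congr (val F _); apply: fock_ext => p; rewrite !SubK.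
by congr (if _ then _ else _); apply: eq_forallb => j; rewrite mem_index_enum.
Qed.

Hypothesis tau_tracial : tracial tau.
Hypothesis tau_vanish : forall a, I_ideal alpha (ones n) a -> tau a = 0.

(* By Cauchy-Schwarz, [tau (u^* c c^* u) = tau (c^* u u^* c)] is controlled by
   [tau (c c^* c c^* )], where [c c^* c c^*] lies in the annihilator. *)
Lemma annihilator_null (c u : A) :
  annihilator (\bigcap_(i in setT) kernel_at alpha i) c ->
  tau (star (star c * u) * (star c * u)) = 0.
Proof.
move=> Hc; have pt := state_positive htau.
set J := \bigcap_(i in _) _ in Hc *.
have Jl b d : J b -> J (d * b).
  move=> Jb i _; have := Jb i I; rewrite /kernel_at /= (alphaM halpha) => ->.
  by rewrite mulr0.
have Hcc := annihilatorMr (star c) Jl Hc.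
rewrite starM starK -mulrA (tau_tracial (star u)) -mulrA.
rewrite (tau_tracial c) -!mulrA.
have -> : star c * (u * (star u * c)) = star c * (u * star u * c) by rewrite !mulrA.
rewrite (tau_tracial (star c)) -!mulrA mulrA.
have := pos_CauchySchwarz pt (c * star c) (u * star u).
rewrite !starM !starK.
have -> : tau (c * star c * (c * star c)) = 0.
  apply: tau_vanish; rewrite (I_ideal_ones halpha) => b Jb.
  by rewrite -[LHS]mulrA (Hcc b Jb) mulr0.
rewrite cRe0 mul0r => h.
apply: cabs_eq0; apply/eqP; rewrite -sqrf_eq0 eq_le sqr_ge0 andbT.
by move: h; rewrite !mulrA.
Qed.

(** The cut leaves points [p] orthogonal to [x]. There [alpha p a] annihilates the intersection of
    the kernels over [supp x], a fortiori the smaller intersection over all indices, so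
    [annihilator_null] makes every coefficient a null vector. *)
Lemma fock_pair_cuntz : cuntz_nica_covariant alpha fock_pair.
Proof.
split; first exact: fock_pair_nica.
move=> x a; rewrite /I_ideal; case: eqP => [_ ->|x0 Ha].
  apply/funext => F; apply: completion_ext => f /=; rewrite multE star0.
  have -> : mult alpha 0 f = 0.
    apply: fock_ext => p; rewrite SubK.
    by rewrite (alpha_zero halpha) mul0r.
  by rewrite -(subrr (0 : fock n A)) completionB subrr.
apply/funext => F; apply: completion_ext => f /=; rewrite multE defect_productE.
set g := cut _ _.
suff g0 : snorm (fock_form tau) g = 0.
  by apply: cabs_eq0; apply/eqP; rewrite eq_le cabs_ge0 andbT;
     have := completion_bound F g; rewrite g0 mulr0.
rewrite /snorm /sq /fock_form /psum big1 ?sqrtr0// => p _.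
rewrite /g !SubK; case: ifP => [/forallP px|_]; last by rewrite mulr0 (pos0 (state_positive htau)).
rewrite (alpha_star halpha); apply: annihilator_null => b Jb.
have := Ha p; rewrite /orth/=; apply; last by move=> i _; exact: Jb.
apply/seteqP; split=> // i [/= pi xi]; move: pi; rewrite /supp/=.
by have := px i; move: xi; rewrite /supp/= => -> /= /eqP ->.
Qed.

End FockRepresentation.

(** * Existence of the KMS state attached to a trace *)

Section ExistenceOfState.
Variables (R : realType) (n : nat) (A : cstarType R) (alpha : Zplus n -> A -> A).
Variables (N : cstarType R) (rho : A -> N) (v : Zplus n -> N).
Variables (lam : 'I_n -> R) (beta : R) (tau : A -> Cx R).
Hypothesis halpha : unital_dynamical_system alpha.
Hypothesis hN : is_NO alpha rho v.
Hypothesis hbeta : forall k : 'I_n, 0 < lam k * beta.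
Hypothesis htau : is_state tau.
Hypothesis tau_tracial : tracial tau.
Hypothesis tau_vanish : forall a, I_ideal alpha (ones n) a -> tau a = 0.

Lemma state_alpha (psi : A -> Cx R) x : is_state psi -> is_state (fun a => psi (alpha x a)).
Proof. by case: halpha => ah a1 _ _; exact: state_hom. Qed.

Lemma orbit_bounded (psi : A -> Cx R) a : is_state psi -> cbounded (fun w => psi (alpha w a)).
Proof.
by move=> hpsi; exists (2 * rnorm a) => w; exact: (state_le a (state_alpha w hpsi)).
Qed.

Local Notation hs := (fock_form_semi_inner n htau).
Local Notation H := (completion hs : hilbertType R).
Let hv : covariant_relations alpha rho v := (NO_relations halpha hN).1.

(** These are the vector states at [delta w]. A monomial [(x, a, y)] moves [delta w] to position
    [w - y + x] with coefficient [alpha_{w - y}(a)] if [y <= w] and kills it otherwise; pairing with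
    [delta w] keeps only [x = y]. *)
Lemma fock_vector_states : exists om : Zplus n -> N -> Cx R,
  (forall w, is_state (om w)) /\
  forall w x a y, om w (monomial rho v x a y) =
    if (x == y) && below x w then tau (alpha (vsub w x) a) else 0.
Proof.
have [_ _ _ univ] := hN.
have cuntz := fock_pair_cuntz halpha htau tau_tracial tau_vanish.
have [Th [[Thc Thl ThM Thadj] ThE]] := univ H (fock_pair alpha htau) cuntz.
have [rho1 v0] := (cr_rho1 hv, cr_v0 hv).
have rep1 F : lift (mult alpha (star 1)) F = F :> completion hs.
  apply: completion_ext => f; rewrite (liftE (mult_bounded halpha htau 1)).
  by congr (val F _); apply: fock_ext => p; rewrite SubK star1 (alpha1 halpha) mul1r.
have Thv x F : Th (v x) F = lift (unshift x) F.
  by have := ThE x 1; rewrite rho1 mulr1 => ->; rewrite /= rep1.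
have Th1 F : Th 1 F = F.
  by rewrite -v0 Thv; apply: completion_ext => f; rewrite (liftE (shift_bounded htau 0));
     congr (val F _); apply: fock_ext => p; rewrite SubK addr0.
have Thvs y : Th (star (v y)) = lift (shift y).
  apply: (@adjoint_unique R H (Th (v y))); first exact: Thadj.
  have -> : Th (v y) = lift (unshift y) by apply/funext => F; exact: Thv.
  exact: (@lift_adjoint _ _ _ hs _ _ (shift_bounded htau y)).
pose d w : H := embed hs (delta A w).
exists (fun w b => dotp (Th b (d w)) (d w)); split=> [w|w x a y].
  split=> [k a b|a|].
  - by rewrite (Thl (d w)) (siDl (@dotp_semi_inner R H)) (siZl (@dotp_semi_inner R H)).
  - rewrite ThM /= (adjointC (Thadj a)) dotp_norm exprn_ge0//.
  - rewrite Th1 -[LHS]/(dot (d w) (d w)) dot_embed /=.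
    rewrite (@fock_formE _ _ _ _ htau _ _ [fset w]%fset); last by move=> p; rewrite SubK inE => /negbTE ->.
    by rewrite /psum big_seq_fset1 !SubK eqxx star1 mul1r; case: htau.
have -> : Th (monomial rho v x a y) (d w) = embed hs (shift x (mult alpha a (unshift y (delta A w)))).
  rewrite /monomial ThM /= ThE Thvs /=.
  rewrite /d (lift_embed hs (bounded_adjointC hs (shift_bounded htau y))).
  by rewrite (lift_embed hs (mult_bounded halpha htau a)) (lift_embed hs (shift_bounded htau x)).
rewrite -[LHS]/(dot _ (d w)) dot_embed /=.
have sC := si_conj hs; rewrite sC (@fock_formE _ _ _ _ htau _ _ [fset w]%fset); last first.
  by move=> p; rewrite SubK inE => /negbTE ->.
rewrite /psum big_seq_fset1 -(pos_conj (state_positive htau)) starM starK.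
rewrite {1}/delta !SubK eqxx star1 mul1r.
have [xw|xw] := boolP (below x w); last by rewrite andbF (pos0 (state_positive htau)).
rewrite andbT; have -> : (vsub w x + y == w) = (x == y).
  apply/eqP/eqP => [E|<-]; last exact: add_vsub.
  apply/ffunP => i; have := congr1 (fun f : Zplus n => f i) E.
  rewrite -{2}(add_vsub xw) !ffunE => E'; apply/esym; move: E'.
  exact: addnI.
by case: eqP => _; rewrite ?mulr1 ?mulr0 ?(pos0 (state_positive htau)).
Qed.

(** In the weighted average of the vector states only the [w >= x] contribute; renaming [w - x] to
    [w] releases the factor [weight x], and [kms_sum1] is the normalization. *)
Lemma exists_kms_state : exists psi : N -> Cx R, is_state psi /\
  forall x a y, psi (monomial rho v x a y) =
    (x == y)%:R * ofR (weight lam beta x) * ofR (\prod_(i < n) (1 - ratio lam beta i))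
    * kms_sum lam beta 0 (fun w => tau (alpha w a)).
Proof.
have [om [omS omE]] := fock_vector_states.
set C := ofR (\prod_(i < n) _).
have C0 : 0 <= C.
  rewrite ofR_ge0; apply: prodr_ge0 => i _; rewrite subr_ge0 ltW//.
  exact: ratio_lt1.
have omb b : cbounded (fun w => om w b) by exists (2 * rnorm b) => w; exact: state_le.
exists (fun b => C * kms_sum lam beta 0 (fun w => om w b)); split.
- split=> [k b c|b|].
  + have -> : (fun w => om w (k *: b + c)) = (fun w => k * om w b + om w c).
      by apply/funext => w; have [l _ _] := omS w; rewrite l.
    by rewrite (kms_sum_lin hbeta)//; ring.
  + apply: mulr_ge0 => //; apply: (kms_sum_ge0 hbeta) => // w.
    by case: (omS w).
  + have -> : (fun w => om w 1) = (fun=> 1).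
      by apply/funext => w; have [_ _ ->] := omS w.
    exact: kms_sum1.
- move=> x a y; have tb := orbit_bounded a htau.
  suff -> : kms_sum lam beta 0 (fun w => om w (monomial rho v x a y)) =
      (x == y)%:R * (ofR (weight lam beta x) * kms_sum lam beta 0 (fun w => tau (alpha w a))) by ring.
  have -> : (fun w => om w (monomial rho v x a y)) = (fun w =>
      if (x == y) && below x w then tau (alpha (vsub w x) a) else 0).
    by apply/funext => w; exact: omE.
  apply: has_sum_sum; case: eqP => [xy|_]; last first.
    have -> : kms_family lam beta 0 (fun w : Zplus n => 0) = fun=> 0 :> Cx R.
      by apply/funext => w; rewrite /kms_family mulr0 if_same.
    by rewrite mul0r => r r0; exists fset0 => J _; rewrite /psum big1 ?subrr ?cabs0 ?ltW.
  rewrite mul1r; have := kms_sum_shift hbeta x tb; congr has_sum; apply/funext => w.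
  rewrite [RHS]/kms_family [RHS]ifT; last by apply/forallP.
  by rewrite /below; case: ifP => _ //; rewrite mulr0.
Qed.
End ExistenceOfState.

(** * Entire functions and KMS states *)

Section EntireFunctions.
Variables (R : realType) (B : cstarType R).
Implicit Types (z w h : Cx R) (x y s t k : R).

Definition mkC x y : Cx R := (x +i* y)%C.

Lemma cRe_mkC x y : cRe (mkC x y) = x. Proof. by []. Qed.
Lemma cIm_mkC x y : cIm (mkC x y) = y. Proof. by []. Qed.
Lemma mkC_real x : mkC x 0 = ofR x. Proof. by []. Qed.
Lemma mkC_i y : mkC 0 y = 'i * ofR y.
Proof. by apply: complex_ext; rewrite !cReIm ?cRe_mkC ?cIm_mkC; ring. Qed.
Lemma mkCD x y s t : mkC (x + s) (y + t) = mkC x y + mkC s t. Proof. by []. Qed.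
Lemma mkC_surj z : z = mkC (cRe z) (cIm z). Proof. by case: z. Qed.

Lemma derivable_eps (f : Cx R -> B) z : derivable f z 1 -> exists L : B,
  forall e : R, 0 < e -> exists2 d : R, 0 < d & forall h, cabs h < d ->
    rnorm (f (z + h) - f z - h *: L) <= e * cabs h.
Proof.
move=> /cvg_ex[L HL]; exists L => e e0; have e0' : 0 < ofR e by rewrite ofR_gt0.
move/cvgrPdist_le : HL => /(_ _ e0')/nbhs_ballP[d /= d0 Hd].
exists (cRe d) => [|h hd]; first by rewrite -ofR_gt0 -ge0_ofR// ltW.
have [->|h0] := eqVneq h 0; first by rewrite addr0 scale0r !subrr rnorm0 cabs0 mulr0.
have /= := Hd h; rewrite /ball/= sub0r normrN cabs_ball// => /(_ hd h0).
rewrite rnormE ler_ofR => H.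
have -> : f (z + h) - f z - h *: L = - (h *: (L - h^-1 *: (f (h *: (1 : Cx R) + z) - f z))).
  rewrite scalerBr scalerA mulfV// scale1r opprB (addrC z).
  by rewrite -[h *: (1 : Cx R)]/(h * 1) mulr1.
by rewrite rnormN rnormZ mulrC ler_wpM2r ?cabs_ge0.
Qed.

Lemma eps_derivable (f : Cx R -> B) z (L : B) :
  (forall e : R, 0 < e -> exists2 d : R, 0 < d & forall h, cabs h < d ->
    rnorm (f (z + h) - f z - h *: L) <= e * cabs h) -> derivable f z 1.
Proof.
move=> H; apply/cvg_ex; exists L; apply/cvgrPdist_le => e e0.
have e0' : 0 < cRe e by rewrite -ofR_gt0 -ge0_ofR// ltW.
have [d d0 Hd] := H _ e0'; apply/nbhs_ballP; exists (ofR d) => /=; first by rewrite ofR_gt0.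
move=> h; rewrite /ball/= sub0r normrN cabs_ball ?ofR_gt0// cRe_ofR => hd h0.
rewrite rnormE (ge0_ofR (ltW e0)) ler_ofR.
have ch : 0 < cabs h.
  by rewrite lt_neqAle cabs_ge0 andbT eq_sym; apply: contra h0 => /eqP/cabs_eq0 ->.
rewrite -(ler_pM2l ch) -rnormZ scalerBr scalerA mulfV// scale1r.
have -> : h *: L - (f (h *: (1 : Cx R) + z) - f z) = - (f (z + h) - f z - h *: L).
  by rewrite [RHS]opprB (addrC z) -[h *: (1 : Cx R)]/(h * 1) mulr1.
by rewrite rnormN mulrC; exact: Hd.
Qed.

Definition bounded_functional (chi : B -> Cx R) : Prop := scalar chi /\
  exists2 M : R, 0 <= M & forall b, cabs (chi b) <= M * rnorm b.

Lemma entire_holomorphic (f : Cx R -> B) (chi : B -> Cx R) : entire f ->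
  bounded_functional chi ->
  holomorphic (fun x y => cRe (chi (f (mkC x y)))) (fun x y => cIm (chi (f (mkC x y)))).
Proof.
move=> fe [chil [M M0 HM]] x y; have [L HL] := derivable_eps (fe (mkC x y)).
have chiD b c : chi (b + c) = chi b + chi c by have := chil 1 b c; rewrite scale1r mul1r.
have chi0 : chi 0 = 0 by apply: (addrI (chi 0)); rewrite -chiD !addr0.
have chiZ (k : Cx R) b : chi (k *: b) = k * chi b by have := chil k b 0; rewrite addr0 chi0 addr0.
have chiB b c : chi (b - c) = chi b - chi c by rewrite chiD -scaleN1r chiZ mulN1r.
have M1 : 0 < M + 1 by rewrite ltr_wpDl.
have main (e : R) : 0 < e -> exists2 d : R, 0 < d & forall h k : R, `|h| < d -> `|k| < d ->
    cabs (chi (f (mkC (x + h) (y + k))) - chi (f (mkC x y)) - mkC h k * chi L) <= e * (`|h| + `|k|).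
  move=> e0; have [|d d0 Hd] := HL (e / (M + 1)); first by rewrite divr_gt0.
  exists (d / 2) => [|h k hd kd]; first by rewrite divr_gt0.
  have hk : cabs (mkC h k) <= `|h| + `|k| by exact: cabs_le_ReIm.
  have := Hd (mkC h k); rewrite -mkCD => H.
  rewrite -chiZ -!chiB; apply: (le_trans (HM _)).
  have {}H := H (le_lt_trans hk _); apply: (le_trans (ler_wpM2l M0 (H _))); first by lra.
  have Me : M * (e / (M + 1)) <= e.
    by rewrite mulrCA ler_piMr ?(ltW e0)// ler_pdivrMr// mul1r lerDl.
  rewrite mulrA; apply: ler_pM => //; last exact: cabs_ge0.
  by rewrite mulr_ge0 ?divr_ge0 ?(ltW e0) ?(ltW M1).
exists (cRe (chi L)), (cIm (chi L)); split=> e /main[d d0 Hd]; exists d => // h k hd kd.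
- apply: le_trans (Hd _ _ hd kd); apply: le_trans (cRe_le_cabs _).
  rewrite le_eqVlt; apply/orP; left; apply/eqP; congr (`|_|).
  by rewrite !cReIm !(cRe_mkC, cIm_mkC); ring.
- apply: le_trans (Hd _ _ hd kd); apply: le_trans (cIm_le_cabs _).
  rewrite le_eqVlt; apply/orP; left; apply/eqP; congr (`|_|).
  by rewrite !cReIm !(cRe_mkC, cIm_mkC); ring.
Qed.

Lemma holomorphic_eps (u v : R -> R -> R) x y : holomorphic u v ->
  exists l : Cx R, forall e : R, 0 < e -> exists2 d : R, 0 < d & forall h, cabs h < d ->
    cabs (mkC (u (x + cRe h) (y + cIm h)) (v (x + cRe h) (y + cIm h)) - mkC (u x y) (v x y)
      - h * l) <= e * cabs h.
Proof.
move=> H; have [p [q [Du Dv]]] := H x y; exists (mkC p q) => e e0.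
have e40 : 0 < e / 4 by rewrite divr_gt0.
have [d d0 Hd] := Du _ e40; have [d' d'0 Hd'] := Dv _ e40.
exists (Num.min d d') => [|h]; first by rewrite lt_min d0.
rewrite lt_min => /andP[hd hd'].
have hR := cRe_le_cabs h; have hI := cIm_le_cabs h.
have A := Hd _ _ (le_lt_trans hR hd) (le_lt_trans hI hd).
have A' := Hd' _ _ (le_lt_trans hR hd') (le_lt_trans hI hd').
apply: (le_trans (cabs_le_ReIm _)); rewrite !cReIm !(cRe_mkC, cIm_mkC).
rewrite (_ : _ - u x y - _ = u (x + cRe h) (y + cIm h) - u x y - (p * cRe h + - q * cIm h)); last by ring.
rewrite (_ : v _ _ - v x y - _ = v (x + cRe h) (y + cIm h) - v x y - (q * cRe h + p * cIm h)); last by ring.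
apply: (le_trans (lerD A A')).
have : e / 4 * (`|cRe h| + `|cIm h|) <= e / 4 * (cabs h + cabs h).
  by rewrite ler_wpM2l ?(ltW e40)// lerD.
by lra.
Qed.

Lemma holomorphicM (u v u' v' : R -> R -> R) : holomorphic u v -> holomorphic u' v' ->
  holomorphic (fun x y => u x y * u' x y - v x y * v' x y)
    (fun x y => u x y * v' x y + v x y * u' x y).
Proof.
move=> H H' x y; have [p [q [Du Dv]]] := H x y; have [p' [q' [Du' Dv']]] := H' x y.
exists (p * u' x y + u x y * p' - (q * v' x y + v x y * q')),
  (p * v' x y + u x y * q' + (q * u' x y + v x y * p')); split.
- have := D2D (D2M Du Du') (D2N (D2M Dv Dv')).
  by congr D2; ring.
- have := D2D (D2M Du Dv') (D2M Dv Du').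
  by congr D2; ring.
Qed.

Lemma holomorphicB (u v u' v' : R -> R -> R) : holomorphic u v -> holomorphic u' v' ->
  holomorphic (fun x y => u x y - u' x y) (fun x y => v x y - v' x y).
Proof.
move=> H H' x y; have [p [q [Du Dv]]] := H x y; have [p' [q' [Du' Dv']]] := H' x y.
exists (p - p'), (q - q'); split; last exact: D2D Dv (D2N Dv').
by have := D2D Du (D2N Du'); congr D2; ring.
Qed.

(* [cexpi k z] is exp(i k z). *)
Definition cexpi k z : Cx R :=
  mkC (expR (- k * cIm z) * cos (k * cRe z)) (expR (- k * cIm z) * sin (k * cRe z)).

Lemma cexpi_holomorphic k : holomorphic
  (fun x y => expR (- k * y) * cos (k * x)) (fun x y => expR (- k * y) * sin (k * x)).
Proof.
move=> x y.
have dk (c t : R) : is_derive t 1 (fun t => c * t) c.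
  by apply: (is_derive_eq (is_derive_scal c (is_derive_id t 1))); rewrite mulr1.
have dE : is_derive y 1 (fun y => expR (- k * y)) (expR (- k * y) * - k).
  exact: (is_derive1_comp (is_derive_expR _) (dk (- k) y)).
have dC : is_derive x 1 (fun x => cos (k * x)) (- sin (k * x) * k).
  exact: (is_derive1_comp (is_derive_cos _) (dk k x)).
have dS : is_derive x 1 (fun x => sin (k * x)) (cos (k * x) * k).
  exact: (is_derive1_comp (is_derive_sin _) (dk k x)).
exists (- k * (expR (- k * y) * sin (k * x))), (k * (expR (- k * y) * cos (k * x))); split.
- by have := D2M (D2_y x dE) (D2_x y dC); congr D2; ring.
- by have := D2M (D2_y x dE) (D2_x y dS); congr D2; ring.
Qed.

Lemma cexpi_real k t : cexpi k (ofR t) = expi (k * t).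
Proof.
rewrite /cexpi /expi cIm_ofR mulr0 expR0 !mul1r cRe_ofR.
by apply: complex_ext; rewrite !cReIm ?cRe_mkC ?cIm_mkC; ring.
Qed.

Lemma cexpi_mkC k x y : cexpi k (mkC x y) = ofR (expR (- k * y)) * expi (k * x).
Proof.
apply: complex_ext; rewrite /cexpi /expi !cReIm ?cRe_mkC ?cIm_mkC; ring.
Qed.

Lemma cabs_expi t : cabs (expi t) = 1.
Proof.
apply/eqP; rewrite -(@eqrXn2 _ 2) ?cabs_ge0// cabs_sqr expr1n /expi !cReIm.
by rewrite !(mul0r, mul1r, mulr0, subr0, addr0, add0r) cos2Dsin2.
Qed.

Lemma expiD s t : expi (s + t) = expi s * expi t.
Proof. by apply: complex_ext; rewrite /expi !cReIm ?cosD ?sinD; ring. Qed.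

Lemma expi0 : expi (0 : R) = 1.
Proof. by apply: complex_ext; rewrite /expi !cReIm ?cos0 ?sin0; ring. Qed.

Lemma expi_conj t : (expi t)^* = expi (- t).
Proof. by apply: complex_ext; rewrite /expi !cReIm ?cosN ?sinN; ring. Qed.

Lemma entire_cexpi k (b : B) : entire (fun z => cexpi k z *: b).
Proof.
move=> z; have [l Hl] := holomorphic_eps (cRe z) (cIm z) (cexpi_holomorphic k).
apply: (@eps_derivable _ _ (l *: b)) => e e0.
have b1 : 0 < rnorm b + 1 by rewrite ltr_wpDl ?rnorm_ge0.
have [|d d0 Hd] := Hl (e / (rnorm b + 1)); first by rewrite divr_gt0.
exists d => // h /Hd H.
rewrite scalerA -!scalerBl rnormZ.
have -> : cexpi k (z + h) - cexpi k z - h * l = mkC (expR (- k * (cIm z + cIm h)) * cos (k * (cRe z + cRe h)))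
   (expR (- k * (cIm z + cIm h)) * sin (k * (cRe z + cRe h))) -
   mkC (expR (- k * cIm z) * cos (k * cRe z)) (expR (- k * cIm z) * sin (k * cRe z)) - h * l.
  by rewrite {1}/cexpi cReD cImD.
apply: (le_trans (ler_wpM2r (rnorm_ge0 _) H)).
rewrite mulrAC ler_wpM2r ?cabs_ge0// mulrAC ler_pdivrMr// ler_wpM2l ?(ltW e0)//.
by rewrite lerDl.
Qed.

Lemma entireD (f g : Cx R -> B) : entire f -> entire g -> entire (fun z => f z + g z).
Proof. by move=> fe ge z; apply: derivableD. Qed.

Lemma entire0 : entire (fun _ : Cx R => 0 : B).
Proof. by move=> z; exact: derivable_cst. Qed.

(** [holomorphic_vanish] for the difference. Two functionals and a real shift are allowed so that it
    yields both the translation rule for continuations under [sigma t] and the independence of the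
    chosen extension. *)
Lemma entire_unique (f g : Cx R -> B) (chi chi' : B -> Cx R) (c : R) : entire f -> entire g ->
  bounded_functional chi -> bounded_functional chi' ->
  (forall t : R, chi (f (ofR t)) = chi' (g (ofR (t + c)))) ->
  forall z, chi (f z) = chi' (g (z + ofR c)).
Proof.
move=> fe ge hchi hchi' fg z.
have Hf := entire_holomorphic fe hchi; have Hg := entire_holomorphic ge hchi'.
have Hg' : holomorphic (fun x y => cRe (chi' (g (mkC (x + c) (y + 0)))))
    (fun x y => cIm (chi' (g (mkC (x + c) (y + 0))))).
  move=> x y; have [p [q [Du Dv]]] := Hg (x + c) (y + 0).
  exists p, q; split.
    exact: (@D2_shift R (fun x y => cRe (chi' (g (mkC x y)))) x y _ _ c 0 Du).
  exact: (@D2_shift R (fun x y => cIm (chi' (g (mkC x y)))) x y _ _ c 0 Dv).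
have [|A C] := holomorphic_vanish (holomorphicB Hf Hg') _ (cRe z) (cIm z).
  by move=> x; rewrite addr0 !mkC_real fg !subrr.
move: A C; rewrite -mkC_surj mkCD -mkC_surj mkC_real => /eqP; rewrite subr_eq0 => /eqP A.
by move=> /eqP; rewrite subr_eq0 => /eqP C; exact: complex_ext.
Qed.

End EntireFunctions.

Section KMSTransfer.
Variables (R : realType) (B : cstarType R) (sigma : R -> B -> B).
Implicit Types (a b c : B) (s t : R).
Hypothesis sigma_hom : forall t, star_hom (sigma t).
Hypothesis sigma1 : forall t, sigma t 1 = 1.
Hypothesis sigmaD : forall s t a, sigma (s + t) a = sigma s (sigma t a).

Lemma sigma_lin t (k : Cx R) a b : sigma t (k *: a + b) = k *: sigma t a + sigma t b.
Proof. by have [l _ _] := sigma_hom t; exact: l. Qed.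
Lemma sigmaM t a b : sigma t (a * b) = sigma t a * sigma t b.
Proof. by have [_ m _] := sigma_hom t. Qed.
Lemma sigma_star t a : sigma t (star a) = star (sigma t a).
Proof. by have [_ _ m] := sigma_hom t. Qed.
Lemma sigmaB t a b : sigma t (a - b) = sigma t a - sigma t b.
Proof. by rewrite addrC -scaleN1r sigma_lin scaleN1r addrC. Qed.

Section State.
Variable psi : B -> Cx R.
Hypothesis hpsi : is_state psi.
Let ppsi := state_positive hpsi.

(** [psi \o sigma t] is again a state, so [state_star_le] bounds one factor of Cauchy-Schwarz by the
    norm of [c] itself, uniformly in [t]. *)
Lemma sigma_ler t b c : cabs (psi (b * sigma t c)) <= 2 * rnorm b * rnorm c.
Proof.
rewrite -ler_sqr ?nnegrE ?cabs_ge0 ?mulr_ge0 ?rnorm_ge0//.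
have := pos_CauchySchwarz ppsi (sigma t c) (star b); rewrite starK => H.
apply: (le_trans H); rewrite -sigma_star -sigmaM.
have h1 := state_star_le c (state_hom (sigma_hom t) (sigma1 t) hpsi).
have h2 := state_star_le (star b) hpsi; rewrite rnorm_star starK in h2.
have -> : (2 * rnorm b * rnorm c) ^+ 2 = 2 * rnorm c ^+ 2 * (2 * rnorm b ^+ 2) by ring.
apply: ler_pM; [| |exact: h1|exact: h2]; apply: cRe_ge0.
  by rewrite sigmaM sigma_star; exact: ppsi.2.
by rewrite -{1}(starK b); exact: ppsi.2.
Qed.

Lemma sigma_lel t b c : cabs (psi (sigma t c * b)) <= 2 * rnorm b * rnorm c.
Proof.
rewrite -cabs_conj -(pos_conj ppsi) starM -sigma_star -(rnorm_star b) -(rnorm_star c).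
exact: sigma_ler.
Qed.

Lemma sigma_functional t b : bounded_functional (fun c => psi (b * sigma t c)).
Proof.
split; last by exists (2 * rnorm b) => [|c]; rewrite ?mulr_ge0 ?rnorm_ge0// sigma_ler.
by move=> k a c; rewrite sigma_lin mulrDr mulcZr (posD ppsi) (posZ ppsi).
Qed.

Hypothesis sigma0 : forall a, sigma 0 a = a.

Lemma mul_functional b : bounded_functional (fun c => psi (b * c)).
Proof. by have := sigma_functional 0 b; congr bounded_functional; apply/funext => c; rewrite sigma0. Qed.

Lemma analytic_extP a : analytic sigma a ->
  entire (analytic_ext sigma ^~ a) /\ forall t, analytic_ext sigma (ofR t) a = sigma t a.
Proof. by move=> [f hf]; exact: (xgetPex (fun=> 0) (ex_intro _ f hf)). Qed.

(** [analytic_ext] is an extension picked by choice; seen through [psi] all extensions agree, so an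
    explicit one can be substituted. *)
Lemma psi_extension a b (g : Cx R -> B) : analytic sigma a -> entire g ->
  (forall t, g (ofR t) = sigma t a) ->
  forall z, psi (b * analytic_ext sigma z a) = psi (b * g z).
Proof.
move=> /analytic_extP[fe fE] ge gE z; have hb := mul_functional b.
have := entire_unique (c := 0) fe ge hb hb _ z; rewrite rmorph0 addr0; apply => t.
by rewrite addr0 fE gE.
Qed.

Variable beta : R.

(* For [a] in the given subalgebra close to [m], the function
   [G z = exp (- i k z) psi (b sigma_z a)] is nearly constant on both edges of the
   strip between the real axis and its translate by [i beta]. *)
Lemma KMS_eigen m (k : R) : is_KMS sigma beta psi ->
  (forall t, sigma t m = expi (k * t) *: m) ->
  forall b, psi (m * b) = ofR (expR (- (k * beta))) * psi (b * m).
Proof.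
move=> [_ [D [Dsub Dan Dd Dinv DKMS]]] sm.
pose E := expR (- (k * beta)).
have dense_approx c (d : R) : 0 < d -> exists2 c', D c' & rnorm (c - c') <= d.
  move=> d0; have d0' : 0 < ofR d by rewrite ofR_gt0.
  have [||c' [Hc' Dc']] := Dd (ball c (ofR d)).
  - by exists c; exact: ballxx.
  - exact: ball_open.
  by exists c' => //; move: Hc'; rewrite -ball_normE /ball_/= rnormE ltr_ofR; exact: ltW.
have main b : D b -> psi (b * m) = ofR (expR (k * beta)) * psi (m * b).
  move=> Db.
  have est (e : R) : 0 < e -> `|cRe (psi (b * m)) - cRe (ofR (expR (k * beta)) * psi (m * b))| <= 2 * e
     /\ `|cIm (psi (b * m)) - cIm (ofR (expR (k * beta)) * psi (m * b))| <= 2 * e.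
    move=> e0; pose K := 2 * rnorm b * (1 + expR (k * beta)) + 1.
    have K0 : 0 < K by rewrite ltr_wpDl// !mulr_ge0 ?rnorm_ge0// addr_ge0// expR_ge0.
    have [|a Da am] := dense_approx m (e / K); first by rewrite divr_gt0.
    have bound1 : 2 * rnorm b * rnorm (m - a) <= e.
      apply: (@le_trans _ _ (K * (e / K))); last by rewrite mulrCA mulfV ?mulr1// gt_eqF.
      apply: ler_pM; rewrite ?mulr_ge0 ?rnorm_ge0// /K.
      by have := expR_ge0 (k * beta); have := rnorm_ge0 b; nra.
    have bound2 : expR (k * beta) * (2 * rnorm b * rnorm (m - a)) <= e.
      rewrite mulrA; apply: (@le_trans _ _ (K * (e / K))); last by rewrite mulrCA mulfV ?mulr1// gt_eqF.
      apply: ler_pM; rewrite ?mulr_ge0 ?rnorm_ge0 ?expR_ge0// /K.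
      by have := expR_ge0 (k * beta); have := rnorm_ge0 b; nra.
    have [fe fE] := analytic_extP (Dan _ Da).
    set f := analytic_ext sigma ^~ a in fe.
    have {}fE t : f (ofR t) = sigma t a by exact: fE.
    have shift t z : psi (b * sigma t (f z)) = psi (b * f (z + ofR t)).
      apply: (entire_unique fe fe (sigma_functional t b) (mul_functional b)) => s.
      by rewrite /= !fE addrC sigmaD.
    have top t : psi (b * f (ofR t + 'i * ofR beta)) = psi (sigma t a * b).
      rewrite (DKMS _ _ (Dinv t a Da) Db).
      have [ge gE] := analytic_extP (Dan _ (Dinv t a Da)).
      rewrite addrC; apply/esym.
      apply: (entire_unique ge fe (mul_functional b) (mul_functional b)) => s.
      by rewrite gE fE sigmaD.
    have Hf := holomorphicM (cexpi_holomorphic (- k)) (entire_holomorphic fe (mul_functional b)).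
    pose G x y := cexpi (- k) (mkC x y) * psi (b * f (mkC x y)).
    have GE x y : cRe (G x y) = expR (- - k * y) * cos (- k * x) * cRe (psi (b * f (mkC x y))) -
        expR (- - k * y) * sin (- k * x) * cIm (psi (b * f (mkC x y))) by rewrite /G /cexpi !cReIm.
    have GE' x y : cIm (G x y) = expR (- - k * y) * cos (- k * x) * cIm (psi (b * f (mkC x y))) +
        expR (- - k * y) * sin (- k * x) * cRe (psi (b * f (mkC x y))) by rewrite /G /cexpi !cReIm.
    have HG : holomorphic (fun x y => cRe (G x y)) (fun x y => cIm (G x y)).
      move: Hf; congr holomorphic; apply/funext => x; apply/funext => y; rewrite ?GE ?GE'//.
    have G0 x : cabs (G x 0 - psi (b * m)) <= e.
      have -> : G x 0 - psi (b * m) = - (expi (- k * x) * psi (b * sigma x (m - a))).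
        rewrite /G mkC_real cexpi_real fE sigmaB sm mulrBr (posB ppsi) mulcZr (posZ ppsi).
        rewrite mulrBr mulrA -expiD (_ : - k * x + k * x = 0); last by ring.
        by rewrite expi0 mul1r opprB.
      rewrite cabsN cabsM cabs_expi mul1r; apply: le_trans bound1; exact: sigma_ler.
    (* At height [beta] the factor [exp(- i k z)] has modulus [expR (k * beta)], hence the
       constant. *)
    have G1 x : cabs (G x beta - ofR (expR (k * beta)) * psi (m * b)) <= e.
      have -> : G x beta - ofR (expR (k * beta)) * psi (m * b) =
          - (ofR (expR (k * beta)) * (expi (- k * x) * psi (sigma x (m - a) * b))).
        rewrite /G {2}(mkC_surj (mkC x beta)) cRe_mkC cIm_mkC.
        rewrite (_ : f (mkC x beta) = f (ofR x + 'i * ofR beta)); last first.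
          by congr f; apply: complex_ext; rewrite !cReIm ?cRe_mkC ?cIm_mkC; ring.
        rewrite top cexpi_mkC opprK sigmaB sm mulrBl (posB ppsi) mulcZl (posZ ppsi).
        rewrite (mulrBr (expi _)) (mulrA (expi _) (expi _)) -expiD (_ : - k * x + k * x = 0); last by ring.
        by rewrite expi0; ring.
      rewrite cabsN !cabsM cabs_expi mul1r cabs_ofR ger0_norm ?expR_ge0//.
      apply: le_trans bound2; rewrite ler_wpM2l ?expR_ge0//; exact: sigma_lel.
    (* By [shift] and [sigma_ler] only the norm of [f] along the compact segment between [0] and
       [i beta] matters. *)
    have [M HM] : exists M : R, forall x y, 0 <= x -> Num.min 0 beta <= y <= Num.max 0 beta ->
        cabs (G x y) <= M.
      pose h (y : R) := rnorm (f (mkC 0 y)).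
      have hc : continuous h.
        move=> y; apply/cvgrPdist_le => r r0.
        have [L HL] := derivable_eps (fe (mkC 0 y)).
        have [d d0 Hd] := HL 1 ltr01.
        have c0 : 0 < 1 + rnorm L by rewrite ltr_pwDl ?rnorm_ge0.
        apply/nbhs_ballP; exists (Num.min d (r / (1 + rnorm L))) => /=.
          by rewrite lt_min d0 divr_gt0.
        move=> y'; rewrite /ball/= lt_min => /andP[y'd y'r].
        have ch : cabs (mkC 0 (y' - y)) = `|y' - y|.
          have -> : mkC 0 (y' - y) = 'i * ofR (y' - y) by exact: mkC_i.
          by rewrite cabsM cabs_ofR {1}/cabs normCi mul1r.
        have := Hd (mkC 0 (y' - y)); rewrite ch distrC => /(_ y'd).
        rewrite -mkCD addr0 addrCA subrr addr0 mul1r => H.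
        have H1 : rnorm (f (mkC 0 y') - f (mkC 0 y)) <= (1 + rnorm L) * `|y - y'|.
          rewrite -(subrK (mkC 0 (y' - y) *: L) (f (mkC 0 y') - _)).
          apply: (le_trans (rnormD _ _)); rewrite rnormZ ch (distrC y') mulrDl mul1r.
          by rewrite (mulrC (rnorm L)) lerD.
        have H2 : (1 + rnorm L) * `|y - y'| <= r.
          by rewrite mulrC -ler_pdivlMr// ltW.
        apply: le_trans H2; apply: le_trans H1; rewrite /h ler_norml; apply/andP; split.
          have := rnormD (f (mkC 0 y') - f (mkC 0 y)) (f (mkC 0 y)).
          by rewrite subrK; lra.
        have := rnormD (f (mkC 0 y) - f (mkC 0 y')) (f (mkC 0 y')).
        by have := rnormN (f (mkC 0 y') - f (mkC 0 y)); rewrite opprB subrK; lra.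
      have mm : Num.min 0 beta <= Num.max 0 beta by rewrite ge_min !le_max lexx.
      have [y0 _ Hy0] := EVT_max mm (continuous_subspaceT hc).
      exists (expR (`|k| * `|beta|) * (2 * rnorm b * h y0)) => x y x0 yb.
      rewrite /G cabsM; apply: ler_pM; rewrite ?cabs_ge0//.
        rewrite cexpi_mkC cabsM cabs_expi mulr1 cabs_ofR ger0_norm ?expR_ge0// opprK ler_expR.
        apply: (le_trans (ler_norm _)); rewrite normrM ler_wpM2l//.
        move: yb; rewrite ge_min le_max; have := ler_norm beta; have := ler_norm (- beta).
        by rewrite normrN => A1 A2 /andP[/orP[] ? /orP[] ?]; rewrite ler_norml; have := normr_ge0 beta; lra.
      have -> : mkC x y = mkC 0 y + ofR x.
        by apply: complex_ext; rewrite !cReIm ?cRe_mkC ?cIm_mkC; ring.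
      rewrite -shift; apply: (le_trans (sigma_ler _ _ _)).
      rewrite ler_wpM2l ?mulr_ge0 ?rnorm_ge0//; apply: Hy0.
      by rewrite in_itv.
    (* The real and imaginary parts of [G dz] are the closed forms [Re G dx - Im G dy] and
       [Im G dx + Re G dy]. *)
    split.
    - apply: (@strip_mean R (fun x y => cRe (G x y)) (fun x y => - cIm (G x y)) beta M).
      + move=> x y; have [p [q [Du Dv]]] := HG x y; exists p, (- q), (- p); split=> //.
        exact: D2N.
      + by move=> x _; rewrite -cReB; exact: le_trans (cRe_le_cabs _) (G0 x).
      + by move=> x _; rewrite -cReB; exact: le_trans (cRe_le_cabs _) (G1 x).
      + by move=> x y x0 yb; rewrite normrN; exact: le_trans (cIm_le_cabs _) (HM _ _ x0 yb).
    - apply: (@strip_mean R (fun x y => cIm (G x y)) (fun x y => cRe (G x y)) beta M).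
      + by move=> x y; have [p [q [Du Dv]]] := HG x y; exists q, p, (- q).
      + by move=> x _; rewrite -cImB; exact: le_trans (cIm_le_cabs _) (G0 x).
      + by move=> x _; rewrite -cImB; exact: le_trans (cIm_le_cabs _) (G1 x).
      + by move=> x y x0 yb; exact: le_trans (cRe_le_cabs _) (HM _ _ x0 yb).
  have eq0 (r r' : R) : (forall e : R, 0 < e -> `|r - r'| <= 2 * e) -> r = r'.
    move=> H; apply/eqP; rewrite -subr_eq0 -normr_le0; apply/ler_addgt0Pr => e e0.
    have e20 : 0 < e / 2 by rewrite divr_gt0.
    by have := H _ e20; lra.
  apply: complex_ext; apply: eq0 => e e0; first exact: (est _ e0).1.
  exact: (est _ e0).2.
have EK : ofR (expR (- (k * beta))) * ofR (expR (k * beta)) = 1.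
  by rewrite -rmorphM -expRD addNr expR0 rmorph1.
have mainE b : D b -> psi (m * b) = ofR (expR (- (k * beta))) * psi (b * m).
  by move=> /main ->; rewrite mulrA EK mul1r.
(* From [b] in [D] to all [b] by density, both sides being bounded in [b]. *)
move=> b; apply/eqP; rewrite -subr_eq0; apply/eqP/cabs_eq0/eqP.
rewrite eq_le cabs_ge0 andbT; apply/ler_addgt0Pr => e e0; rewrite add0r.
pose K := 2 * rnorm m * (1 + E) + 1.
have K0 : 0 < K by rewrite ltr_wpDl// !mulr_ge0 ?rnorm_ge0// addr_ge0// expR_ge0.
have [|b' Db' bb'] := dense_approx b (e / K); first by rewrite divr_gt0.
have -> : psi (m * b) - ofR (expR (- (k * beta))) * psi (b * m) =
    psi (m * sigma 0 (b - b')) - ofR (expR (- (k * beta))) * psi (sigma 0 (b - b') * m).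
  rewrite sigma0 mulrBr mulrBl !(posB ppsi) (mainE _ Db'); ring.
apply: (le_trans (cabsD _ _)); rewrite cabsN cabsM cabs_ofR ger0_norm ?expR_ge0// -/E.
have h1 := sigma_ler 0 m (b - b'); have h2 := sigma_lel 0 m (b - b').
have E0 : 0 <= E by exact: expR_ge0.
apply: (@le_trans _ _ (K * (e / K))); last by rewrite mulrCA mulfV ?mulr1// gt_eqF.
apply: (@le_trans _ _ (K * rnorm (b - b'))); last by rewrite ler_wpM2l// ltW.
have := ler_wpM2l E0 h2; have := rnorm_ge0 (b - b'); rewrite /K; nra.
Qed.

End State.
End KMSTransfer.

(** * KMS states on monomials *)

Section KMSStates.
Variables (R : realType) (n : nat) (A : cstarType R) (alpha : Zplus n -> A -> A).
Variables (N : cstarType R) (rho : A -> N) (v : Zplus n -> N).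
Variables (lam : 'I_n -> R) (beta : R) (sigma : R -> N -> N).
Local Notation e := egen.
Implicit Types (a : A) (x y z w : Zplus n) (i j : 'I_n) (t : R).

Hypothesis halpha : unital_dynamical_system alpha.
Hypothesis hv : covariant_relations alpha rho v.
Hypothesis hbeta : forall k : 'I_n, 0 < lam k * beta.
Hypothesis sigma_hom : forall t, star_hom (sigma t).
Hypothesis sigma1 : forall t, sigma t 1 = 1.
Hypothesis sigma0 : forall b, sigma 0 b = b.
Hypothesis sigmaD : forall (s t : R) b, sigma (s + t) b = sigma s (sigma t b).
Hypothesis sigma_monomial : forall t x a y, sigma t (monomial rho v x a y) =
  expi ((pairing x lam - pairing y lam) * t) *: monomial rho v x a y.

Local Notation mono := (monomial rho v).
Local Notation wt := (weight lam beta).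
Local Notation rr := (ratio lam beta).

Let natrDE (p q : nat) : (p + q)%R = (p + q)%N. Proof. by []. Qed.

Lemma vsub_balance x y z w :
  (x + vsub z y == w + vsub y z) = (x + z == w + y).
Proof.
apply/eqP/eqP => E; apply/ffunP => i;
  have := congr1 (fun f : Zplus n => f i) E; rewrite /= !ffunE;
  do ?rewrite natrDE; move: (x i) (y i) (z i) (w i) => *; lia.
Qed.

Lemma vsub_swap x y z w : x + z = w + y -> vsub z y = vsub w x.
Proof.
move=> E; apply/ffunP => i; have := congr1 (fun f : Zplus n => f i) E.
by rewrite /= !ffunE; do ?rewrite natrDE; move: (x i) (y i) (z i) (w i) => *; lia.
Qed.

Lemma vsub_addC y z : vsub z y + y = z + vsub y z.
Proof. by apply/ffunP => i; rewrite !ffunE; do ?rewrite natrDE; move: (y i) (z i) => *; lia. Qed.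

(** The span of the monomials serves as the dense subalgebra. For monomials [(x, a, y)] and
    [(z, b', w)] both products can have a nonzero value only if [x + z = w + y]; then the truncated
    differences pair up by [vsub_swap], the coefficients agree by the trace property, and the
    weights differ by the eigenvalue of [sigma] continued to [i beta]. *)
Lemma KMS_of_formula (psi : N -> Cx R) : is_state psi ->
  (forall x a y, psi (mono x a y) = (x == y)%:R * ofR (wt x) * psi (rho a)) ->
  (forall a b, psi (rho (a * b)) = psi (rho (b * a))) ->
  is_KMS sigma beta psi.
Proof.
move=> hpsi hform htr; have pp := state_positive hpsi; split=> //.
(* An explicit extension is carried along the induction on the span; [psi_extension] passes from it
   to [analytic_ext] at the end. *)
pose ext (b : N) (g : Cx R -> N) := [/\ entire g, forall t, g (ofR t) = sigma t b &
  forall c, mono_span rho v c -> psi (b * c) = psi (c * g ('i * ofR beta))].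
have Hext b : mono_span rho v b -> exists g, ext b g.
  move: b; apply: mono_span_ind => [|x a y b [g [ge gE gK]]].
    exists (fun=> 0); split; first exact: entire0.
      by move=> t; have := sigmaB sigma_hom t 0 0; rewrite !subrr => ->.
    by move=> c _; rewrite mul0r mulr0.
  pose k := pairing x lam - pairing y lam.
  exists (fun u : Cx R => cexpi k u *: mono x a y + g u); split.
  - by apply: entireD => //; exact: entire_cexpi.
  - move=> t; rewrite cexpi_real gE -sigma_monomial.
    by have := sigma_lin sigma_hom t 1 (mono x a y) b; rewrite !scale1r.
  move=> c Hc; rewrite mulrDl mulrDr !(posD pp) gK//; congr (_ + _) => {gK ge gE g}.
  move: c Hc; apply: mono_span_ind => [|z b' w c IH]; first by rewrite mulr0 mul0r.
  rewrite mulrDr mulrDl !(posD pp) IH; congr (_ + _).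
  rewrite !(monomial_mul halpha hv) mulcZr (monomial_mul halpha hv) (posZ pp) !hform !vsub_balance.
  rewrite -[RHS]/(_ * _).
  have -> : (z + x == y + w) = (x + z == w + y) by rewrite (addrC z) (addrC y).
  have [E|_] := eqVneq (x + z) (w + y); last by rewrite !mul0r mulr0.
  have E1 := vsub_swap E.
  have E2 : vsub y z = vsub x w by apply: vsub_swap; exact: esym.
  rewrite E2 E1 htr -E2 !mul1r mulrA; congr (_ * _).
  have -> : cexpi k ('i * ofR beta) = ofR (expR (- (k * beta))).
    rewrite -mkC_i cexpi_mkC mulr0 expi0 mulr1; congr (ofR (expR _)); ring.
  rewrite -rmorphM /weight -expRD; congr (ofR (expR _)).
  rewrite !pairingD /k.
  have := congr1 (fun u => pairing u lam) (vsub_addC y z); rewrite !pairingD E1 => E3.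
  have -> : pairing (vsub w x) lam = pairing z lam + pairing (vsub y z) lam - pairing y lam.
    by rewrite -E3 addrK.
  by ring.
have Hinv t b : mono_span rho v b -> mono_span rho v (sigma t b).
  move: b; apply: mono_span_ind => [|x a y b IH].
    have -> : sigma t 0 = 0; last exact: mono_span0.
    by have := sigmaB sigma_hom t 0 0; rewrite !subrr.
  have -> : sigma t (mono x a y + b) = sigma t (mono x a y) + sigma t b.
    by have := sigma_lin sigma_hom t 1 (mono x a y) b; rewrite !scale1r.
  rewrite sigma_monomial (monomialZ hv); apply: mono_spanD => //; exact: mono_span_monomial.
exists (mono_span rho v); split=> //.
- exact: (mono_span_subalg halpha hv).
- by move=> b /Hext[g [ge gE _]]; exists g; split.
- exact: (mono_span_dense halpha hv).
- move=> b c Hb Hc; have [g [ge gE gK]] := Hext b Hb.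
  have ba : analytic sigma b by exists g; split.
  rewrite (psi_extension sigma_hom sigma1 hpsi sigma0 c ba ge gE); exact: gK.
Qed.

Section OneKMS.
Variable psi : N -> Cx R.
Hypothesis hK : is_KMS sigma beta psi.
Let hpsi : is_state psi := hK.1.
Let pp := state_positive hpsi.

Lemma KMS_monomial x a y b : psi (mono x a y * b) =
  ofR (expR (- ((pairing x lam - pairing y lam) * beta))) * psi (b * mono x a y).
Proof.
exact: (KMS_eigen sigma_hom sigma1 sigmaD hpsi sigma0 hK (fun t => sigma_monomial t x a y)).
Qed.

Lemma pairing0 : pairing (0 : Zplus n) lam = 0.
Proof. by rewrite /pairing big1// => i _; rewrite ffunE mul0r. Qed.

Lemma KMS_rho a b : psi (rho a * b) = psi (b * rho a).
Proof. by rewrite -(monomial_rho hv) KMS_monomial subrr mul0r oppr0 expR0 rmorph1 mul1r. Qed.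

Lemma KMS_v x b : psi (v x * b) = ofR (wt x) * psi (b * v x).
Proof.
have := KMS_monomial x 1 0 b.
by rewrite /monomial (cr_rho1 hv) (cr_v0 hv) star1 !mulr1 pairing0 subr0.
Qed.

Lemma state_rho : is_state (psi \o rho).
Proof. exact: (state_hom (cr_hom hv) (cr_rho1 hv) hpsi). Qed.

Lemma state_rho_alpha w : is_state (fun a => psi (rho (alpha w a))).
Proof. exact: (state_alpha halpha w state_rho). Qed.

(** The right side is free of [w] because [psi \o rho \o alpha w] is a state; this feeds the
    geometric iteration in [KMS_injective]. *)
Lemma psi_rho_bound w a (c : N) :
  cabs (psi (rho (alpha w a) * c)) ^+ 2 <= 2 * rnorm a ^+ 2 * cRe (psi (star c * c)).
Proof.
have := pos_CauchySchwarz pp c (star (rho (alpha w a))); rewrite starK mulrC => H.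
apply: (le_trans H); rewrite ler_wpM2r//; first exact/cRe_ge0/pp.2.
have := state_star_le (star a) (state_rho_alpha w).
rewrite starK rnorm_star (alphaM halpha) (alpha_star halpha) (rhoM hv) (rho_star hv).
by [].
Qed.

Lemma le0_geometric (r c z : R) : 0 <= r < 1 -> 0 <= c -> (forall k, z <= r ^+ k * c) -> z <= 0.
Proof.
move=> /andP[r0 r1] c0 H; apply/ler_addgt0Pr => d d0; rewrite add0r.
have c1 : 0 < c + 1 by rewrite ltr_wpDl.
have /cvgrPdist_le/(_ (d / (c + 1))) : (r ^+ k)%R @[k --> \oo] --> (0 : R).
  by apply: cvg_expr; rewrite ger0_norm.
rewrite divr_gt0// => /(_ isT)[k _ Hk]; apply: (le_trans (H k)).
have := Hk k (leqnn k); rewrite /= sub0r normrN ger0_norm ?exprn_ge0// => Hr.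
apply: (le_trans (ler_wpM2r c0 Hr)).
by rewrite mulrAC ler_pdivrMr// ler_wpM2l ?(ltW d0)// lerDl.
Qed.

(* Moving [v x] around by the KMS condition reproduces the same monomial with a
   factor [wt x < 1]. *)
Lemma KMS_offdiagonal x y a : (forall i, (x i == 0%N) || (y i == 0%N)) -> x != 0 ->
  psi (mono x a y) = 0.
Proof.
move=> disj x0.
have xy : vsub x y = x.
  by apply/ffunP => i; rewrite ffunE; case/orP: (disj i) => /eqP ->; rewrite ?subn0 ?sub0n.
have yx : vsub y x = y.
  by apply/ffunP => i; rewrite ffunE; case/orP: (disj i) => /eqP ->; rewrite ?subn0 ?sub0n.
have step b : psi (mono x b y) = ofR (wt x) * psi (mono x (alpha x b) y).
  rewrite {1}/monomial -mulrA KMS_v -mulrA (star_v_v hv) xy yx mulrA (cov halpha hv).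
  by [].
pose xk k : Zplus n := iter k (fun u => x + u) 0.
have iterE k b : psi (mono x b y) = ofR (wt x ^+ k) * psi (mono x (alpha (xk k) b) y).
  elim: k b => [|k IH] b; first by rewrite expr0 rmorph1 mul1r (alpha0 halpha).
  rewrite step (IH (alpha x b)) -(alphaD halpha) mulrA -rmorphM -exprS.
  by congr (_ * psi (mono x (alpha _ b) y)); rewrite /xk iterS addrC.
have w1 : wt x < 1 by rewrite /weight -expR0 ltr_expR oppr_lt0 pairing_gt0.
(* A bound uniform along the orbit: after Cauchy-Schwarz the KMS condition turns the two squares
   into [wt y] and into [wt x] times a bounded quantity, and both weights are at most 1. *)
have bound w : cabs (psi (mono x (alpha w a) y)) <= 2 * rnorm a.
  have := pos_CauchySchwarz pp (star (v y)) (star (v x * rho (alpha w a))).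
  rewrite !starK -/(mono x (alpha w a) y).
  have -> : psi (v y * star (v y)) = ofR (wt y).
    rewrite KMS_v (cr_iso hv); have [_ _ ->] := hpsi; exact: mulr1.
  have -> : psi (v x * rho (alpha w a) * star (v x * rho (alpha w a))) =
      ofR (wt x) * psi (rho (alpha w (a * star a))).
    rewrite starM -mulrA KMS_v -!mulrA (cr_iso hv) mulr1 (alphaM halpha) (alpha_star halpha).
    by rewrite (rhoM hv) (rho_star hv).
  have b1 := state_star_le (star a) (state_rho_alpha w); rewrite starK rnorm_star in b1.
  have wy : wt y <= 1.
    have [->|y0] := eqVneq y 0; first by rewrite weight0.
    by rewrite /weight -expR0 ler_expR oppr_le0 ltW// pairing_gt0.
  set P := psi (rho _) in b1 *; rewrite cReM cIm_ofR mul0r subr0 !cRe_ofR => H.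
  have P0 : 0 <= cRe P.
    have [_ sp _] := state_rho_alpha w.
    by apply: cRe_ge0; have := sp (star a); rewrite starK.
  rewrite -ler_sqr ?nnegrE ?cabs_ge0 ?mulr_ge0 ?rnorm_ge0//.
  apply: (le_trans H).
  have w0 := weight_gt0 lam beta x; have wy0 := weight_gt0 lam beta y.
  have a0 := rnorm_ge0 a.
  apply: (@le_trans _ _ (1 * (1 * cRe P))); last by nra.
  apply: ler_pM => //; [exact: ltW|by rewrite mulr_ge0// ltW|].
  by apply: ler_pM => //; exact: ltW.
apply: cabs_eq0; apply/eqP; rewrite eq_le cabs_ge0 andbT.
apply: (@le0_geometric (wt x) (2 * rnorm a)).
- by rewrite w1 ltW// weight_gt0.
- by rewrite mulr_ge0// rnorm_ge0.
move=> k; have wk : 0 <= wt x ^+ k by rewrite exprn_ge0// ltW// weight_gt0.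
by rewrite (iterE k) cabsM cabs_ofR ger0_norm//; apply: ler_wpM2l.
Qed.

(** For [x != y], cycling [v x] produces [star (v y) * v x], whose normal form has indices of
    disjoint supports, not both zero; [KMS_offdiagonal] applies to the resulting monomial or to its
    adjoint. *)
Lemma KMS_formula x a y : psi (mono x a y) = (x == y)%:R * ofR (wt x) * psi (rho a).
Proof.
have [<-|xy] := eqVneq x y.
  by rewrite mul1r /monomial -mulrA KMS_v -mulrA (cr_iso hv) mulr1.
rewrite !mul0r {1}/monomial -mulrA KMS_v -mulrA (star_v_v hv) mulrA (cov halpha hv).
rewrite -/(mono _ _ _).
have disj i : (vsub x y i == 0%N) || (vsub y x i == 0%N).
  by rewrite !ffunE !subn_eq0 leq_total.
have disj' i : (vsub y x i == 0%N) || (vsub x y i == 0%N) by rewrite orbC.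
have [x0|x0] := eqVneq (vsub x y) 0; last by rewrite KMS_offdiagonal// mulr0.
have [y0|y0] := eqVneq (vsub y x) 0; last first.
  by rewrite -[mono _ _ _]starK (monomial_star hv) (pos_conj pp) KMS_offdiagonal// rmorph0 mulr0.
by have := vsub_addC x y; rewrite x0 y0 add0r addr0 => E; rewrite E eqxx in xy.
Qed.

End OneKMS.
End KMSStates.

(** * The corner trace *)

Section DefectProducts.
Variables (R : realType) (n : nat) (A : cstarType R) (alpha : Zplus n -> A -> A).
Variables (N : cstarType R) (rho : A -> N) (v : Zplus n -> N).
Local Notation e := egen.
Implicit Types (a : A) (i j : 'I_n) (c : N).

Hypothesis halpha : unital_dynamical_system alpha.
Hypothesis hv : covariant_relations alpha rho v.

(** Padding by [1] beyond [n] gives defects indexed by [nat], so that [Qdefect] is an ordered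
    product that gains one factor on the right at each step. *)
Definition defect_nat (k : nat) : N := oapp (defect v) 1 (insub k).
Definition Qdefect (k : nat) : N := \prod_(0 <= j < k) defect_nat j.

Lemma defect_natE i : defect_nat i = defect v i.
Proof. by rewrite /defect_nat valK. Qed.

Lemma QdefectS i : Qdefect i.+1 = Qdefect i * defect v i.
Proof. by rewrite /Qdefect big_nat_recr//= defect_natE. Qed.

Lemma Qdefect_full : Qdefect n = \prod_(i < n) defect v i.
Proof. by rewrite /Qdefect big_mkord; apply: eq_bigr => i _; rewrite defect_natE. Qed.

Lemma comm_Qdefect c k : (forall i, (i < k)%N -> GRing.comm c (defect v i)) ->
  GRing.comm c (Qdefect k).
Proof.
move=> H; rewrite /Qdefect big_seq; apply: commr_prod => j.
rewrite mem_index_iota => /andP[_ jk]; rewrite /defect_nat.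
by case: insubP => [i _ ij|_]; [apply: H; rewrite ij|exact: commr1].
Qed.

Lemma v_comm_defect i j : i != j -> GRing.comm (v (e i)) (defect v j).
Proof.
move=> ij; apply: (commrB (commr1 _)); apply: commrM; last exact: (cr_nica hv).
by rewrite /GRing.comm -!(cr_vD hv) addrC.
Qed.

Lemma defect_star i : star (defect v i) = defect v i.
Proof. by rewrite /defect starB star1 starM starK. Qed.

Lemma comm_star c d : GRing.comm c d -> GRing.comm (star c) (star d).
Proof. by rewrite /GRing.comm -!starM => ->. Qed.

Lemma vs_comm_defect i j : i != j -> GRing.comm (star (v (e i))) (defect v j).
Proof. by move=> ij; rewrite -(defect_star j); apply/comm_star/v_comm_defect. Qed.

Lemma rho_comm_defect a i : GRing.comm (rho a) (defect v i).
Proof.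
apply: (commrB (commr1 _)); rewrite /GRing.comm mulrA (cr_cov hv) -!mulrA; congr (_ * _).
by rewrite (cov_star halpha hv).
Qed.

Lemma defect_comm i j : i != j -> GRing.comm (defect v i) (defect v j).
Proof.
move=> ij; apply/commr_sym/(commrB (commr1 _))/commrM; apply/commr_sym.
  exact: v_comm_defect.
exact: vs_comm_defect.
Qed.

Lemma defect_idem i : defect v i * defect v i = defect v i.
Proof.
rewrite {2}/defect mulrBr mulr1 {1 2}/defect mulrA mulrBl mul1r.
by rewrite -(mulrA (v (e i))) (cr_iso hv) mulr1 subrr mul0r subr0.
Qed.

Lemma rho_comm_Q a k : GRing.comm (rho a) (Qdefect k).
Proof. by apply: comm_Qdefect => i _; exact: rho_comm_defect. Qed.

(** Only indices below [i] occur in [Qdefect i], and their defects commute with [v (e i)] by Nica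
    covariance. *)
Lemma v_comm_Q i : GRing.comm (v (e i)) (Qdefect i).
Proof.
apply: comm_Qdefect => j ji; apply: v_comm_defect.
by rewrite -val_eqE /= gtn_eqF.
Qed.

Lemma defect_comm_Q i : GRing.comm (defect v i) (Qdefect i).
Proof.
apply: comm_Qdefect => j ji; apply: defect_comm.
by rewrite -val_eqE /= gtn_eqF.
Qed.

Lemma Qdefect_projection k : (k <= n)%N ->
  star (Qdefect k) = Qdefect k /\ Qdefect k * Qdefect k = Qdefect k.
Proof.
elim: k => [_|k IH kn]; first by rewrite /Qdefect big_geq// star1 mulr1.
have [Qs QQ] := IH (ltnW kn).
have /= -> := QdefectS (Ordinal kn); have := defect_comm_Q (Ordinal kn).
rewrite /GRing.comm /= => DQ; split; first by rewrite starM Qs defect_star DQ.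
by rewrite -mulrA (mulrA (defect v _)) DQ -mulrA defect_idem mulrA QQ.
Qed.

Variables (lam : 'I_n -> R) (beta : R) (sigma : R -> N -> N).
Hypothesis hbeta : forall k : 'I_n, 0 < lam k * beta.
Hypothesis sigma_hom : forall t, star_hom (sigma t).
Hypothesis sigma1 : forall t, sigma t 1 = 1.
Hypothesis sigma0 : forall b, sigma 0 b = b.
Hypothesis sigmaD : forall (s t : R) b, sigma (s + t) b = sigma s (sigma t b).
Hypothesis sigma_monomial : forall t x a y, sigma t (monomial rho v x a y) =
  expi ((pairing x lam - pairing y lam) * t) *: monomial rho v x a y.
Local Notation rr := (ratio lam beta).

Section OneKMS.
Variable psi : N -> Cx R.
Hypothesis hK : is_KMS sigma beta psi.
Let hpsi : is_state psi := hK.1.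
Let pp := state_positive hpsi.
Let psi_v := KMS_v hv sigma_hom sigma1 sigma0 sigmaD sigma_monomial hK.
Let psi_rho := KMS_rho hv sigma_hom sigma1 sigma0 sigmaD sigma_monomial hK.

(** In the subtracted term [v (e i)] passes [Qdefect i], then [rho a] at the cost of [alpha (e i)],
    and is cycled by the KMS condition to the right end, where it meets its adjoint and cancels. *)
Lemma KMS_Qdefect i a : psi (rho a * Qdefect i.+1) =
  psi (rho a * Qdefect i) - ofR (rr i) * psi (rho (alpha (e i) a) * Qdefect i).
Proof.
rewrite QdefectS /defect mulrBr mulr1 mulrBr (posB pp); congr (_ - _).
rewrite (mulrA (Qdefect i)) -v_comm_Q !mulrA (cr_cov hv) -!mulrA psi_v.
rewrite (weight_egen lam beta); congr (_ * psi _).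
by rewrite -!mulrA (cr_iso hv) mulr1.
Qed.

Lemma KMS_Qdefect1 k : (k <= n)%N ->
  psi (Qdefect k) = ofR (\prod_(i < n | (i < k)%N) (1 - rr i)).
Proof.
elim: k => [_|k IH kn].
  by rewrite /Qdefect big_geq// big_pred0 ?rmorph1//; case: hpsi.
have := KMS_Qdefect (Ordinal kn) 1; rewrite (alpha1 halpha) (cr_rho1 hv) !mul1r /= => ->.
rewrite (IH (ltnW kn)) [in RHS](bigD1 (Ordinal kn))/= ?ltnSn//.
rewrite [in RHS](eq_bigl (fun i : 'I_n => (i < k)%N)); last first.
  move=> i; rewrite ltnS (leq_eqVlt i) -val_eqE /=.
  by case: (ltngtP i k).
by rewrite rmorphM rmorphB/= rmorph1; ring.
Qed.

Let C : R := \prod_(i < n) (1 - rr i).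

Lemma prod_ratio_gt0 : 0 < C.
Proof. by apply: prodr_gt0 => i _; rewrite subr_gt0 ratio_lt1. Qed.

Definition corner_trace (a : A) : Cx R := (ofR C)^-1 * psi (rho a * Qdefect n).

Lemma corner_trace_state : is_state corner_trace.
Proof.
have C0 := prod_ratio_gt0.
split=> [k a b|a|].
- by rewrite /corner_trace (rho_lin hv) mulrDl mulcZl (posD pp) (posZ pp); ring.
- rewrite /corner_trace mulr_ge0 ?invr_ge0 ?ofR_ge0 ?(ltW C0)//.
  have [Qs QQ] := Qdefect_projection (leqnn n).
  (* [Qdefect n] is a projection commuting with the range of [rho], so the corner of a positive
     element is again of the form [star c * c]. *)
  have -> : rho (star a * a) * Qdefect n = star (rho a * Qdefect n) * (rho a * Qdefect n).
    rewrite starM Qs (rhoM hv) -(rho_star hv) -(rho_comm_Q (star a) n).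
    by rewrite -!mulrA (mulrA (Qdefect n)) -(rho_comm_Q a n) -(mulrA (rho a)) QQ.
  exact: pp.2.
- rewrite /corner_trace (cr_rho1 hv) mul1r KMS_Qdefect1//.
  rewrite (eq_bigl xpredT) => [|i]; last by rewrite ltn_ord.
  by rewrite -/C mulVf// gt_eqF// ofR_gt0.
Qed.

Lemma corner_trace_tracial : tracial corner_trace.
Proof.
move=> a b; rewrite /corner_trace !(rhoM hv); congr (_ * _).
by rewrite -mulrA psi_rho -!mulrA rho_comm_Q.
Qed.

Lemma corner_trace_vanish a : rho a * \prod_(i < n) defect v i = 0 -> corner_trace a = 0.
Proof. by rewrite /corner_trace Qdefect_full => ->; rewrite (pos0 pp) mulr0. Qed.

End OneKMS.

(* A family satisfying [KMS_Qdefect] is determined by its last member, since the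
   recursion contracts by the factor [rr i] at each step. *)
Lemma KMS_injective (psi psi' : N -> Cx R) :
  is_KMS sigma beta psi -> is_KMS sigma beta psi' ->
  (forall a, corner_trace psi a = corner_trace psi' a) -> psi = psi'.
Proof.
move=> hK hK' E; have [hpsi hpsi'] := (hK.1, hK'.1).
have C0 := prod_ratio_gt0.
pose d k a := psi (rho a * Qdefect k) - psi' (rho a * Qdefect k).
have dn a : d n a = 0.
  apply/eqP; rewrite subr_eq0; apply/eqP; apply: mulfI (E a).
  by rewrite invr_eq0 gt_eqF// ofR_gt0.
have dS i a : d i.+1 a = d i a - ofR (rr i) * d i (alpha (e i) a).
  by rewrite /d (KMS_Qdefect hK) (KMS_Qdefect hK'); ring.
have bound k : exists2 M : R, 0 <= M & forall w a, cabs (d k (alpha w a)) <= M * (rnorm a + 1).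
  pose s (f : N -> Cx R) := cRe (f (star (Qdefect k) * Qdefect k)).
  have one f : is_state f -> is_KMS sigma beta f -> forall w a, 
      cabs (f (rho (alpha w a) * Qdefect k)) <= (s f + 1) * (2 * (rnorm a + 1)).
    move=> hf hfK w a; have s0 : 0 <= s f by apply: cRe_ge0; case: hf.
    have a0 := rnorm_ge0 a.
    rewrite -ler_sqr ?nnegrE ?cabs_ge0 ?mulr_ge0 ?addr_ge0//.
    apply: (le_trans (psi_rho_bound halpha hv hfK w a (Qdefect k))).
    rewrite -/(s f) !exprMn; have := sqr_ge0 (rnorm a); have := sqr_ge0 (s f).
    rewrite !expr2 => A1 A2.
    rewrite mulrC; apply: ler_pM; rewrite ?mulr_ge0//; nra.
  exists ((s psi + 1) * 2 + (s psi' + 1) * 2).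
    have sp f : is_state f -> 0 <= s f by move=> hf; apply: cRe_ge0; case: hf.
    by have := sp _ hpsi; have := sp _ hpsi'; lra.
  move=> w a; apply: (le_trans (cabsD _ _)); rewrite cabsN mulrDl -!mulrA.
  by apply: lerD; exact: one.
(* Indexed by [n - k] in order to descend from the corner, where the two traces agree, to
   [Qdefect 0 = 1]. Once [d i.+1] vanishes, [dS] becomes a fixed-point relation for [d i] along the
   orbit of [a]. *)
have d0 k : (k <= n)%N -> forall a, d (n - k)%N a = 0.
  elim: k => [_|k IH kn] a; first by rewrite subn0.
  have kl : (n - k.+1 < n)%N by rewrite ltn_subrL/= (leq_trans _ kn).
  pose i := Ordinal kl.
  have dk b : d i b = ofR (rr i) * d i (alpha (e i) b).
    have := dS i b; rewrite (_ : i.+1 = (n - k)%N); last by rewrite /= -subSn// subSS.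
    by rewrite (IH (ltnW kn)) => /esym/eqP; rewrite subr_eq0 => /eqP.
  have [M M0 HM] := bound i.
  rewrite -[(n - k.+1)%N]/(nat_of_ord i).
  apply: cabs_eq0; apply/eqP; rewrite eq_le cabs_ge0 andbT.
  apply: (@le0_geometric R (rr i) (M * (rnorm a + 1))).
  - by rewrite ratio_lt1// andbT expR_ge0.
  - by rewrite mulr_ge0// addr_ge0// rnorm_ge0.
  move=> j; have -> : d i a = ofR (rr i ^+ j) * d i (alpha (iter j (fun u => u + e i) 0) a).
    elim: j => [|j IHj]; first by rewrite expr0 rmorph1 mul1r (alpha0 halpha).
    by rewrite IHj dk exprSr rmorphM mulrA -(alphaD halpha) iterS addrC.
  have rj : 0 <= rr i ^+ j by rewrite exprn_ge0// expR_ge0.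
  by rewrite cabsM cabs_ofR ger0_norm// ler_wpM2l.
have rhoE a : psi (rho a) = psi' (rho a).
  apply/eqP; rewrite -subr_eq0; apply/eqP; have := d0 n (leqnn n) a.
  by rewrite /d subnn /Qdefect big_geq// !mulr1.
apply: (states_eq halpha hv hpsi hpsi') => x a y.
rewrite (KMS_formula halpha hv hbeta sigma_hom sigma1 sigma0 sigmaD sigma_monomial hK).
by rewrite (KMS_formula halpha hv hbeta sigma_hom sigma1 sigma0 sigmaD sigma_monomial hK') rhoE.
Qed.

(** [psi (rho a * Qdefect k)] and the sums over [w] with the first [k] coordinates zero obey the
    same recursion from the same start; at [k = n] only [w = 0] contributes and the constant
    cancels. *)
Lemma corner_trace_kms (psi : N -> Cx R) (tau : A -> Cx R) :
  is_KMS sigma beta psi -> is_state tau ->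
  (forall a, psi (rho a) = ofR (\prod_(i < n) (1 - rr i)) *
     kms_sum lam beta 0 (fun w => tau (alpha w a))) ->
  forall a, corner_trace psi a = tau a.
Proof.
move=> hK htau H; set C := \prod_(i < n) _ in H; have C0 : 0 < C := prod_ratio_gt0.
have key k : (k <= n)%N -> forall a, psi (rho a * Qdefect k) =
    ofR C * kms_sum lam beta k (fun w => tau (alpha w a)).
  elim: k => [_|k IH kn] a; first by rewrite /Qdefect big_geq// mulr1.
  have := KMS_Qdefect hK (Ordinal kn) a; rewrite /= => ->.
  have := kms_sumS hbeta (Ordinal kn) (orbit_bounded halpha a htau); rewrite /= => ->.
  rewrite !(IH (ltnW kn)) mulrBr; congr (_ - _); rewrite mulrCA; congr (_ * (_ * _)).
  by congr kms_sum; apply/funext => w; rewrite (alphaD halpha).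
move=> a; rewrite /corner_trace key// (kms_sum_last hbeta (orbit_bounded halpha a htau)).
by rewrite (alpha0 halpha) mulrA mulVf ?mul1r// gt_eqF// ofR_gt0.
Qed.

End DefectProducts.

(** * The parametrization *)

Section QuotientFlow.
Variables (R : realType) (n : nat) (A : cstarType R).
Variables (NT : cstarType R) (rhoT : A -> NT) (V : Zplus n -> NT).
Variables (NO : cstarType R) (rhoO : A -> NO) (U : Zplus n -> NO).
Variables (q : NT -> NO) (gamma : ('I_n -> Cx R) -> NT -> NT).
Variables (lam : 'I_n -> R) (sigma : R -> NO -> NO).
Hypothesis rho1 : rhoO 1 = 1.
Hypothesis hq : quotient_map rhoT V rhoO U q.
Hypothesis hgamma : gauge_action rhoT V gamma.
Hypothesis hsigma : forall (t : R) (b : NT), sigma t (q b) = q (flow gamma lam t b).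
Implicit Types (s t : R) (x y : Zplus n).

Let q_onto b : exists c, q c = b.
Proof. by have [_ + _ _] := hq => /(_ b I)[c _ <-]; exists c. Qed.

Lemma torus_expi t : torus (fun k : 'I_n => expi (lam k * t)).
Proof. by move=> i; rewrite cabsE cabs_expi. Qed.

(** [sigma] is known only through [q], so each of its properties descends from the gauge action by
    surjectivity of [q]. *)
Lemma flow_hom t : star_hom (sigma t).
Proof.
have [[ql qM qs] _ _ _] := hq; have [gh _ _ _ _] := hgamma.
have [gl gM gs] := gh _ (torus_expi t); split.
- move=> k b c; have [[b' <-] [c' <-]] := (q_onto b, q_onto c).
  by rewrite -ql !hsigma /flow gl ql.
- move=> b c; have [[b' <-] [c' <-]] := (q_onto b, q_onto c).
  by rewrite -qM !hsigma /flow gM qM.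
- by move=> b; have [b' <-] := q_onto b; rewrite -qs !hsigma /flow gs qs.
Qed.

Lemma flow_rho t a : sigma t (rhoO a) = rhoO a.
Proof.
have [_ _ qr _] := hq; have [_ _ _ gr _] := hgamma.
by rewrite -qr hsigma /flow gr//; exact: torus_expi.
Qed.

Lemma flow_one t : sigma t 1 = 1.
Proof. by rewrite -rho1 flow_rho. Qed.

Lemma flow0 b : sigma 0 b = b.
Proof.
have [_ g1 _ _ _] := hgamma; have [c <-] := q_onto b; rewrite hsigma /flow.
have -> : (fun k => expi (lam k * 0)) = (fun=> 1).
  by apply/funext => k; rewrite mulr0 expi0.
by rewrite g1.
Qed.

Lemma flowD s t b : sigma (s + t) b = sigma s (sigma t b).
Proof.
have [_ _ gM _ _] := hgamma; have [c <-] := q_onto b; rewrite !hsigma /flow.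
have -> : (fun k => expi (lam k * (s + t))) =
    (fun k => expi (lam k * s) * expi (lam k * t)).
  by apply/funext => k; rewrite mulrDr expiD.
by rewrite gM//; exact: torus_expi.
Qed.

Lemma expiX t (k : nat) : expi t ^+ k = expi (k%:R * t).
Proof.
elim: k => [|k IH]; first by rewrite mul0r expi0.
by rewrite exprS IH -expiD -natr1 mulrDl mul1r addrC.
Qed.

Lemma flow_U t x : sigma t (U x) = expi (pairing x lam * t) *: U x.
Proof.
have [[ql _ _] _ _ qv] := hq; have [_ _ _ _ gv] := hgamma.
rewrite -qv hsigma /flow gv; last exact: torus_expi.
have qZ k b : q (k *: b) = k *: q b.
  have q0 : q 0 = 0 by have := ql (-1) 0 0; rewrite scaler0 addr0 scaleN1r addNr.
  by have := ql k b 0; rewrite q0 !addr0.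
rewrite qZ; congr (_ *: _).
rewrite /pairing mulr_suml (big_morph (@expi R) (@expiD R) (@expi0 R)).
by apply: eq_bigr => i _; rewrite expiX mulrA.
Qed.

Lemma flow_monomial t x a y : sigma t (monomial rhoO U x a y) =
  expi ((pairing x lam - pairing y lam) * t) *: monomial rhoO U x a y.
Proof.
have [_ sM ss] := flow_hom t.
rewrite /monomial !sM ss !flow_U flow_rho starZ !mulcZl mulcZr scalerA.
by rewrite expi_conj -expiD mulrBl.
Qed.

End QuotientFlow.

Section PointwiseTopology.
Variables (R : realType) (A : cstarType R) (S : set {ptws A -> Cx R}).

Lemma cvg_eval (tau : {ptws A -> Cx R}) (a : A) :
  f a @[f --> within S (nbhs tau)] --> tau a.
Proof.
have F : Filter (within S (nbhs tau)) by exact: within_filter.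
by move: a; apply: (@pointwise_cvgP A (Cx R) _ tau F).1; exact: cvg_within.
Qed.

Lemma within_ptwsP (B : cstarType R) (Phi : {ptws A -> Cx R} -> {ptws B -> Cx R}) :
  (forall tau b, S tau -> Phi f b @[f --> within S (nbhs tau)] --> Phi tau b) ->
  {within S, continuous Phi}.
Proof.
move=> H; apply/subspace_continuousP => tau Stau.
have F : Filter (Phi @ within S (nbhs tau)).
  by apply: fmap_filter; exact: within_filter.
by apply: (@pointwise_cvgP B (Cx R) _ (Phi tau) F).2 => b; exact: H.
Qed.

End PointwiseTopology.

Section Parametrization.
Variables (R : realType) (n : nat) (A : cstarType R) (alpha : Zplus n -> A -> A).
Variables (N : cstarType R) (rho : A -> N) (v : Zplus n -> N).
Variables (lam : 'I_n -> R) (beta : R) (sigma : R -> N -> N).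
Hypothesis halpha : unital_dynamical_system alpha.
Hypothesis hN : is_NO alpha rho v.
Hypothesis hbeta : forall k : 'I_n, 0 < lam k * beta.
Hypothesis sigma_hom : forall t, star_hom (sigma t).
Hypothesis sigma1 : forall t, sigma t 1 = 1.
Hypothesis sigma0 : forall b, sigma 0 b = b.
Hypothesis sigmaD : forall (s t : R) b, sigma (s + t) b = sigma s (sigma t b).
Hypothesis sigma_monomial : forall t x a y, sigma t (monomial rho v x a y) =
  expi ((pairing x lam - pairing y lam) * t) *: monomial rho v x a y.

Local Notation S := (tracial_states_on_quotient alpha).
Local Notation T := (KMS_states sigma beta).
Local Notation wt := (weight lam beta).
Local Notation C := (\prod_(i < n) (1 - ratio lam beta i)).
Let hv : covariant_relations alpha rho v := (NO_relations halpha hN).1.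

Definition orbit_sum (tau : A -> Cx R) a : Cx R := kms_sum lam beta 0 (fun w => tau (alpha w a)).

Definition kms_values (tau : A -> Cx R) (psi : N -> Cx R) : Prop :=
  forall x a y, psi (monomial rho v x a y) =
    (x == y)%:R * ofR (wt x) * ofR C * orbit_sum tau a.

Lemma kms_values_rho tau psi : kms_values tau psi ->
  forall a, psi (rho a) = ofR C * orbit_sum tau a.
Proof.
by move=> H a; rewrite -(monomial_rho hv) H eqxx (weight0 lam beta) rmorph1 !mul1r.
Qed.

Lemma exists_KMS tau : S tau -> exists psi, T psi /\ kms_values tau psi.
Proof.
move=> [htau ttr tv].
have [psi [hpsi H]] := exists_kms_state halpha hN hbeta htau ttr tv.
have Hr := kms_values_rho H; exists psi; split=> //.
apply: (KMS_of_formula halpha hv sigma_hom sigma1 sigma0 sigma_monomial hpsi).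
  by move=> x a y; rewrite Hr H mulrA.
move=> a b; rewrite !Hr /orbit_sum; congr (_ * kms_sum _ _ _ _).
by apply/funext => w; rewrite !(alphaM halpha) ttr.
Qed.

(** The choice is forced: [states_eq] leaves room for at most one such state and [exists_KMS]
    provides it on [S], so the default can only occur outside [S]. *)
Definition kms_extension (tau : {ptws A -> Cx R}) : {ptws N -> Cx R} :=
  xget (fun=> 0) [set psi | T psi /\ kms_values tau psi].

Lemma kms_extensionP tau : S tau ->
  T (kms_extension tau) /\ kms_values tau (kms_extension tau).
Proof.
by move=> /exists_KMS[psi H]; rewrite /kms_extension; case: xgetP => [y _ //|/(_ psi)].
Qed.

Lemma corner_trace_extension tau : S tau ->
  corner_trace rho v lam beta (kms_extension tau) = tau.
Proof.
move=> St; have [hK H] := kms_extensionP St; apply/funext => a.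
have [htau _ _] := St.
exact: (corner_trace_kms halpha hv hbeta sigma_hom sigma1 sigma0 sigmaD sigma_monomial
  hK htau (kms_values_rho H)).
Qed.

Lemma corner_trace_in psi : T psi -> S (corner_trace rho v lam beta psi).
Proof.
move=> hK; split.
- exact: (corner_trace_state halpha hv hbeta sigma_hom sigma1 sigma0 sigmaD sigma_monomial hK).
- exact: (corner_trace_tracial halpha hv sigma_hom sigma1 sigma0 sigmaD sigma_monomial hK).
- by move=> a Ia; apply: (corner_trace_vanish lam hK); exact: (NO_relations halpha hN).2.
Qed.

(** The inverse is [corner_trace]. For surjectivity, the extension of the corner trace of [psi] has
    the same corner trace as [psi], so [KMS_injective] identifies the two. *)
Lemma kms_extension_bij : set_bij S T kms_extension.
Proof.
split=> [tau /kms_extensionP[]//|tau tau' /set_mem St /set_mem St' E|psi hK].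
  by rewrite -(corner_trace_extension St) E corner_trace_extension.
have St := corner_trace_in hK; exists (corner_trace rho v lam beta psi) => //.
apply: (KMS_injective halpha hv hbeta sigma_hom sigma1 sigma0 sigmaD sigma_monomial) => //.
  exact: (kms_extensionP St).1.
by move=> a; rewrite corner_trace_extension.
Qed.

Lemma convex_state (B : cstarType R) (s : R) (f g : B -> Cx R) : 0 <= s <= 1 ->
  is_state f -> is_state g -> is_state (fun b => ofR s * f b + ofR (1 - s) * g b).
Proof.
move=> /andP[s0 s1] [fl fp f1] [gl gp g1]; split=> [k a b|a|].
- by rewrite fl gl; ring.
- by rewrite addr_ge0// mulr_ge0// ofR_ge0// subr_ge0.
- by rewrite f1 g1 !mulr1 -rmorphD addrC subrK rmorph1.
Qed.

Lemma kms_extension_affine (s : R) f g : 0 <= s <= 1 -> S f -> S g ->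
  kms_extension (fun x => ofR s * f x + ofR (1 - s) * g x) =
  (fun y => ofR s * kms_extension f y + ofR (1 - s) * kms_extension g y).
Proof.
move=> s01 Sf Sg; have [[hf ft fv] [hg gt gv]] := (Sf, Sg).
have Sh : S (fun x => ofR s * f x + ofR (1 - s) * g x).
  split; first exact: convex_state.
    by move=> a b; rewrite ft gt.
  by move=> a Ia; rewrite fv// gv// !mulr0 addr0.
have [[Kf Hf] [Kg Hg]] := (kms_extensionP Sf, kms_extensionP Sg).
have [Kh Hh] := kms_extensionP Sh.
(* Both sides are states, so it is enough to compare them on monomials, where the value is linear in
   the trace. *)
apply: (states_eq halpha hv Kh.1 (convex_state s01 Kf.1 Kg.1)) => x a y.
rewrite Hh Hf Hg.
have bf := orbit_bounded halpha a hf; have bg := orbit_bounded halpha a hg.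
have bg' : cbounded (fun w => ofR (1 - s) * g (alpha w a)).
  by case: bg => M HM; exists (cabs (ofR (1 - s)) * M) => w; rewrite cabsM ler_wpM2l ?cabs_ge0.
have b0 : @cbounded R n (fun=> 0) by exists 0 => w; rewrite cabs0.
have -> : orbit_sum (fun x => ofR s * f x + ofR (1 - s) * g x) a =
    ofR s * orbit_sum f a + ofR (1 - s) * orbit_sum g a.
  rewrite /orbit_sum (kms_sum_lin hbeta 0 (ofR s) bf bg'); congr (_ + _).
  have z0 : kms_sum lam beta 0 (fun=> 0) = 0.
    have := kms_sum_lin hbeta 0 (-1) b0 b0.
    have -> : (fun _ : Zplus n => -1 * 0 + 0 : Cx R) = (fun=> 0).
      by apply/funext => w; rewrite mulr0 addr0.
    by move=> ->; rewrite mulN1r addNr.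
  rewrite -[RHS]addr0 -{1}z0 -(kms_sum_lin hbeta 0 (ofR (1 - s)) bg b0).
  by congr kms_sum; apply/funext => w; rewrite addr0.
ring.
Qed.

Lemma kms_family0 tau a : kms_family lam beta 0 (fun w => tau (alpha w a)) =
  KMS_term alpha lam beta tau a.
Proof. by apply/funext => w; rewrite /kms_family ifT//; apply/forallP. Qed.

(** The terms are dominated by [wt w * (2 * rnorm a)] whatever the state, so one finite set [J]
    serves every [f] in [S]; on [J] pointwise convergence is enough. *)
Lemma orbit_sum_cvg tau a (e : R) : S tau -> 0 < e ->
  \forall f \near within S (nbhs tau), cabs (orbit_sum tau a - orbit_sum f a) <= e.
Proof.
move=> St e0; pose fam (f : A -> Cx R) := KMS_term alpha lam beta f a.
have a0 : 0 <= 2 * rnorm a by rewrite mulr_ge0// rnorm_ge0.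
have [M HM] := weight_bounded_by hbeta a0.
have b0 (w : Zplus n) : 0 <= wt w * (2 * rnorm a) by rewrite mulr_ge0// expR_ge0.
have e3 : 0 < e / 3 by rewrite divr_gt0.
have [J HJ] := dominated_has_sum b0 HM e3.
have fb f : S f -> cabs (orbit_sum f a - psum (fam f) J) <= e / 3.
  move=> [hf _ _]; rewrite /fam -kms_family0.
  apply: HJ; last exact/kms_has_sum/(orbit_bounded halpha).
  by apply: kms_family_bound => w; exact: (state_le a (state_alpha halpha w hf)).
have cJ : psum (fam f) J @[f --> within S (nbhs tau)] --> psum (fam tau) J.
  apply: (@cvg_big _ _ +%R) => [|w _].
    exact: add_continuous.
  rewrite /fam /KMS_term; apply: cvgMl_tmp.
  exact: (@cvg_eval _ _ S tau (alpha w a)).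
move/cvgrPdist_le : cJ => /(_ (ofR (e / 3))); rewrite ofR_gt0 => /(_ e3) cJ.
near=> f; have Sf : S f by near: f; exact: withinT.
have : cabs (psum (fam tau) J - psum (fam f) J) <= e / 3.
  by rewrite -ler_ofR -cabsE; near: f.
have -> : orbit_sum tau a - orbit_sum f a = (orbit_sum tau a - psum (fam tau) J) +
   (psum (fam tau) J - psum (fam f) J) - (orbit_sum f a - psum (fam f) J) by ring.
move: (fb _ St) (fb _ Sf) => H1 H2 H3.
apply: (le_trans (cabsD _ _)); rewrite cabsN.
have := cabsD (orbit_sum tau a - psum (fam tau) J) (psum (fam tau) J - psum (fam f) J).
by move: H1 H2 H3; lra.
Unshelve. all: by end_near. Qed.

Lemma kms_extension_continuous : {within S, continuous kms_extension}.
Proof.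
apply: within_ptwsP => tau b St.
have span c : mono_span rho v c -> forall e : R, 0 < e ->
    \forall f \near within S (nbhs tau), cabs (kms_extension tau c - kms_extension f c) <= e.
  move: c; apply: mono_span_ind => [e e0|x a y c IH e e0].
    near=> f; have Sf : S f by near: f; exact: withinT.
    have [[[hf _] _] [[ht _] _]] := (kms_extensionP Sf, kms_extensionP St).
    by rewrite !(pos0 (state_positive _))// subrr cabs0 ltW.
  set k := (x == y)%:R * ofR (wt x) * ofR C.
  have k0 : 0 < cabs k + 1 by rewrite ltr_wpDl ?cabs_ge0.
  have e2 : 0 < e / 2 by rewrite divr_gt0.
  have e3 : 0 < e / 2 / (cabs k + 1) by rewrite divr_gt0.
  near=> f; have Sf : S f by near: f; exact: withinT.
  have [[[hf _] Hf] [[ht _] Ht]] := (kms_extensionP Sf, kms_extensionP St).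
  rewrite (posD (state_positive hf)) (posD (state_positive ht)) Hf Ht opprD addrACA.
  apply: (le_trans (cabsD _ _)); rewrite (splitr e) lerD//; last by near: f; exact: IH.
  rewrite -/k -mulrBr cabsM; apply: (@le_trans _ _ (cabs k * (e / 2 / (cabs k + 1)))).
    by apply: ler_wpM2l; [exact: cabs_ge0|near: f; exact: orbit_sum_cvg].
  by rewrite mulrCA ler_piMr ?ltW// ltr_pdivrMr// mul1r ltrDl.
apply/cvgrPdist_le => e e0.
have e0' : 0 < cRe e by rewrite -ofR_gt0 -ge0_ofR// ltW.
(* Two states, each bounded by twice the norm, cost at most [4 * (e / 8)] on [b - c]; the other half
   of [e] is spent on [c] in the span. *)
have e8 : 0 < cRe e / 8 by rewrite divr_gt0.
have e2 : 0 < cRe e / 2 by rewrite divr_gt0.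
have [c Hc bc] := mono_span_approx halpha hv b e8.
near=> f; have Sf : S f by near: f; exact: withinT.
have [[[hf _] _] [[ht _] _]] := (kms_extensionP Sf, kms_extensionP St).
rewrite cabsE (ge0_ofR (ltW e0)) ler_ofR.
have -> : kms_extension tau b - kms_extension f b =
    (kms_extension tau c - kms_extension f c) +
    (kms_extension tau (b - c) - kms_extension f (b - c)).
  by rewrite (posB (state_positive hf)) (posB (state_positive ht)); ring.
apply: (le_trans (cabsD _ _)).
have H1 : cabs (kms_extension tau c - kms_extension f c) <= cRe e / 2 by near: f; exact: span.
have := cabsD (kms_extension tau (b - c)) (- kms_extension f (b - c)); rewrite cabsN.
have := state_le (b - c) hf; have := state_le (b - c) ht.
by move: H1 bc; lra.
Unshelve. all: by end_near. Qed.

Lemma corner_trace_continuous :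
  {within T, continuous (corner_trace rho v lam beta : {ptws N -> Cx R} -> {ptws A -> Cx R})}.
Proof.
apply: within_ptwsP => psi a hK; rewrite /corner_trace.
by apply: cvgMl_tmp; exact: cvg_eval.
Qed.

Lemma kms_extension_homeomorphism : affine_homeomorphism S T kms_extension.
Proof.
split.
- exact: kms_extension_bij.
- exact: kms_extension_affine.
- exact: kms_extension_continuous.
- exists (corner_trace rho v lam beta); split; last exact: corner_trace_continuous.
  exact: corner_trace_extension.
Qed.

End Parametrization.

Theorem theorem3p13 (R : realType) (n : nat) (A : cstarType R)
    (alpha : Zplus n -> A -> A) (halpha : unital_dynamical_system alpha)
    (NT : cstarType R) (rhoT : A -> NT) (V : Zplus n -> NT)
    (hNT : is_NT alpha rhoT V)
    (NO : cstarType R) (rhoO : A -> NO) (U : Zplus n -> NO)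
    (hNO : is_NO alpha rhoO U)
    (q : NT -> NO) (hq : quotient_map rhoT V rhoO U q)
    (gamma : ('I_n -> Cx R) -> NT -> NT) (hgamma : gauge_action rhoT V gamma)
    (lam : 'I_n -> R)
    (sigma : R -> NO -> NO)
    (hsigma : forall (t : R) (b : NT), sigma t (q b) = q (flow gamma lam t b))
    (beta : R) (hbeta : forall k : 'I_n, 0 < lam k * beta) :
  I_ideal alpha (ones n) = annihilator (\bigcap_(i in setT) kernel_at alpha i) /\
  exists phi : {ptws A -> Cx R} -> {ptws NO -> Cx R},
    affine_homeomorphism (tracial_states_on_quotient alpha)
      (KMS_states sigma beta) phi /\
    forall tau : {ptws A -> Cx R}, tracial_states_on_quotient alpha tau ->
    forall (a : A) (x y : Zplus n),
      cvg (summability.partial_sum (KMS_term alpha lam beta tau a)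
             @ summability.totally) /\
      phi tau (U x * rhoO a * star (U y)) =
        (x == y)%:R * ofR (expR (- (pairing x lam * beta)))
        * ofR (\prod_(i < n) (1 - expR (- (lam i * beta))))
        * summability.sum (KMS_term alpha lam beta tau a).
Proof.
split; first exact: I_ideal_ones halpha.
have rho1 : rhoO 1 = 1 by case: hNO => -[].
have s_hom := flow_hom hq hgamma hsigma.
have s1 := flow_one rho1 hq hgamma hsigma.
have s0 := flow0 hq hgamma hsigma.
have sD := flowD hq hgamma hsigma.
have sm := flow_monomial hq hgamma hsigma.
exists (kms_extension alpha rhoO U lam beta sigma); split.
  exact: (kms_extension_homeomorphism halpha hNO hbeta s_hom s1 s0 sD sm).
move=> tau St a x y; have [htau _ _] := St; split.
  apply: (@cvgP _ _ (kms_sum lam beta 0 (fun w => tau (alpha w a)))).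
  rewrite -kms_family0; apply: has_sum_cvg.
  exact/kms_has_sum/(orbit_bounded halpha).
have := (kms_extensionP halpha hNO hbeta s_hom s1 s0 sm St).2 x a y.
by rewrite /orbit_sum /kms_sum (kms_family0 alpha lam beta tau a).
Qed.
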